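(* Let $d\ge2$, let $\boldsymbol{L}_t=(L^1_t,\dots,L^d_t)^\top$, $t\in\mathbb{R}$, be a $d$-dimensional (two-sided) subordinator with $\mathbb{E}[\|\boldsymbol{L}_1\|]<\infty$, and let $\boldsymbol{\phi}=(\phi_{jk})$ be a $d\times d$ matrix-valued signed measure on $[0,\infty)$ with $\int_0^\infty t^2\,|\phi_{jk}|(\mathrm{d}t)<\infty$ for $j,k=1,\dots,d$. Set $\boldsymbol{\lambda}=-\boldsymbol{\phi}(\{0\})$ and $\boldsymbol{\eta}=\boldsymbol{\phi}(\,\cdot\,\cap(0,\infty))$, and let $$\boldsymbol{h}_\phi(z)=z\boldsymbol{I}_d-\int_{[0,\infty)}e^{-zt}\,\boldsymbol{\phi}(\mathrm{d}t),\qquad z\in\mathbb{C}_+.$$ Assume that $\det(\boldsymbol{h}_\phi(z))\ne0$ for all $z\in\mathbb{C}_+$. Suppose further that all the entries of $\boldsymbol{\eta}$ are non-negative measures and that $\boldsymbol{\lambda}$ is an $M$-matrix. Then the entries of the unique solution $(\boldsymbol{X}_t)_{t\in\mathbb{R}}$, $\boldsymbol{X}_t=(X^1_t,\dots,X^d_t)^\top$, to $$X^j_t-X^j_s=\sum_{k=1}^d\int_s^t\int_{[0,\infty)}X^k_{u-v}\,\phi_{jk}(\mathrm{d}v)\,\mathrm{d}u+L^j_t-L^j_s,\qquad s<t,\ j=1,\dots,d,$$ which is given by $\boldsymbol{X}_t=\int_{-\infty}^t\boldsymbol{g}_\phi(t-s)\,\mathrm{d}\boldsymbol{L}_s$, $t\in\mathbb{R}$,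 with $\boldsymbol{g}_\phi:[0,\infty)\to\mathbb{R}^{d\times d}$ characterized by $\int_0^\infty e^{-ity}\boldsymbol{g}_\phi(t)\,\mathrm{d}t=\boldsymbol{h}_\phi(iy)^{-1}$ for $y\in\mathbb{R}$, are non-negative in the sense that $X^j_t\ge0$ for $j=1,\dots,d$ almost surely for each fixed $t\in\mathbb{R}$.
   Context: $\mathbb{C}_+=\{z\in\mathbb{C}:\operatorname{Re}(z)\ge 0\}$ and $\boldsymbol{I}_d$ is the $d\times d$ identity matrix. A $d$-dimensional subordinator is an $\mathbb{R}^d$-valued Lévy process with entrywise non-negative increments; the two-sided version is $\boldsymbol{L}_t=\boldsymbol{L}^{(1)}_t$ for $t\ge0$ and $\boldsymbol{L}_t=-\boldsymbol{L}^{(2)}_{(-t)-}$ for $t<0$, with $\boldsymbol{L}^{(1)},\boldsymbol{L}^{(2)}$ independent one-sided subordinators with the same law. A signed measure on $[0,\infty)$ is a set function $\mu=\mu_+-\mu_-$ with $\mu_+,\mu_-$ mutually singular finite Borel measures on $[0,\infty)$; $|\mu|=\mu_++\mu_-$. A matrix-valued signed measure is a matrix whose entries are signed measures, and integrals against it are defined entrywise. A solution is a stationary process $(\boldsymbol{X}_t)_{t\in\mathbb{R}}$ with $\mathbb{E}[\|\boldsymbol{X}_0\|]<\infty$ satisfying the displayed equation almost surely for each fixed pair $s<t$. It is known that when $\det(\boldsymbol{h}_\phi(z))\ne0$ for all $z\in\mathbb{C}_+$, the kernel $\boldsymbol{g}_\phi$ exists (with integrable entries, unique up to Lebesgue null sets)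 and the solution exists, is unique, and is given by the stated moving average. A matrix $\boldsymbol{A}\in\mathbb{R}^{d\times d}$ is an $M$-matrix if $\boldsymbol{A}=\alpha\boldsymbol{I}_d-\boldsymbol{B}$ for some $\alpha\in[0,\infty)$ and $\boldsymbol{B}\in\mathbb{R}^{d\times d}$ with non-negative entries and spectral radius $\rho(\boldsymbol{B})\le\alpha$. *)

(* Defs.v *)
From HB Require Import structures.
From mathcomp Require Import all_boot all_order all_algebra.
From mathcomp Require Import all_classical all_reals all_analysis.
From mathcomp Require Export complex.

Set Implicit Arguments.
Unset Strict Implicit.
Unset Printing Implicit Defensive.

Import Order.TTheory GRing.Theory Num.Theory.
Import numFieldNormedType.Exports.

Local Open Scope classical_set_scope.
Local Open Scope ring_scope.
Local Open Scope complex_scope.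

Section Laws.
Context {d : measure_display} {Omega : measurableType d} {R : realType}.
Variable P : probability Omega R.

(* A family (Z i)_i of real random variables is seen as a random element of
   the path space I -> R.  Only the coordinates in D are observed: D restricts
   a process indexed by the whole line to the times t >= 0. *)
Definition cylinder_sigma (I : Type) (D : set I) : set (set (I -> R)) :=
  <<s [set C | exists2 i, D i & exists2 B : set R, measurable B &
               C = [set x | B (x i)]] >>.

Definition same_law (I : Type) (D : set I) (Z Z' : I -> Omega -> R) : Prop :=
  forall A, cylinder_sigma D A ->
    P [set w | A (Z ^~ w)] = P [set w | A (Z' ^~ w)].

(* The product rule for a subfamily is the case A k = setT for the other k. *)
Definition mutually_independent (K : finType) (I : Type) (D : set I)
    (Z : K -> I -> Omega -> R) : Prop :=
  forall A : K -> set (I -> R), (forall k, cylinder_sigma D (A k)) ->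
    fine (P (\bigcap_k [set w | A k (Z k ^~ w)])) =
    \prod_k fine (P [set w | A k (Z k ^~ w)]).

End Laws.

Section Subordinators.
Context {d : measure_display} {Omega : measurableType d} {R : realType}.
Variables (P : probability Omega R) (n : nat).

(* [X j t] is the random variable X^j_t. *)
Definition process := 'I_n -> R -> {RV P >-> R}.

Definition joint (X : process) (i : 'I_n * R) (w : Omega) : R := X i.1 i.2 w.

Definition at_nonneg_times : set ('I_n * R) := [set i | 0 <= i.2].

Definition euclidean_norm (x : 'I_n -> R) : R := Num.sqrt (\sum_j x j ^+ 2).

Definition finite_first_moment (X : process) (t : R) : Prop :=
  (\int[P]_w (euclidean_norm (fun j => X j t w))%:E < +oo)%E.

Definition cadlag (f : R -> R) : Prop :=
  (forall t, 0 <= t -> f s @[s --> t^'+] --> f t) /\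
  (forall t, 0 < t -> cvg (f s @[s --> t^'-])).

(* One-sided processes: the values at negative times play no role. *)
Definition levy_process (L : process) : Prop :=
  [/\ {ae P, forall w, forall j, L j 0 w = 0},
      forall (m : nat) (t : nat -> R),
        0 <= t 0%N -> (forall i, t i <= t i.+1) ->
        mutually_independent P [set: 'I_n]
          (fun (k : 'I_m) j w => L j (t k.+1) w - L j (t k) w),
      forall s t, 0 <= s -> s <= t ->
        same_law P [set: 'I_n] (fun j w => L j t w - L j s w)
                               (fun j w => L j (t - s) w) &
      {ae P, forall w, forall j, cadlag (fun t => L j t w)}].

Definition subordinator (L : process) : Prop :=
  levy_process L /\
  forall s t, 0 <= s -> s <= t ->
    {ae P, forall w, forall j, 0 <= L j t w - L j s w}.

Definition two_sided_subordinator (L : process) : Prop :=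
  exists L1 L2 : process,
    [/\ subordinator L1, subordinator L2,
        mutually_independent P at_nonneg_times
          (fun b : bool => if b then joint L1 else joint L2),
        same_law P at_nonneg_times (joint L1) (joint L2) &
        {ae P, forall w, forall j t,
           (0 <= t -> L j t w = L1 j t w) /\
           (t < 0 -> L j t w = - lim (L2 j s w @[s --> (- t)^'-]))}].

Definition stationary (X : process) : Prop :=
  forall h : R,
    same_law P [set: 'I_n * R] (fun i w => X i.1 (i.2 + h) w) (joint X).

Definition jointly_measurable (X : process) : Prop :=
  forall j, measurable_fun [set: measurableTypeR R * Omega]
              (fun tw : measurableTypeR R * Omega => X j tw.1 tw.2).

End Subordinators.

Section SignedMeasures.
Context {R : realType}.
Local Notation T := (measurableTypeR R).

(* A charge is a finite signed measure; its positive and negative parts do not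
   depend on the Hahn decomposition that is picked. *)
Definition signed_measure := {charge set T -> \bar R}.

Lemma hahn_pair (nu : signed_measure) :
  exists PN : set T * set T, hahn_decomposition nu PN.1 PN.2.
Proof. by have [P [N nuPN]] := Hahn_decomposition nu; exists (P, N). Qed.

Definition pos_part (nu : signed_measure) : {measure set T -> \bar R} :=
  jordan_pos (projT2 (cid (hahn_pair nu))).

Definition neg_part (nu : signed_measure) : {measure set T -> \bar R} :=
  jordan_neg (projT2 (cid (hahn_pair nu))).

Definition abs_measure (nu : signed_measure) :
    {measure set T -> \bar R} :=
  measure_add (pos_part nu) (neg_part nu).

Definition concentrated_nonneg (nu : signed_measure) : Prop :=
  forall A : set T, measurable A -> A `<=` `]-oo, 0[ -> nu A = 0%E.

(* The integral over [0, +oo[. *)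
Definition signed_int (nu : signed_measure) (f : R -> R) : R :=
  (\int[pos_part nu]_(t in `[0, +oo[) f t) -
  (\int[neg_part nu]_(t in `[0, +oo[) f t).

Definition signed_cint (nu : signed_measure) (f : R -> R[i]) : R[i] :=
  signed_int nu (fun t => complex.Re (f t)) +i* signed_int nu (fun t => complex.Im (f t)).

End SignedMeasures.

Arguments signed_measure : clear implicits.

Section Kernel.
Context {R : realType} {n : nat}.
Local Notation mu := (@lebesgue_measure R).

Definition cexp (z : R[i]) : R[i] :=
  (expR (complex.Re z) * cos (complex.Im z)) +i* (expR (complex.Re z) * sin (complex.Im z)).

Definition lambda_mx (phi : 'M[signed_measure R]_n) : 'M[R]_n :=
  \matrix_(j, k) - fine (phi j k [set 0]).

Definition eta_mx (phi : 'M[signed_measure R]_n) (j k : 'I_n)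
    (A : set (measurableTypeR R)) : \bar R :=
  phi j k (A `&` `]0, +oo[).

Definition h_phi (phi : 'M[signed_measure R]_n) (z : R[i]) : 'M[R[i]]_n :=
  z%:M - \matrix_(j, k) signed_cint (phi j k) (fun t => cexp (- z * t%:C)).

Definition half_line_cint (f : R -> R[i]) : R[i] :=
  (\int[mu]_(t in `[0, +oo[) complex.Re (f t)) +i*
  (\int[mu]_(t in `[0, +oo[) complex.Im (f t)).

(* The condition on g that characterizes g_phi up to Lebesgue null sets. *)
Definition is_kernel (phi : 'M[signed_measure R]_n) (g : R -> 'M[R]_n) : Prop :=
  (forall j k, mu.-integrable `[0, +oo[ (fun t => (g t j k)%:E)) /\
  forall y : R,
    \matrix_(j, k) half_line_cint
      (fun t => cexp (- (0 +i* (t * y))) * (g t j k)%:C) =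
    invmx (h_phi phi (0 +i* y)).

Definition spectral_radius (B : 'M[R]_n) : R :=
  sup [set Normc.normc z | z in
         [set z : R[i] | eigenvalue (map_mx (real_complex R) B) z]].

Definition M_matrix (A : 'M[R]_n) : Prop :=
  exists (alpha : R) (B : 'M[R]_n),
    [/\ 0 <= alpha, forall j k, 0 <= B j k, spectral_radius B <= alpha &
        A = alpha%:M - B].

(* The Lebesgue-Stieltjes measure of a nondecreasing right-continuous function,
   and the zero measure for any other function. *)
Definition stieltjes (f : R -> R) : {measure set (measurableTypeR R) -> \bar R} :=
  match pselect (nondecreasing f /\ right_continuous f) with
  | left H =>
      lebesgue_stieltjes_measure
        (HB.pack f (isCumulative.Build R _ R f (proj1 H) (proj2 H))
         : cumulative R R)
  | right _ => mzero
  end.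

End Kernel.

Section Equation.
Context {d : measure_display} {Omega : measurableType d} {R : realType}.
Variables (P : probability Omega R) (n : nat).

(* Joint measurability, a standing convention for processes whose paths are
   integrated, makes the double integral meaningful: with stationarity and the
   moment condition it is almost surely absolutely convergent. *)
Definition solution (phi : 'M[signed_measure R]_n) (L X : process P n) : Prop :=
  [/\ jointly_measurable X, stationary X, finite_first_moment X 0 &
      forall s t, s < t ->
        {ae P, forall w, forall j,
           X j t w - X j s w =
           (\sum_k \int[lebesgue_measure]_(u in `[s, t])
                     signed_int (phi j k) (fun v => X k (u - v) w)) + (L j t w - L j s w)}].

(* The j-th entry of the integral of g (t - s) dL_s over s <= t. *)
Definition moving_average (g : R -> 'M[R]_n) (L : process P n)
    (j : 'I_n) (t : R) (w : Omega) : R :=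
  \sum_k \int[stieltjes (fun s => L k s w)]_(s in `]-oo, t]) g (t - s) j k.

End Equation.

(* Main.v *)
Require Import Defs.
From HB Require Import structures.
From mathcomp Require Import all_boot all_order all_algebra.
From mathcomp Require Import all_classical all_reals all_analysis.
From mathcomp Require Import complex measurable_realfun.
From mathcomp Require Import ring lra.

Import Order.TTheory GRing.Theory Num.Theory.
Import numFieldNormedType.Exports.

Local Open Scope classical_set_scope.
Local Open Scope ring_scope.
Local Open Scope complex_scope.

(** Since the off-diagonal entries of an M-matrix are non-positive and all
    mass of phi away from the origin is non-negative, each phi_jk is a finite
    positive measure m_jk, except that the diagonal entries also carry an atom
    of mass - a_j at the origin.  On the half-line x >= 0 the matrix h_phi(x)
    is therefore a Z-matrix: its off-diagonal entries are non-positive.  It is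
    invertible there, and for large x it maps the vector of ones to a positive
    vector.  Moving x continuously down to 0 preserves the existence of such
    positive vectors ([monotone_at0]), so that h_phi(0) is a monotone matrix
    ([h_real_monotone]): h_phi(0) u >= 0 implies u >= 0.

    Non-negativity.  A solution satisfies
      X_t - X_s = int_s^t (sum_k int X^k_(u-v) m_jk(dv) - a_j X^j_u) du
                  + (L_t - L_s),
    with a non-negative last term.  Let q_j be the supremum over t of the mean
    of the negative part of X^j_t.  A step of length h gives
      q_j <= (1 - a_j h) q_j + h sum_k m_jk(R) q_k + O(h^2),
    because freezing X over the step costs O(h) in the mean.  Dividing by h and
    letting h tend to 0 yields h_phi(0) q <= 0, whence q = 0 by monotonicity
    ([contraction_nonneg], [delay_equation_nonneg]).  This argument applies to
    any mean-bounded solution of the equation with non-negative forcing.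

    Moving average.  Applied with zero forcing to the two differences of two
    solutions, the same principle gives uniqueness ([mean_bounded_solution_le]).
    Hence it suffices that the moving average Z satisfies the equation.  The
    kernel g, extended by zero to the negative axis, satisfies for almost every
    r the deterministic equation
      g(t-r) - g(s-r) = 1(s < r <= t) I
                        + int_s^t (sum of the delayed and damped g)(u-r) du,
    because both sides have the same Fourier transform: this is the identity
    h_phi(iy) h_phi(iy)^-1 = I ([kernel_transform], [kernel_identity]), and an
    integrable function with vanishing transform vanishes almost everywhere
    ([fourier_uniqueness], by Poisson kernels).  Integrating this equation in r
    against the random measure dL gives the equation of Z
    ([kernel_process_equation]).  The exceptional null set of r is harmless and
    the integrals converge since the mean of dL is a multiple of Lebesgue
    measure ([campbell]); joint measurability comes from writing dL as an image
    of Lebesgue measure under the generalized inverse of the path. *)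

Set Implicit Arguments.
Unset Strict Implicit.
Unset Printing Implicit Defensive.

(** * Integration with respect to restricted, image and product measures *)

Lemma ae_weaken {d} {T : measurableType d} {R : realType}
    (mu : {measure set T -> \bar R}) (Q Q' : T -> Prop) :
  (forall x, Q x -> Q' x) -> {ae mu, forall x, Q x} -> {ae mu, forall x, Q' x}.
Proof. by move=> QQ'; apply: filterS. Qed.

Lemma ae_eq_integrable {d} {T : measurableType d} {R : realType}
    (mu : {measure set T -> \bar R}) (D : set T) (f g : T -> \bar R) :
  measurable D -> measurable_fun D g -> ae_eq mu D f g ->
  mu.-integrable D f -> mu.-integrable D g.
Proof.
move=> mD mg fg /integrableP[mf foo]; apply/integrableP; split => //.
apply: le_lt_trans foo; apply: ae_ge0_le_integral => //.
- exact: measurableT_comp.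
- exact: measurableT_comp.
by apply: filterS fg => x /[apply] ->.
Qed.

Section fubini.
Context {d1 d2 : measure_display} {T1 : measurableType d1} {T2 : measurableType d2}
  {R : realType}.
Variables (m1 : {sigma_finite_measure set T1 -> \bar R})
  (m2 : {sigma_finite_measure set T2 -> \bar R}).
Variable f : T1 * T2 -> R.
Hypothesis intf : (m1 \x m2)%E.-integrable setT (EFin \o f).

Lemma Rintegral_prod12 :
  \int[(m1 \x m2)%E]_z f z = \int[m1]_x \int[m2]_y f (x, y).
Proof.
rewrite /Rintegral; apply: (congr1 fine).
rewrite -(integral12_prod_meas1 intf).
apply: ae_eq_integral => //.
- exact: (measurable_fubini_F intf).
- apply/measurable_EFinP; apply: measurableT_comp (measurable_fubini_F intf);
    exact: fine_measurable.
apply: filterS (ae_integrable1 intf) => x /= ix _.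
by rewrite fineK// integrable_fin_num.
Qed.

Lemma Rintegral_prod21 :
  \int[(m1 \x m2)%E]_z f z = \int[m2]_y \int[m1]_x f (x, y).
Proof.
rewrite /Rintegral; apply: (congr1 fine).
rewrite -(integral21_prod_meas1 intf).
apply: ae_eq_integral => //.
- exact: (measurable_fubini_G intf).
- apply/measurable_EFinP; apply: measurableT_comp (measurable_fubini_G intf);
    exact: fine_measurable.
apply: filterS (ae_integrable2 intf) => x /= ix _.
by rewrite fineK// integrable_fin_num.
Qed.

Lemma Rintegral_swap :
  \int[m1]_x \int[m2]_y f (x, y) = \int[m2]_y \int[m1]_x f (x, y).
Proof. by rewrite -Rintegral_prod12 Rintegral_prod21. Qed.

Lemma integrable_Rfubini1 :
  m1.-integrable setT (EFin \o (fun x => \int[m2]_y f (x, y))).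
Proof.
apply: ae_eq_integrable (integrable_fubini_F intf) => //.
  apply/measurable_EFinP; apply: measurableT_comp (measurable_fubini_F intf).
  exact: fine_measurable.
apply: filterS (ae_integrable1 intf) => x /= ix _.
by rewrite fineK// integrable_fin_num.
Qed.

End fubini.

Section product_measure.
Context {d1 d2} {T1 : measurableType d1} {T2 : measurableType d2} {R : realType}
    (m1 : {sigma_finite_measure set T1 -> \bar R})
    (m2 : {sigma_finite_measure set T2 -> \bar R}).
Lemma sigma_finite_prod : sigma_finite setT (product_measure1 m1 m2).
Proof.
by case: (lebesgue_integral_fubini.measure_function_Measure_isSigmaFinite__to__measure_function_isSigmaFinite m1 m2).
Qed.
(** The product measure together with its sigma-finiteness, so that it can
    itself be a factor of a product. *)
Definition sprod : {sigma_finite_measure set (T1 * T2)%type -> \bar R} :=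
  HB.pack (product_measure1 m1 m2) (Measure_isSigmaFinite.Build _ _ _
    (product_measure1 m1 m2) sigma_finite_prod).
End product_measure.

Section image.
Context {d1 d2} {T1 : measurableType d1} {T2 : measurableType d2} {R : realType}.
Variables (mu : {measure set T1 -> \bar R}) (phi : T1 -> T2).
Hypothesis mphi : measurable_fun setT phi.

Definition image_measure : {measure set T2 -> \bar R} :=
  measure_function_pushforward__canonical__measure_function_Measure mu mphi.

Lemma image_measureE (A : set T2) : image_measure A = mu (phi @^-1` A).
Proof. by []. Qed.

Lemma ge0_integral_image (f : T2 -> \bar R) : measurable_fun setT f ->
  (forall x, 0 <= f x)%E -> (\int[image_measure]_y f y = \int[mu]_x f (phi x))%E.
Proof. by move=> mf f0; exact: (ge0_integral_pushforward mphi). Qed.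

Lemma Rintegral_image (f : T2 -> R) : measurable_fun setT f ->
  mu.-integrable setT (EFin \o (fun x => f (phi x))) ->
  \int[image_measure]_y f y = \int[mu]_x f (phi x).
Proof.
move=> mf iphi; rewrite /Rintegral; apply: (congr1 fine).
apply: (integral_pushforward mphi) => //; exact/measurable_EFinP.
Qed.

End image.

Section restr.
Context {d : measure_display} {T : measurableType d} {R : realType}.
Variables (mu : {measure set T -> \bar R}) (D : set T) (mD : measurable D).

Lemma mrestr_ae : {ae mrestr mu mD, forall x, D x}.
Proof.
exists (~` D); split => //; first exact: measurableC.
by rewrite /= /mrestr setICl measure0.
Qed.

Lemma integral_mrestr (f : T -> \bar R) : measurable_fun setT f ->
  (\int[mrestr mu mD]_x f x = \int[mu]_(x in D) f x)%E.
Proof.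
move=> mf; rewrite -(@eq_measure_integral _ _ _ D mu (mrestr mu mD)); last first.
  move=> A mA AD; by rewrite /= /mrestr setIidl.
rewrite [RHS]integral_mkcond; apply: ae_eq_integral => //.
  by apply/(measurable_restrictT _ mD); exact: measurable_funTS.
by apply: filterS mrestr_ae => x Dx _; rewrite patchE mem_set.
Qed.

Lemma Rintegral_mrestr (f : T -> R) : measurable_fun setT f ->
  \int[mrestr mu mD]_x f x = \int[mu]_(x in D) f x.
Proof. by move=> mf; rewrite /Rintegral integral_mrestr//; exact/measurable_EFinP. Qed.

Lemma integrable_mrestr (f : T -> \bar R) : measurable_fun setT f ->
  (mrestr mu mD).-integrable setT f <-> mu.-integrable D f.
Proof.
move=> mf; have mfD : measurable_fun D f by exact: measurable_funTS.
split=> /integrableP[_ h]; apply/integrableP; split => //.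
  by move: h; rewrite integral_mrestr//; exact: measurableT_comp.
by rewrite integral_mrestr//; exact: measurableT_comp.
Qed.

End restr.

Section interval_measure.
Context {R : realType}.
Local Notation T := (measurableTypeR R).
Local Notation leb := (@lebesgue_measure R).

Lemma lebesgue_itv_lty (a b : R) : (leb `[a, b]%classic < +oo)%E.
Proof. by rewrite lebesgue_measure_itv/=; case: ifP => // _; rewrite -EFinB ltry. Qed.

(** Lebesgue measure on an interval as a finite measure on the line, so that
    iterated integrals are taken over whole spaces. *)
Definition leb_itv (a b : R) : {finite_measure set T -> \bar R} :=
  @mfrestr _ T R `[a, b]%classic leb (measurable_itv `[a, b]) (lebesgue_itv_lty a b).

Lemma Rintegral_leb_itv a b (f : R -> R) : measurable_fun setT f ->
  \int[leb_itv a b]_x f x = \int[leb]_(x in `[a, b]) f x.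
Proof. by move=> mf; rewrite (Rintegral_mrestr leb (measurable_itv `[a, b]) mf). Qed.

Lemma integral_leb_itv a b (f : R -> \bar R) : measurable_fun setT f ->
  (\int[leb_itv a b]_x f x = \int[leb]_(x in `[a, b]) f x)%E.
Proof. by move=> mf; rewrite (integral_mrestr leb (measurable_itv `[a, b]) mf). Qed.

Lemma integrable_leb_itv a b (f : R -> \bar R) : measurable_fun setT f ->
  (leb_itv a b).-integrable setT f <-> leb.-integrable `[a, b] f.
Proof. exact: (integrable_mrestr leb (measurable_itv `[a, b])). Qed.

Lemma leb_itvT a b : a <= b -> leb_itv a b setT = (b - a)%:E.
Proof.
rewrite /= /mfrestr /mrestr setTI lebesgue_measure_itv/= lte_fin.
by rewrite le_eqVlt => /predU1P[->|->//]; rewrite ltxx subrr.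
Qed.

Lemma is_derive_continuous (F : R -> R) (f : R -> R) :
  (forall x : R, is_derive x 1 F (f x)) -> continuous F.
Proof. by move=> dF x; apply/differentiable_continuous/derivable1_diffP. Qed.

Lemma FTC_itv (F f : R -> R) a b : a <= b -> continuous f ->
  (forall x : R, is_derive x 1 F (f x)) ->
  \int[leb]_(x in `[a, b]) f x = F b - F a.
Proof.
rewrite le_eqVlt => /predU1P[->|ab] cf dF.
  by rewrite set_itv1 Rintegral_set1 subrr.
rewrite /Rintegral (@continuous_FTC2 _ f F) //.
- exact: continuous_subspaceT.
- have cF := is_derive_continuous dF.
  split => //; by [apply: cvg_at_right_filter; exact: cF|
                   apply: cvg_at_left_filter; exact: cF].
- by move=> x _; rewrite derive1E; apply: derive_val.
Qed.

End interval_measure.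

Lemma integrable_prod_bounded {d1 d2} {T1 : measurableType d1}
    {T2 : measurableType d2} {R : realType}
    (m1 : {sigma_finite_measure set T1 -> \bar R})
    (m2 : {finite_measure set T2 -> \bar R}) (f : T1 -> R)
    (k : T1 * T2 -> R) (M : R) :
  m1.-integrable setT (EFin \o f) -> measurable_fun setT k ->
  (forall z, `|k z| <= M) ->
  (m1 \x m2)%E.-integrable setT (EFin \o (fun z => f z.1 * k z)).
Proof.
move=> intf mk kM'; have /integrableP[/measurable_EFinP mf foo] := intf.
have kM z : `|k z| <= `|M| by rewrite (le_trans (kM' z))// ler_norm.
have mfk : measurable_fun setT (fun z : T1 * T2 => f z.1 * k z).
  by apply: measurable_funM => //; exact: measurableT_comp.
apply/integrable12ltyP; first exact/measurable_EFinP.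
have fM : m2 setT \is a fin_num by apply: fin_num_measure.
apply: (@le_lt_trans _ _ (\int[m1]_x (`|(f x)%:E| * (`|M| * fine (m2 setT))%:E))%E).
  apply: ge0_le_integral => //.
  - by move=> x _; apply: integral_ge0.
  - apply: (@measurable_fun_fubini_tonelli_F _ _ _ _ _ m2
      (fun z => `|(f z.1 * k z)%:E|)%E) => //.
    by apply: measurableT_comp => //; exact/measurable_EFinP.
  - apply: emeasurable_funM => //; apply: measurableT_comp => //.
    exact/measurable_EFinP.
  move=> x _ /=.
  apply: (@le_trans _ _ (\int[m2]_y (`|f x| * `|M|)%:E)%E).
    apply: ge0_le_integral => //.
    - apply/measurable_EFinP; apply: measurableT_comp => //.
      exact: (measurable_fun_pair2 x mfk).
    - by move=> y _; rewrite lee_fin normrM ler_wpM2l.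
  by rewrite integral_cst// -[X in (_ * X <= _)%E](fineK fM) -!EFinM mulrA.
rewrite ge0_integralZr//; last 2 first.
- by apply: measurableT_comp => //; exact/measurable_EFinP.
- by rewrite lee_fin mulr_ge0// fine_ge0.
apply: lte_mul_pinfty => //; first exact: integral_ge0.
  by rewrite ge0_fin_numE ?integral_ge0.
exact: ltry.
Qed.

Lemma integrable_mul_bounded {d} {T : measurableType d} {R : realType}
    (m : {measure set T -> \bar R}) (f k : T -> R) (M : R) :
  m.-integrable setT (EFin \o f) -> measurable_fun setT k ->
  (forall x, `|k x| <= M) -> m.-integrable setT (EFin \o (fun x => f x * k x)).
Proof.
move=> intf mk kM; have /integrableP[/measurable_EFinP mf _] := intf.
apply: (@le_integrable _ _ _ m _ _ _ (fun x => (M%:E * (f x)%:E)%E)) => //.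
- by apply/measurable_EFinP; exact: measurable_funM.
- move=> x _ /=; rewrite lee_fin normrM [`|M * _|]normrM mulrC ler_wpM2r//.
  by rewrite (le_trans (kM x))// ler_norm.
- exact: integrableZl.
Qed.

Lemma normr_Rintegral_mul_bounded {d} {T : measurableType d} {R : realType}
    (m : {measure set T -> \bar R}) (f k : T -> R) (M : R) :
  m.-integrable setT (EFin \o f) -> measurable_fun setT k ->
  (forall x, `|k x| <= M) ->
  `|\int[m]_x (f x * k x)| <= M * \int[m]_x `|f x|.
Proof.
move=> intf mk kM; have /integrableP[/measurable_EFinP mf _] := intf.
have ifk := integrable_mul_bounded intf mk kM.
apply: (le_trans (le_normr_Rintegral measurableT ifk)).
rewrite -RintegralZl//; last exact: integrable_norm.
apply: le_Rintegral => //.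
- exact: integrable_norm.
- exact: (integrableZl measurableT M (integrable_norm intf)).
- by move=> x _; rewrite normrM mulrC ler_wpM2r.
Qed.

Lemma integrable_bounded {d} {T : measurableType d} {R : realType}
    (m : {finite_measure set T -> \bar R}) (k : T -> R) (M : R) :
  measurable_fun setT k -> (forall x, `|k x| <= M) ->
  m.-integrable setT (EFin \o k).
Proof.
move=> mk kM; have i1 := @finite_measure_integrable_cst _ _ _ m setT 1 measurableT.
have := integrable_mul_bounded i1 mk kM.
by under [X in EFin \o X]eq_fun do rewrite /= mul1r.
Qed.

(** * Z-matrices *)

Section monotone_matrices.
Context {R : realType} {d : nat}.
Implicit Types (A : 'M[R]_d) (u v w : 'cV[R]_d).

Definition z_matrix A := forall j k, j != k -> A j k <= 0.

Definition positive v := forall j, 0 < v j ord0.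

(** Inverse positivity, phrased without the inverse. *)
Definition monotone_mx A :=
  forall u, (forall j, 0 <= (A *m u) j ord0) -> forall j, 0 <= u j ord0.

(** At a zero entry of a non-negative vector the diagonal entry does not
    contribute, and only the non-positive ones remain. *)
Lemma z_matrix_zero_entry A v j : z_matrix A -> (forall k, 0 <= v k ord0) ->
  v j ord0 = 0 -> (A *m v) j ord0 <= 0.
Proof.
move=> ZA v0 vj; rewrite mxE; apply: sumr_le0 => k _.
have [->|jk] := eqVneq k j; first by rewrite vj mulr0.
by rewrite mulr_le0_ge0// ZA// eq_sym.
Qed.

(** The standard criterion for nonsingular M-matrices.  Subtract from u the
    multiple r_j w, where r_j is the smallest ratio u_i / w_i: the result y is
    non-negative with y_j = 0, so (A y)_j <= 0, whereas r_j < 0 would give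
    (A y)_j = (A u)_j - r_j (A w)_j > 0. *)
Lemma monotone_of_positive A w :
  z_matrix A -> positive w -> positive (A *m w) -> monotone_mx A.
Proof.
move=> ZA w0 Aw0 u Au0 j0.
pose r i := u i ord0 / w i ord0.
have [j _ jmin] := @Order.TotalTheory.arg_minP _ _ _ j0 xpredT r isT.
suff rj : 0 <= r j.
  have := le_trans rj (jmin j0 isT).
  by rewrite /r pmulr_lge0// invr_gt0.
rewrite leNgt; apply/negP => rj.
pose y := u - r j *: w.
have yE k : y k ord0 = u k ord0 - r j * w k ord0 by rewrite !mxE.
have y0 k : 0 <= y k ord0.
  by rewrite yE subr_ge0 -ler_pdivlMr//; exact: jmin.
have yj : y j ord0 = 0 by rewrite yE /r divfK ?subrr// gt_eqF.
have := z_matrix_zero_entry ZA y0 yj.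
rewrite /y mulmxBr -scalemxAr !mxE leNgt => /negP; apply.
rewrite ltr_wpDl ?oppr_gt0//; last by rewrite nmulr_rlt0//; have := Aw0 j; rewrite mxE.
by have := Au0 j; rewrite mxE.
Qed.

Variable A : R -> 'M[R]_d.
Hypothesis ZA : forall x, 0 <= x -> z_matrix (A x).
Hypothesis ndA : forall x y j k, 0 <= x -> x <= y -> A x j k <= A y j k.
Variable C : R.
Hypothesis lipA : forall x y j k, 0 <= x -> 0 <= y ->
  `|A x j k - A y j k| <= C * `|x - y|.
Hypothesis detA : forall x, 0 <= x -> \det (A x) != 0.

Let good x := 0 <= x /\ exists2 w, positive w & positive (A x *m w).

Lemma positive_near x v : 0 <= x -> positive (A x *m v) ->
  exists2 e, 0 < e & forall y, 0 <= y -> `|x - y| < e -> positive (A y *m v).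
Proof.
move=> x0 Av0.
(* K is a Lipschitz constant of the entries of A x *m v; the summand 1 makes it
   nonzero. *)
pose K := 1 + `|C| * \sum_k `|v k ord0|.
have K0 : 0 < K.
  by rewrite /K ltr_pwDl// mulr_ge0// sumr_ge0.
pose m := \big[Order.min/1]_j ((A x *m v) j ord0).
have m0 : 0 < m by apply: lt_bigmin => // j _; exact: Av0.
exists (m / K); first exact: divr_gt0.
move=> y y0 xy j.
have mj : m <= (A x *m v) j ord0 by exact: bigmin_le.
have : `|(A x *m v) j ord0 - (A y *m v) j ord0| < m.
  apply: (@le_lt_trans _ _ (K * `|x - y|)); last by rewrite mulrC -ltr_pdivlMr.
  rewrite !mxE -sumrB; apply: (le_trans (ler_norm_sum _ _ _)).
  apply: (@le_trans _ _ (\sum_k (`|C| * `|v k ord0|) * `|x - y|)).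
    apply: ler_sum => k _; rewrite -mulrBl normrM mulrAC ler_wpM2r//.
    by apply: (le_trans (lipA _ _ x0 y0)); rewrite ler_wpM2r// ler_norm.
  by rewrite -mulr_suml -mulr_sumr ler_wpM2r// /K lerDr.
rewrite ltr_norml => /andP[_]; lra.
Qed.

Let good_up x y : good x -> x <= y -> good y.
Proof.
move=> [x0 [w w0 Aw0]] xy; split; first exact: le_trans xy.
exists w => // j; apply: lt_le_trans (Aw0 j) _.
by rewrite !mxE; apply: ler_sum => k _; rewrite ler_wpM2r ?ndA// ltW.
Qed.

(** A continuity argument.  The good x, for which A x maps some positive vector
    to a positive vector, form an up-set.  The infimum x0 is good: the solution
    v of A(x0) v = 1 is non-negative, as it is sent to positive vectors by the
    monotone matrices just above x0, and a zero entry of v would contradict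
    [z_matrix_zero_entry].  Since being good is an open condition, x0 = 0. *)
Lemma monotone_at0 x1 v1 : 0 <= x1 -> positive v1 -> positive (A x1 *m v1) ->
  monotone_mx (A 0).
Proof.
move=> x10 v10 Av10.
have good1 : good x1 by split => //; exists v1.
have lbS : has_lbound [set x | good x] by exists 0 => x [].
pose x0 := inf [set x | good x].
have x00 : 0 <= x0 by apply: lb_le_inf; [exists x1|move=> x []].
have good_gt y : x0 < y -> good y.
  move=> x0y; have [z gz zy] := inf_lt (ex_intro _ x1 good1) x0y.
  exact: good_up gz (ltW zy).
have gx0 : good x0.
  split => //; have ux0 : A x0 \in unitmx by rewrite unitmxE unitfE detA.
  pose v : 'cV[R]_d := invmx (A x0) *m const_mx 1.
  have Av : A x0 *m v = const_mx 1 by rewrite /v mulmxA mulmxV// mul1mx.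
  have Avp : positive (A x0 *m v) by move=> j; rewrite Av mxE.
  have [e e0 xe] := positive_near x00 Avp.
  (* A matrix just above x0 is monotone and still maps v to a positive vector. *)
  have [y0 [w w0 Aw0]] : good (x0 + e / 2) by apply: good_gt; rewrite ltrDl divr_gt0.
  have v0 : forall j, 0 <= v j ord0.
    apply: (monotone_of_positive (ZA y0) w0 Aw0) => j; apply/ltW/xe => //.
    rewrite opprD addNKr normrN gtr0_norm ?divr_gt0//.
    by rewrite ltr_pdivrMr// ltr_pMr// ltr1n.
  exists v => // j; rewrite lt_neqAle v0 andbT; apply/negP => /eqP vj.
  have := z_matrix_zero_entry (ZA x00) v0 (esym vj).
  by rewrite Av mxE ler10.
have [_ [w w0 Aw0]] := gx0.
have [x0E|x0gt0] := eqVneq x0 0.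
  by move: Aw0; rewrite x0E => /(monotone_of_positive (ZA (lexx 0)) w0).
have {x0gt0}x0p : 0 < x0 by rewrite lt_neqAle eq_sym x0gt0.
have [e e0 xe] := positive_near x00 Aw0.
pose y := Num.max 0 (x0 - e / 2).
have y0 : 0 <= y by rewrite le_max lexx.
have yx0 : y < x0 by rewrite gt_max x0p gtrBl divr_gt0.
have gy : good y.
  split => //; exists w => //; apply: xe => //.
  rewrite gtr0_norm ?subr_gt0//.
  have : x0 - e / 2 <= y by rewrite le_max lexx orbT.
  by lra.
by have := ge_inf lbS gy; rewrite leNgt yx0.
Qed.

End monotone_matrices.

(** * Uniqueness for Fourier transforms of integrable functions *)

Section fourier_uniqueness.
Context {R : realType}.
Local Notation leb := (@lebesgue_measure R).

Lemma is_derive_scale (c y : R) : is_derive y 1 (fun t => c * t) c.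
Proof.
have -> : (fun t => c * t) = c *: (@id R) by apply/funext.
by apply: is_derive_eq; rewrite /GRing.scale/= mulr1.
Qed.

Lemma damped_cos_integral (e x Y : R) : 0 < e -> 0 <= Y ->
  \int[leb]_(y in `[0, Y]) (expR (- e * y) * cos (x * y)) =
  e / (e ^+ 2 + x ^+ 2) +
  expR (- e * Y) * (x * sin (x * Y) - e * cos (x * Y)) / (e ^+ 2 + x ^+ 2).
Proof.
move=> e0 Y0; have q0 : e ^+ 2 + x ^+ 2 != 0.
  by rewrite gt_eqF// ltr_pwDl ?exprn_gt0// sqr_ge0.
pose F (y : R) := (e ^+ 2 + x ^+ 2)^-1 *
  (expR (- e * y) * (x * sin (x * y) - e * cos (x * y))).
have dexp (y : R) := is_derive1_comp (is_derive_expR (- e * y)) (is_derive_scale (- e) y).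
have dsin y := is_derive1_comp (is_derive_sin (x * y)) (is_derive_scale x y).
have dcos y := is_derive1_comp (is_derive_cos (x * y)) (is_derive_scale x y).
have dF (y : R) : is_derive y 1 F (expR (- e * y) * cos (x * y)).
  have -> : F = (e ^+ 2 + x ^+ 2)^-1 *: ((expR \o (fun t => - e * t)) *
    (x *: (sin \o (fun t => x * t)) - e *: (cos \o (fun t => x * t)))).
    by apply/funext.
  apply: is_derive_eq.
  rewrite /GRing.scale/=.
  have -> : (x \*: (sin \o [eta  *%R x]) - e \*: (cos \o [eta  *%R x])) y =
    x * sin (x * y) - e * cos (x * y) by [].
  by field; exact: q0.
rewrite (FTC_itv Y0 _ dF); last first.
  move=> y; apply: cvgM; first exact: (is_derive_continuous dexp).
  exact: (is_derive_continuous dcos).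
rewrite /F !mulr0 sin0 cos0 expR0; field; exact: q0.
Qed.

Lemma poisson_integral (e x a b : R) : 0 < e -> a <= b ->
  \int[leb]_(c in `[a, b]) (e / (e ^+ 2 + (x - c) ^+ 2)) =
  atan ((b - x) / e) - atan ((a - x) / e).
Proof.
move=> e0 ab.
have q0 c : e ^+ 2 + (x - c) ^+ 2 != 0.
  by rewrite gt_eqF// ltr_pwDl ?exprn_gt0// sqr_ge0.
have dlin (c : R) : is_derive c 1 (fun c => (c - x) / e) (e^-1).
  have -> : (fun c : R => (c - x) / e) = e^-1 *: (@id R - cst x).
    by apply/funext => t; rewrite /GRing.scale/= mulrC.
  by apply: is_derive_eq; rewrite /GRing.scale/= subr0 mulr1.
have datan (c : R) :=
  @is_derive1_comp _ atan (fun c => (c - x) / e) c _ _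
    (is_derive1_atan ((c - x) / e)) (dlin c).
have dF (c : R) : is_derive c 1 (atan \o (fun c => (c - x) / e))
    (e / (e ^+ 2 + (x - c) ^+ 2)).
  apply: (is_derive_eq (datan c)).
  have h1 : 1 + ((c - x) / e) ^+ 2 != 0 by rewrite gt_eqF// ltr_pwDl// sqr_ge0.
  have h2 : e != 0 by rewrite gt_eqF.
  have h3 := q0 c.
  have -> : 1 + ((c - x) / e) ^+ 2 = (e ^+ 2 + (x - c) ^+ 2) / e ^+ 2 by field.
  by field; rewrite h2 h3.
rewrite (FTC_itv ab _ dF)// => c; apply: cvgM; first exact: cvg_cst.
apply: cvgV; first exact: q0.
apply: cvgD; first exact: cvg_cst.
apply: (@cvg_comp _ _ _ (fun c => x - c) (fun y => y ^+ 2)); last exact: exprn_continuous.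
apply: cvgB; first exact: cvg_cst. exact: cvg_id.
Qed.

Section transform.
Variable f : R -> R.
Hypothesis intf : leb.-integrable setT (EFin \o f).
Hypothesis cosf : forall y, \int[leb]_x (f x * cos (x * y)) = 0.
Hypothesis sinf : forall y, \int[leb]_x (f x * sin (x * y)) = 0.

Let mf : measurable_fun setT f.
Proof. by have /integrableP[/measurable_EFinP] := intf. Qed.

Let mcos y : measurable_fun setT (fun x : R => cos (x * y)).
Proof.
apply: (@measurableT_comp _ _ _ _ _ _ cos); last exact: mulrr_measurable.
exact: continuous_measurable_fun (@continuous_cos R).
Qed.

Let msin y : measurable_fun setT (fun x : R => sin (x * y)).
Proof.
apply: (@measurableT_comp _ _ _ _ _ _ sin); last exact: mulrr_measurable.
exact: continuous_measurable_fun (@continuous_sin R).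
Qed.

Lemma shifted_cos_transform a y : \int[leb]_x (f x * cos ((x - a) * y)) = 0.
Proof.
have -> : (fun x => f x * cos ((x - a) * y)) =
    (fun x => f x * cos (x * y) * cos (a * y) + f x * sin (x * y) * sin (a * y)).
  by apply/funext => x; rewrite mulrBl cosB; ring.
have icos : leb.-integrable setT (EFin \o (fun x => f x * cos (x * y))).
  by apply: (integrable_mul_bounded intf (mcos y) (M := 1)) => x;
    rewrite ler_norml cos_geN1 cos_le1.
have isin : leb.-integrable setT (EFin \o (fun x => f x * sin (x * y))).
  by apply: (integrable_mul_bounded intf (msin y) (M := 1)) => x;
    rewrite ler_norml sin_geN1 sin_le1.
rewrite RintegralD//.
- by rewrite !RintegralZr// cosf sinf !mul0r addr0.
- by apply: (integrable_mul_bounded (M := `|cos (a * y)|)) => //; exact: measurable_cst.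
- by apply: (integrable_mul_bounded (M := `|sin (a * y)|)) => //; exact: measurable_cst.
Qed.

(** By exchange of integrals, f is orthogonal to the integral over y in [0, Y]
    of exp(- e y) cos((x - a) y), which is the Poisson kernel up to an error
    of order exp(- e Y). *)
Lemma poisson_transform a e : 0 < e ->
  \int[leb]_x (f x * (e / (e ^+ 2 + (x - a) ^+ 2))) = 0.
Proof.
move=> e0.
pose k (z : R * R) := expR (- e * `|z.2|) * cos ((z.1 - a) * z.2).
have mk : measurable_fun setT k.
  apply: measurable_funM.
    apply: measurableT_comp => //; apply: measurable_funM => //.
    by apply: measurableT_comp => //; exact: measurable_snd.
  apply: (@measurableT_comp _ _ _ _ _ _ cos).
    exact: continuous_measurable_fun (@continuous_cos R).
  apply: measurable_funM; last exact: measurable_snd.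
  by apply: measurable_funB => //; exact: measurable_fst.
have k1 z : `|k z| <= 1.
  rewrite normrM mulr_ile1//.
    rewrite (ger0_norm (expR_ge0 _)) -expR0 ler_expR mulNr oppr_le0.
    by rewrite mulr_ge0// ltW.
  by rewrite ler_norml cos_geN1 cos_le1.
pose P x := e / (e ^+ 2 + (x - a) ^+ 2).
pose E Y x := expR (- e * Y) *
  ((x - a) * sin ((x - a) * Y) - e * cos ((x - a) * Y)) / (e ^+ 2 + (x - a) ^+ 2).
have kE Y x : 0 <= Y -> \int[leb_itv 0 Y]_y k (x, y) = P x + E Y x.
  move=> Y0; rewrite Rintegral_leb_itv; last exact: (measurable_fun_pair2 x mk).
  rewrite -(damped_cos_integral _ e0 Y0); apply: eq_Rintegral => y.
  by rewrite inE/= in_itv/= => /andP[y0 _]; rewrite /k/= ger0_norm.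
have q0 (x : R) : 0 < e ^+ 2 + (x - a) ^+ 2.
  by rewrite ltr_pwDl ?exprn_gt0// sqr_ge0.
have z0 Y : 0 <= Y -> \int[leb]_x (f x * (P x + E Y x)) = 0.
  move=> Y0; transitivity (\int[leb_itv 0 Y]_y \int[leb]_x (f x * k (x, y))).
    rewrite -(Rintegral_swap (integrable_prod_bounded (leb_itv 0 Y) intf mk k1)).
    apply: eq_Rintegral => x _; rewrite -kE// -RintegralZl//.
    exact: (integrable_bounded (leb_itv 0 Y) (measurable_fun_pair2 x mk) (fun y => k1 (x, y))).
  rewrite /= (_ : (fun y => _) = cst 0) ?Rintegral_cst ?mul0r//.
  apply/funext => y /=.
  under eq_Rintegral do rewrite /k /= mulrCA.
  rewrite RintegralZl// ?shifted_cos_transform ?mulr0//.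
  apply: (@integrable_mul_bounded _ _ _ leb f (fun x : R => cos ((x - a) * y)) 1 intf) => [|x].
    under eq_fun do rewrite mulrBl.
    apply: (@measurableT_comp _ _ _ _ _ _ cos).
      exact: continuous_measurable_fun (@continuous_cos R).
    by apply: measurable_funB => //; exact: mulrr_measurable.
  by rewrite ler_norml cos_geN1 cos_le1.
have mq : measurable_fun setT (fun x : R => (e ^+ 2 + (x - a) ^+ 2)^-1).
  apply: continuous_measurable_fun => x; apply: cvgV; first exact: lt0r_neq0.
  apply: cvgD; first exact: cvg_cst.
  apply: (@cvg_comp _ _ _ (fun x => x - a) (fun y => y ^+ 2)); last exact: exprn_continuous.
  by apply: cvgB; [exact: cvg_id|exact: cvg_cst].
have mP : measurable_fun setT P by exact: measurable_funM.
have P1 x : `|P x| <= e^-1.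
  rewrite /P ger0_norm; last by rewrite divr_ge0 ?ltW.
  rewrite ler_pdivrMr// mulrDr expr2 mulrA mulVf ?mul1r ?gt_eqF// lerDl.
  by rewrite mulr_ge0 ?invr_ge0 ?sqr_ge0// ltW.
have mE Y : measurable_fun setT (E Y).
  rewrite /E; under eq_fun do rewrite -mulrA.
  apply: measurable_funM => //; apply: measurable_funM => //.
  have mx : measurable_fun setT (fun x : R => x - a) by exact: measurable_funB.
  have mxY : measurable_fun setT (fun x : R => (x - a) * Y) by exact: measurable_funM.
  apply: measurable_funB; apply: measurable_funM => //.
    apply: (measurableT_comp _ mxY).
    exact: continuous_measurable_fun (@continuous_sin R).
  apply: (measurableT_comp _ mxY).
  exact: continuous_measurable_fun (@continuous_cos R).
have E1 Y x : `|E Y x| <= expR (- e * Y) * (2 / e).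
  rewrite /E -mulrA normrM (ger0_norm (expR_ge0 _)) ler_pM2l ?expR_gt0//.
  rewrite normrM [X in _ * X <= _]gtr0_norm ?invr_gt0// ler_pdivrMr//.
  have n1 : `|sin ((x - a) * Y)| <= 1 by rewrite ler_norml sin_geN1 sin_le1.
  have n2 : `|cos ((x - a) * Y)| <= 1 by rewrite ler_norml cos_geN1 cos_le1.
  apply: (@le_trans _ _ (`|x - a| + e)).
    apply: (le_trans (ler_normB _ _)); rewrite !normrM (gtr0_norm e0).
    by apply: lerD; apply: ler_piMr => //; exact: ltW.
  rewrite mulrAC ler_pdivlMr//.
  rewrite -[(x - a) ^+ 2]real_normK ?num_real//.
  set z := `|x - a|; have : 0 <= (z - e / 2) ^+ 2 by exact: sqr_ge0.
  have : 0 <= z ^+ 2 by exact: sqr_ge0.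
  nra.
have bnd Y : 0 <= Y -> `|\int[leb]_x (f x * P x)| <=
    expR (- e * Y) * (2 / e) * \int[leb]_x `|f x|.
  move=> Y0; suff -> : \int[leb]_x (f x * P x) = - \int[leb]_x (f x * E Y x).
    by rewrite normrN; exact: (normr_Rintegral_mul_bounded intf (mE Y) (E1 Y)).
  apply/eqP; rewrite -subr_eq0 opprK -RintegralD//.
  - by rewrite -(z0 _ Y0); apply/eqP; apply: eq_Rintegral => x _; rewrite mulrDr.
  - exact: (integrable_mul_bounded intf mP P1).
  - by apply: (integrable_mul_bounded intf (mE Y) (E1 Y)).
apply/eqP; rewrite -normr_le0 leNgt; apply/negP.
set c := `|_|; move=> c0.
pose K := 2 / e * \int[leb]_x `|f x|.
have K0 : 0 <= K.
  by apply: mulr_ge0; [rewrite divr_ge0 ?ltW|apply: Rintegral_ge0 => x _].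
(* For this Y, expR (e * Y) >= 1 + e * Y contradicts c * expR (e * Y) <= K. *)
have h := bnd (K / (c * e)) (divr_ge0 K0 (ltW (mulr_gt0 c0 e0))).
have : c * expR (e * (K / (c * e))) <= K.
  rewrite -ler_pdivlMr ?expR_gt0// -expRN mulrC /K mulrA.
  by rewrite -mulNr.
apply/negP; rewrite -ltNge.
apply: (@lt_le_trans _ _ (c * (1 + e * (K / (c * e))))); last first.
  by apply: ler_wpM2l; [exact: ltW|exact: expR_ge1Dx].
have -> : c * (1 + e * (K / (c * e))) = c + K by field; rewrite !gt_eqF.
by rewrite ltrDr.
Qed.

(** The Poisson kernel centred at c, integrated over c in [a, b]. *)
Lemma atan_transform a b e : 0 < e -> a <= b ->
  \int[leb]_x (f x * (atan ((b - x) / e) - atan ((a - x) / e))) = 0.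
Proof.
move=> e0 ab; pose k (z : R * R) := e / (e ^+ 2 + (z.1 - z.2) ^+ 2).
have q0 (z : R * R) : 0 < e ^+ 2 + (z.1 - z.2) ^+ 2.
  by rewrite ltr_pwDl ?exprn_gt0// sqr_ge0.
have mk : measurable_fun setT k.
  apply: measurable_funM => //.
  apply: (@measurableT_comp _ _ _ _ _ _ (fun x : R => (e ^+ 2 + x ^+ 2)^-1)
    _ (fun z : R * R => z.1 - z.2)); last first.
    by apply: measurable_funB; [exact: measurable_fst|exact: measurable_snd].
  apply: continuous_measurable_fun => x; apply: cvgV.
    by rewrite gt_eqF// ltr_pwDl ?exprn_gt0// sqr_ge0.
  by apply: cvgD; [exact: cvg_cst|exact: exprn_continuous].
have k1 z : `|k z| <= e^-1.
  rewrite /k ger0_norm; last by rewrite divr_ge0 ?ltW.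
  rewrite ler_pdivrMr// mulrDr expr2 mulrA mulVf ?mul1r ?gt_eqF// lerDl.
  by rewrite mulr_ge0 ?invr_ge0 ?sqr_ge0// ltW.
transitivity (\int[leb_itv a b]_c \int[leb]_x (f x * k (x, c))).
  rewrite -(Rintegral_swap (integrable_prod_bounded (leb_itv a b) intf mk k1)).
  apply: eq_Rintegral => x _; rewrite -poisson_integral// -Rintegral_leb_itv.
    rewrite -RintegralZl//.
    exact: (integrable_bounded (leb_itv a b) (measurable_fun_pair2 x mk) (fun y => k1 (x, y))).
  exact: (measurable_fun_pair2 x mk).
rewrite (_ : (fun y => _) = cst 0) ?Rintegral_cst ?mul0r//.
by apply/funext => c /=; exact: poisson_transform.
Qed.

Lemma atan_cvg_sg (t : R) : atan (t * n.+1%:R) @[n --> \oo] --> pi / 2 * Num.sg t.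
Proof.
have pos (u : R) : 0 < u -> atan (u * n.+1%:R) @[n --> \oo] --> pi / 2.
  move=> u0; apply: (cvg_comp (fun n => u * n.+1%:R) (@atan R) _ (@cvgy_atan R)).
  apply/cvgryPge => A; exists (Num.truncn (A / u)) => // n /= An.
  rewrite mulrC -ler_pdivrMr// ltW// (lt_le_trans (truncnS_gt _))//.
  by rewrite ler_nat ltnS.
have [t0|t0|->] := ltgtP t 0.
- rewrite ltr0_sg// mulrN1.
  rewrite (_ : (fun n => _) = (fun n => - atan (- t * n.+1%:R))).
    by apply: cvgN; apply: pos; rewrite oppr_gt0.
  by apply/funext => n; rewrite mulNr atanN opprK.
- by rewrite gtr0_sg// mulr1; exact: pos.
- rewrite sgr0 mulr0; under eq_fun do rewrite mul0r atan0.
  exact: cvg_cst.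
Qed.

(** As e tends to 0, the difference of arctangents tends boundedly to pi times
    the indicator of the interval, away from its endpoints. *)
Lemma interval_transform a b : a <= b -> \int[leb]_(x in `[a, b]) f x = 0.
Proof.
move=> ab.
pose F n x := f x * (atan ((b - x) * n.+1%:R) - atan ((a - x) * n.+1%:R)).
pose G x := f x * (pi / 2 * Num.sg (b - x) - pi / 2 * Num.sg (a - x)).
have F0 n : \int[leb]_x F n x = 0.
  rewrite /F -[n.+1%:R]invrK; exact: atan_transform.
have matan (c r : R) : measurable_fun setT (fun x : R => atan ((c - x) * r)).
  apply: (@measurableT_comp _ _ _ _ _ _ (@atan R)).
    by apply: continuous_measurable_fun; exact: continuous_atan.
  by apply: measurable_funM => //; exact: measurable_funB.
have mF n : measurable_fun setT (F n).
  by apply: measurable_funM => //; exact: measurable_funB.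
have bF n x : `|F n x| <= `|f x| * pi.
  rewrite normrM ler_wpM2l//.
  have atan1 (t : R) : `|atan t| <= pi / 2.
    by rewrite ler_norml !ltW ?atan_gtNpi2 ?atan_ltpi2.
  rewrite (le_trans (ler_normB _ _))// [leRHS](splitr pi).
  by apply: lerD.
have FG x : F ^~ x @ \oo --> G x.
  by apply: cvgM; [exact: cvg_cst|apply: cvgB; exact: atan_cvg_sg].
have : (\int[leb]_x (F n x)%:E)%E @[n --> \oo] --> (\int[leb]_x (G x)%:E)%E.
  apply: (@dominated_cvg _ _ _ leb setT measurableT _ _ (fun x => (`|f x| * pi)%:E)) => //.
  - by move=> n; apply/measurable_EFinP; exact: mF.
  - by move=> x _; apply: cvg_EFin; [exact: nearW|exact: FG].
  - have := integrableZr measurableT pi (integrable_norm intf).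
    by apply: eq_integrable => // x _; rewrite /= EFinM.
  - by move=> n x _; rewrite lee_fin.
have iF n : leb.-integrable setT (EFin \o F n).
  apply: (le_integrable _ _ _ (integrableZr measurableT pi (integrable_norm intf))) => //.
    by apply/measurable_EFinP; exact: mF.
  move=> x _ /=; rewrite lee_fin (le_trans (bF n x))//.
  exact: ler_norm.
have -> : (fun n => \int[leb]_x (F n x)%:E)%E = cst 0%E.
  apply/funext => n; rewrite -[LHS]fineK ?[fine _]F0//.
  exact: integrable_fin_num (iF n).
move=> /(cvg_lim (@ereal_hausdorff R)); rewrite lim_cst//= => G0.
have ms c : measurable_fun setT (fun x : R => pi / 2 * Num.sg (c - x)).
  apply: (measurable_fun_cvg (h := fun n (x : R) => atan ((c - x) * n.+1%:R))) => //.
  by move=> x _; exact: atan_cvg_sg.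
have iG : leb.-integrable setT (EFin \o G).
  apply: (@integrable_mul_bounded _ _ _ leb f
    (fun x : R => pi / 2 * Num.sg (b - x) - pi / 2 * Num.sg (a - x)) pi intf).
    by apply: measurable_funB; exact: ms.
  have sg1 (t : R) : `|pi / 2 * Num.sg t| <= pi / 2.
    rewrite normrM ger0_norm ?divr_ge0 ?pi_ge0// ler_piMr ?divr_ge0 ?pi_ge0//.
    by rewrite normr_sg; case: (t != 0).
  move=> x; rewrite (le_trans (ler_normB _ _))// [leRHS](splitr pi).
  by apply: lerD.
have /integrableP[/measurable_EFinP mG _] := iG.
transitivity (\int[leb]_x (pi^-1 * G x)); last first.
  by rewrite RintegralZl// /Rintegral -G0 mulr0.
rewrite [LHS]Rintegral_mkcond /Rintegral; apply: (congr1 fine); apply: ae_eq_integral => //.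
- by apply/measurable_EFinP/(measurable_restrictT _ _).1 => //; exact: measurable_funTS.
- by apply/measurable_EFinP; exact: measurable_funM.
exists ([set a] `|` [set b]); split.
- exact: measurableU.
- by rewrite measureU0//; exact: lebesgue_measure_set1.
move=> x /= /not_implyP[_ fG]; apply: contrapT => /not_orP[xa xb]; apply: fG.
congr EFin; rewrite /G patchE.
have pi0 : (pi : R) != 0 by rewrite gt_eqF// pi_gt0.
case: ifPn; rewrite ?inE ?notin_setE/= in_itv/=.
  move=> /andP[ax xb']; rewrite gtr0_sg ?ltr0_sg ?subr_lt0 ?subr_gt0.
  - by rewrite mulrN1 mulr1 opprK -splitr mulrCA mulVf ?mulr1.
  - by rewrite lt_neqAle ax andbT; apply/eqP => /esym.
  - by rewrite lt_neqAle xb' andbT; apply/eqP.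
move=> /negP; rewrite negb_and -!ltNge (_ : point = 0)// => /orP[ax|xb'].
  by rewrite !gtr0_sg ?subr_gt0 ?(lt_le_trans ax)// subrr !mulr0.
by rewrite !ltr0_sg ?subr_lt0 ?(le_lt_trans ab)// subrr !mulr0.
Qed.

(** f has vanishing integral over every interval, hence vanishes at its Lebesgue
    points. *)
Lemma fourier_uniqueness : {ae leb, forall x, f x = 0}.
Proof.
have F0 n : {ae leb, forall x, - n%:R < x -> f x = 0}.
  have iaf y : leb.-integrable `[- n%:R, y] (EFin \o f).
    by apply: integrableS intf.
  have lf : locally_integrable setT f.
    by apply: open_integrable_locally => //; exact: openT.
  have := FTC1 iaf lf; apply: filterS => [|x /= h nx].
    exact: (ae_filter_ringOfSetsType leb).
  have [_ <-] := h nx.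
  rewrite (_ : (fun y => _) = cst 0) ?derive1_cst//.
  apply/funext => y /=; have [ny|ny] := leP (- n%:R) y.
    exact: (interval_transform ny).
  by rewrite set_itv_ge ?Rintegral_set0// bnd_simp -ltNge.
have := ae_foralln F0; apply: filterS => x /(_ (Num.truncn (- x)).+1) /=; apply.
by rewrite ltrNl; exact: truncnS_gt.
Qed.
End transform.
End fourier_uniqueness.

(** * Signed delay measures with non-negative mass away from the origin *)

Section signed.
Context {R : realType}.
Local Notation T := (measurableTypeR R).
Implicit Types nu : signed_measure R.

Lemma pos_part_lty nu : (pos_part nu `[0%R, +oo[%classic < +oo)%E.
Proof.
rewrite /pos_part -ge0_fin_numE ?measure_ge0//.
exact: fin_num_measure.
Qed.

Definition posm nu : {finite_measure set T -> \bar R} :=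
  @mfrestr _ T R `[0, +oo[%classic (pos_part nu) (measurable_itv `[0, +oo[)
    (pos_part_lty nu).

Definition negmass nu : R := fine (neg_part nu `[0%R, +oo[%classic).

Lemma negmass_ge0 nu : 0 <= negmass nu.
Proof. exact: fine_ge0. Qed.

(** Stated with an unspecified set so that the chosen Hahn decomposition does
    not matter afterwards. *)
Lemma neg_partE nu (A : set T) : measurable A ->
  exists2 N : set T, measurable N & neg_part nu A = (- nu (A `&` N))%E.
Proof.
rewrite /neg_part; move: (projT2 (cid (hahn_pair nu))) => h mA.
have [_ [mN _] _ _] := h.
exists (projT1 (cid (hahn_pair nu))).2 => //.
by rewrite -[LHS]/(jordan_neg h A) jordan_negE cjordan_negE /crestr0 mem_set.
Qed.

Section positive_off_zero.
Variable nu : signed_measure R.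
Hypothesis nu0 : forall A : set T, measurable A -> (0 <= nu (A `&` `]0%R, +oo[))%E.

Lemma neg_part_gt0 : neg_part nu `]0%R, +oo[%classic = 0%E.
Proof.
have [N mN E] := @neg_partE nu `]0%R, +oo[%classic (measurable_itv _).
apply/eqP; rewrite eq_le measure_ge0 andbT E oppe_le0 setIC.
exact: nu0.
Qed.

Lemma ae_neg_part : {ae neg_part nu, forall t, `[0%R, +oo[%classic t -> t = 0}.
Proof.
exists `]0%R, +oo[%classic; split.
- exact: measurable_itv.
- exact: neg_part_gt0.
move=> t /=; rewrite !in_itv/= !andbT => /not_implyP[t0 /eqP tn0].
by rewrite lt_neqAle eq_sym tn0.
Qed.

Lemma Rintegral_neg_part (f : R -> R) : measurable_fun setT f ->
  \int[neg_part nu]_(t in `[0, +oo[) f t = negmass nu * f 0.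
Proof.
move=> mf; rewrite mulrC /negmass -Rintegral_cst; last exact: measurable_itv.
apply: (congr1 fine); apply: ae_eq_integral.
- exact: measurable_itv.
- by apply/measurable_EFinP; exact: measurable_funTS.
- by apply/measurable_EFinP.
by apply: ae_weaken ae_neg_part => t /= h /h ->.
Qed.

(** As all mass away from the origin is non-negative, the negative part is an
    atom at the origin: the delay splits into a positive finite measure and an
    instantaneous damping. *)
Lemma signed_intE (f : R -> R) : measurable_fun setT f ->
  signed_int nu f = \int[posm nu]_t f t - negmass nu * f 0.
Proof.
move=> mf; rewrite /signed_int Rintegral_neg_part//.
by rewrite (Rintegral_mrestr (pos_part nu) (measurable_itv `[0, +oo[) mf).
Qed.

Lemma negmass_eq0 : (0 <= nu [set 0%R])%E -> negmass nu = 0.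
Proof.
move=> h0; rewrite /negmass.
have -> : `[0, +oo[%classic = [set 0] `|` `]0, +oo[%classic :> set T.
  apply/seteqP; split => t /=; rewrite !in_itv/= !andbT.
    by rewrite le_eqVlt => /orP[/eqP<-|t0]; [left|right].
  by move=> [->|t0]; [exact: lexx|exact: ltW].
rewrite (@measureU0 _ _ _ (neg_part nu) _ _ (measurable_set1 0)
  (measurable_itv `]0, +oo[) neg_part_gt0).
suff -> : neg_part nu [set 0] = 0%E by [].
have [N mN E] := @neg_partE nu [set 0%R] (measurable_set1 _).
apply/eqP; rewrite eq_le measure_ge0 andbT E oppe_le0.
have [N0|N0] := pselect (N 0).
  by rewrite setIidl// => t ->.
rewrite (_ : _ `&` _ = set0) ?charge0//.
by apply/seteqP; split => // t [->].
Qed.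

End positive_off_zero.

Lemma posm_ae nu : {ae posm nu, forall t, 0 <= t}.
Proof.
have := mrestr_ae (pos_part nu) (measurable_itv `[0, +oo[).
by apply: ae_weaken => t /=; rewrite in_itv/= andbT.
Qed.

Lemma posm_first_moment nu :
  (\int[abs_measure nu]_(t in `[0%R, +oo[) (t ^+ 2)%:E < +oo)%E ->
  (posm nu).-integrable setT (EFin \o id).
Proof.
move=> h.
have m2 : measurable_fun setT (fun t : T => (t ^+ 2)%:E).
  by apply/measurable_EFinP.
have i2 : (posm nu).-integrable setT (fun t => (t ^+ 2)%:E).
  apply/(integrable_mrestr (pos_part nu) (measurable_itv `[0, +oo[) m2).
  apply/integrableP; split; first exact: measurable_funTS.
  apply: le_lt_trans h.
  rewrite /abs_measure ge0_integral_measure_add; [|exact: measurable_itv|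
    by move=> t _; rewrite lee_fin sqr_ge0|exact: measurable_funTS].
  under eq_integral do rewrite abse_EFin ger0_norm ?sqr_ge0//.
  by rewrite leeDl// integral_ge0// => t _; rewrite lee_fin sqr_ge0.
have i1 := @finite_measure_integrable_cst _ _ _ (posm nu) setT 1 measurableT.
apply: (le_integrable measurableT _ _ (integrableD measurableT i1 i2)).
  by apply/measurable_EFinP; exact: measurable_id.
move=> t _ /=; rewrite lee_fin [leRHS]ger0_norm; last by rewrite addr_ge0 ?sqr_ge0.
(* t <= 1 + t ^ 2, as (u - 1 / 2) ^ 2 >= 0. *)
rewrite -(@real_normK _ t) ?num_real//; set u := `|t|.
have : 0 <= (u - 2^-1) ^+ 2 by exact: sqr_ge0.
rewrite -/u; nra.
Qed.

Definition posm_laplace nu (x : R) : R := \int[posm nu]_t expR (- x * t).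

Lemma integrable_laplace nu x : 0 <= x ->
  (posm nu).-integrable setT (EFin \o (fun t : T => expR (- x * t))).
Proof.
move=> x0; have i1 := @finite_measure_integrable_cst _ _ _ (posm nu) setT 1 measurableT.
apply: (@ae_eq_integrable _ _ _ _ _ (EFin \o (fun t : T => expR (- x * `|t|)))) => //.
- apply/measurable_EFinP; apply: measurableT_comp => //; exact: mulrl_measurable.
- by apply: ae_weaken (posm_ae nu) => t /= t0 _; rewrite ger0_norm.
apply: (le_integrable measurableT _ _ i1).
  apply/measurable_EFinP; apply: measurableT_comp => //; apply: measurable_funM => //.
move=> t _ /=; rewrite lee_fin normr1 (ger0_norm (expR_ge0 _)) -expR0 ler_expR.
by rewrite mulNr oppr_le0 mulr_ge0.
Qed.

Lemma ae_le_Rintegral {d} {T' : measurableType d} (m : {measure set T' -> \bar R})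
    (f g : T' -> R) :
  m.-integrable setT (EFin \o f) -> m.-integrable setT (EFin \o g) ->
  {ae m, forall x, f x <= g x} -> \int[m]_x f x <= \int[m]_x g x.
Proof.
move=> intf intg fg.
have /integrableP[/measurable_EFinP mf _] := intf.
have /integrableP[/measurable_EFinP mg _] := intg.
rewrite -subr_ge0 -RintegralB// /Rintegral.
rewrite (_ : (\int[m]_x _)%E = (\int[m]_x `|(g x - f x)%:E|)%E).
  by apply: fine_ge0; exact: integral_ge0.
apply: ae_eq_integral => //.
- by apply/measurable_EFinP; exact: measurable_funB.
- by apply: measurableT_comp => //; apply/measurable_EFinP; exact: measurable_funB.
by apply: ae_weaken fg => x /= fgx _; rewrite ger0_norm ?subr_ge0.
Qed.

Lemma posm_laplace_le nu x y : 0 <= x -> x <= y ->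
  posm_laplace nu y <= posm_laplace nu x.
Proof.
move=> x0 xy; apply: ae_le_Rintegral.
- by apply: integrable_laplace; exact: le_trans xy.
- exact: integrable_laplace.
by apply: ae_weaken (posm_ae nu) => t t0; rewrite ler_expR ler_wpM2r// lerN2.
Qed.

(** From 1 - exp(- u) <= u; the Lipschitz constant is the first moment. *)
Lemma posm_laplace_lip nu x y : (posm nu).-integrable setT (EFin \o id) ->
  0 <= x -> x <= y ->
  posm_laplace nu x - posm_laplace nu y <= (\int[posm nu]_t t) * (y - x).
Proof.
move=> it x0 xy; have y0 := le_trans x0 xy.
rewrite /posm_laplace -RintegralB//; [|exact: integrable_laplace..].
rewrite -RintegralZr//; apply: ae_le_Rintegral.
- by apply: (integrableB measurableT (integrable_laplace _ x0) (integrable_laplace _ y0)).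
- exact: (integrableZr measurableT (y - x) it).
apply: ae_weaken (posm_ae nu) => t t0.
have -> : expR (- y * t) = expR (- x * t) * expR (- ((y - x) * t)).
  by rewrite -expRD; congr expR; ring.
rewrite -{1}[expR (- x * t)]mulr1 -mulrBr.
have h1 : expR (- x * t) <= 1 by rewrite -expR0 ler_expR mulNr oppr_le0 mulr_ge0.
have h2 := expR_ge1Dx (- ((y - x) * t)).
have h3 : 0 <= (y - x) * t by rewrite mulr_ge0// subr_ge0.
have h4 := expR_ge0 (- x * t).
apply: (@le_trans _ _ (expR (- x * t) * ((y - x) * t))).
  by apply: ler_wpM2l => //; lra.
by rewrite [leRHS]mulrC ler_piMl.
Qed.

End signed.

(** * A contraction principle for negative parts *)

Section negative_part.
Context {R : realType}.

Definition negr (x : R) : R := Num.max (- x) 0.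

Lemma negr_ge0 x : 0 <= negr x. Proof. by rewrite le_max lexx orbT. Qed.

Lemma negr_geN x : - x <= negr x. Proof. by rewrite le_max lexx. Qed.

Lemma negr_le_norm x : negr x <= `|x|.
Proof. by rewrite ge_max normr_ge0 andbT -normrN ler_norm. Qed.

Lemma measurable_negr {d} {T : measurableType d} (f : T -> R) :
  measurable_fun setT f -> measurable_fun setT (fun x => negr (f x)).
Proof.
move=> mf; apply: measurable_maxr => //.
exact: measurableT_comp.
Qed.

(** No integrability is assumed: when the integral of f is infinite or
    undefined, its real value is 0 and the bound holds trivially. *)
Lemma neg_Rintegral_le {d} {T : measurableType d}
    (m : {measure set T -> \bar R}) (f : T -> R) : measurable_fun setT f ->
  ((- \int[m]_x f x)%:E <= \int[m]_x (negr (f x))%:E)%E.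
Proof.
move=> mf; rewrite /Rintegral.
have I0 : (0 <= \int[m]_x (negr (f x))%:E)%E.
  by apply: integral_ge0 => x _; rewrite lee_fin negr_ge0.
have : (- (\int[m]_x (f x)%:E) <= \int[m]_x (negr (f x))%:E)%E.
  have -> : (\int[m]_x (negr (f x))%:E = \int[m]_x ((EFin \o f)^\- x))%E.
    apply: eq_integral => x _; rewrite funenegE /negr/=.
    by rewrite EFin_max.
  rewrite integralE.
  have p0 : (0 <= \int[m]_x ((EFin \o f)^\+ x))%E by exact: integral_ge0.
  have n0 : (0 <= \int[m]_x ((EFin \o f)^\- x))%E by exact: integral_ge0.
  move: p0 n0; case: (\int[m]_x ((EFin \o f)^\+ x))%E => [p| |] //;
  case: (\int[m]_x ((EFin \o f)^\- x))%E => [n| |] // p0 n0; rewrite ?leey ?leNye//.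
  by rewrite -EFinB -EFinN lee_fin opprB gerBl.
by case: (\int[m]_x (f x)%:E)%E => [r| |]//=; rewrite oppr0.
Qed.

(** This replaces an average of f over [s, t] by the value c; the factor a is
    kept inside so that a = 0 with an infinite integral is covered. *)
Lemma Rintegral_dist_le (a s t c : R) (f : R -> R) : 0 <= a -> s <= t ->
  measurable_fun setT f ->
  ((a * \int[leb_itv s t]_u f u - a * (t - s) * c)%:E <=
   a%:E * \int[leb_itv s t]_u `|f u - c|%:E)%E.
Proof.
move=> a0 st mf; have [->|an0] := eqVneq a 0.
  by rewrite !mul0r subr0 mul0e.
have mfc : measurable_fun setT (fun u => f u - c) by exact: measurable_funB.
have I0 : (0 <= \int[leb_itv s t]_u `|f u - c|%:E)%E by exact: integral_ge0.
have [Ioo|] := ltP (\int[leb_itv s t]_u `|f u - c|%:E)%E +oo%E; last first.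
  rewrite leye_eq => /eqP ->; rewrite gt0_muley ?leey// lte_fin.
  by rewrite lt_neqAle eq_sym an0.
have ifc : (leb_itv s t).-integrable setT (EFin \o (fun u => f u - c)).
  apply/integrableP; split; first exact/measurable_EFinP.
  exact: Ioo.
have ic : (leb_itv s t).-integrable setT (EFin \o cst c).
  exact: finite_measure_integrable_cst.
have -> : \int[leb_itv s t]_u f u = \int[leb_itv s t]_u (f u - c) + c * (t - s).
  have -> : c * (t - s) = \int[leb_itv s t]_u (cst c u).
    by rewrite Rintegral_cst// -[X in _ * X]/(fine (t - s)%:E) -leb_itvT.
  rewrite -RintegralD//; apply: eq_Rintegral => u _.
  by rewrite subrK.
rewrite mulrDr -!mulrA [c * _]mulrC addrK EFinM lee_wpmul2l ?lee_fin//.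
apply: (@le_trans _ _ (`|\int[leb_itv s t]_u (f u - c)|%:E)).
  by rewrite lee_fin ler_norm.
rewrite EFin_normr_Rintegral//; apply: le_abse_integral => //.
exact/measurable_EFinP.
Qed.

End negative_part.

Section contraction.
Context {dsp : measure_display} {Omega : measurableType dsp} {R : realType}.
Variables (P : probability Omega R) (d : nat).
Local Notation T := (measurableTypeR R).
Variables (m : 'I_d -> 'I_d -> {finite_measure set T -> \bar R}) (a : 'I_d -> R).
Hypothesis a0 : forall j, 0 <= a j.
Hypothesis sub0 : forall q : 'I_d -> R, (forall j, 0 <= q j) ->
  (forall j, a j * q j <= \sum_k fine (m j k setT) * q k) -> forall j, q j = 0.
Variable D : 'I_d -> R -> Omega -> R.
Hypothesis mD : forall j,
  measurable_fun setT (fun tw : T * Omega => D j tw.1 tw.2).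
Variables (M C : R).
Hypothesis bD : forall j t, (\int[P]_w `|D j t w|%:E <= M%:E)%E.
Hypothesis cD : forall j s t, s <= t ->
  (\int[P]_w `|D j t w - D j s w|%:E <= (C * (t - s))%:E)%E.
Hypothesis supD : forall s t, s < t -> {ae P, forall w, forall j,
  \sum_k \int[sprod (leb_itv s t) (m j k)]_z D k (z.1 - z.2) w -
  a j * \int[leb_itv s t]_u D j u w <= D j t w - D j s w}.

Let mDt j t : measurable_fun setT (D j t).
Proof. exact: (measurable_fun_pair2 t (mD j)). Qed.

Let mDw j w : measurable_fun setT (fun t : T => D j t w).
Proof. exact: (measurable_fun_pair1 w (mD j)). Qed.

Let mDc k : measurable_fun setT (fun zw : (T * T) * Omega => D k (zw.1.1 - zw.1.2) zw.2).
Proof.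
have mg : measurable_fun setT (fun zw : (T * T) * Omega => ((zw.1.1 - zw.1.2 : T), zw.2)).
  apply/measurable_fun_pairP; split => /=; last exact: measurable_snd.
  by apply: measurable_funB; apply: (measurableT_comp _ measurable_fst);
    [exact: measurable_fst|exact: measurable_snd].
exact: (measurableT_comp (mD k) mg).
Qed.

Let E j t := (\int[P]_w (negr (D j t w))%:E)%E.

Let E_ge0 j t : (0 <= E j t)%E.
Proof. by apply: integral_ge0 => w _; rewrite lee_fin negr_ge0. Qed.

Let E_le j t : (E j t <= M%:E)%E.
Proof.
apply: le_trans (bD j t); apply: ge0_le_integral => //.
- by move=> w _; rewrite lee_fin negr_ge0.
- by apply/measurable_EFinP; exact: measurable_negr.
- by apply/measurable_EFinP; exact: measurableT_comp.
- by move=> w _; rewrite lee_fin negr_le_norm.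
Qed.

Let q j := sup (range (fun t => fine (E j t))).

Let E_fin j t : E j t \is a fin_num.
Proof. by rewrite ge0_fin_numE// (le_lt_trans (E_le j t))// ltry. Qed.

Let E_q j t : (E j t <= (q j)%:E)%E.
Proof.
rewrite -(fineK (E_fin j t)) lee_fin; apply: ub_le_sup; last by exists t.
by exists M => _ [u _ <-]; rewrite -lee_fin fineK.
Qed.

Let q_ge0 j : 0 <= q j.
Proof. by rewrite -lee_fin; apply: le_trans (E_q j 0). Qed.

(** - D_t is at most the sum of (1 - a h) (- D_s), of minus the delayed terms,
    and of the cost a times the integral of D_u - D_s of freezing D at time s.
    Each of these is bounded by its negative part or its absolute value; the
    condition a h <= 1 keeps the first coefficient non-negative. *)
Let step s t : s < t -> {ae P, forall w, forall j, a j * (t - s) <= 1 ->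
  ((negr (D j t w))%:E <= (1 - a j * (t - s))%:E * (negr (D j s w))%:E +
    \sum_k \int[sprod (leb_itv s t) (m j k)]_z (negr (D k (z.1 - z.2) w))%:E +
    (a j)%:E * \int[leb_itv s t]_u `|D j u w - D j s w|%:E)%E}.
Proof.
move=> st; apply: filterS (supD st) => w h j ah.
have {}h := h j.
set S := (\sum_k _)%E; set I := ((a j)%:E * _)%E.
have S0 : (0 <= S)%E.
  by apply: sume_ge0 => k _; apply: integral_ge0 => z _; rewrite lee_fin negr_ge0.
have I0 : (0 <= I)%E.
  by apply: mule_ge0; [rewrite lee_fin|apply: integral_ge0].
have N0 : (0 <= (1 - a j * (t - s))%:E * (negr (D j s w))%:E)%E.
  by rewrite -EFinM lee_fin mulr_ge0 ?negr_ge0// subr_ge0.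
rewrite {1}/negr EFin_max ge_max; apply/andP; split; last first.
  by rewrite !adde_ge0.
have IE := Rintegral_dist_le (D j s w) (a0 j) (ltW st) (mDw j w).
have SE : ((- \sum_k \int[sprod (leb_itv s t) (m j k)]_z D k (z.1 - z.2) w)%:E <= S)%E.
  rewrite -sumrN -sumEFin; apply: lee_sum => k _.
  by apply: neg_Rintegral_le; exact: (measurable_fun_pair1 w (mDc k)).
apply: (@le_trans _ _ (((1 - a j * (t - s)) * - D j s w)%:E +
   (- \sum_k \int[sprod (leb_itv s t) (m j k)]_z D k (z.1 - z.2) w)%:E +
   (a j * \int[leb_itv s t]_u D j u w - a j * (t - s) * D j s w)%:E)%E).
  by rewrite -!EFinD lee_fin; move: h; lra.
apply: leeD; last exact: IE.
apply: leeD; last exact: SE.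
by rewrite -EFinM lee_fin ler_wpM2l ?subr_ge0// negr_geN.
Qed.

Let E_step j s t : s < t -> a j * (t - s) <= 1 ->
  (E j t <= ((1 - a j * (t - s)) * q j + \sum_k (t - s) * fine (m j k setT) * q k +
    a j * (C * (t - s) * (t - s)))%:E)%E.
Proof.
move=> st ah.
have mnz k : measurable_fun setT (fun zw : (T * T) * Omega =>
    (negr (D k (zw.1.1 - zw.1.2) zw.2))%:E).
  by apply/measurable_EFinP; exact: measurable_negr.
have md : measurable_fun setT (fun uw : T * Omega => `|D j uw.1 uw.2 - D j s uw.2|%:E).
  apply/measurable_EFinP; apply: measurableT_comp => //; apply: measurable_funB => //.
  by apply: (measurableT_comp (mDt j s)); exact: measurable_snd.
pose pk k : {sigma_finite_measure set (T * T)%type -> \bar R} := sprod (leb_itv s t) (m j k).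
have C0 : 0 <= C.
  have := le_trans (integral_ge0 _ _) (cD j (ltW st)); rewrite lee_fin.
  by rewrite pmulr_lge0 ?subr_gt0//; apply.
have mS k : measurable_fun setT
    (fun w => (\int[pk k]_z (negr (D k (z.1 - z.2) w))%:E)%E).
  apply: (@measurable_fun_fubini_tonelli_G _ _ _ _ _ (pk k) _ (mnz k)) => zw.
  by rewrite lee_fin negr_ge0.
have mI : measurable_fun setT
    (fun w => (\int[leb_itv s t]_u `|D j u w - D j s w|%:E)%E).
  exact: (@measurable_fun_fubini_tonelli_G _ _ _ _ _ (leb_itv s t) _ md).
have mN : measurable_fun setT (fun w => (1 - a j * (t - s))%:E * (negr (D j s w))%:E)%E.
  by apply/measurable_EFinP; apply: measurable_funM => //; exact: measurable_negr.
have N0 w : (0 <= (1 - a j * (t - s))%:E * (negr (D j s w))%:E)%E.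
  by rewrite -EFinM lee_fin mulr_ge0 ?negr_ge0// subr_ge0.
have S0 w k : (0 <= \int[pk k]_z (negr (D k (z.1 - z.2) w))%:E)%E.
  by apply: integral_ge0 => z _; rewrite lee_fin negr_ge0.
have aI0 w : (0 <= (a j)%:E * \int[leb_itv s t]_u `|D j u w - D j s w|%:E)%E.
  by apply: mule_ge0; [rewrite lee_fin|apply: integral_ge0].
have SS0 w : (0 <= \sum_k \int[pk k]_z (negr (D k (z.1 - z.2) w))%:E)%E.
  by apply: sume_ge0 => k _; exact: S0.
have NS0 w : (0 <= (1 - a j * (t - s))%:E * (negr (D j s w))%:E +
    \sum_k \int[pk k]_z (negr (D k (z.1 - z.2) w))%:E)%E by exact: adde_ge0.
have NSI0 w : (0 <= (1 - a j * (t - s))%:E * (negr (D j s w))%:E +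
    \sum_k \int[pk k]_z (negr (D k (z.1 - z.2) w))%:E +
    (a j)%:E * \int[leb_itv s t]_u `|D j u w - D j s w|%:E)%E by exact: adde_ge0.
have mSS : measurable_fun setT
    (fun w => (\sum_k \int[pk k]_z (negr (D k (z.1 - z.2) w))%:E)%E).
  by apply: emeasurable_sum => k _; exact: mS.
have maI : measurable_fun setT
    (fun w => ((a j)%:E * \int[leb_itv s t]_u `|D j u w - D j s w|%:E)%E).
  exact: emeasurable_funM.
apply: (@le_trans _ _ (\int[P]_w ((1 - a j * (t - s))%:E * (negr (D j s w))%:E +
    \sum_k \int[sprod (leb_itv s t) (m j k)]_z (negr (D k (z.1 - z.2) w))%:E +
    (a j)%:E * \int[leb_itv s t]_u `|D j u w - D j s w|%:E))%E).
  apply: ae_ge0_le_integral => //.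
  - by move=> w _; rewrite lee_fin negr_ge0.
  - by apply/measurable_EFinP; exact: measurable_negr.
  - by apply: emeasurable_funD => //; exact: emeasurable_funD.
  - by apply: filterS (step st) => w h _; exact: h.
rewrite ge0_integralD//; last exact: emeasurable_funD.
rewrite ge0_integralD//.
rewrite !EFinD; apply: leeD; first apply: leeD.
- rewrite ge0_integralZl//; last 3 first.
  + by apply/measurable_EFinP; exact: measurable_negr.
  + by move=> w _; rewrite lee_fin negr_ge0.
  + by rewrite lee_fin subr_ge0.
  by rewrite EFinM; apply: lee_wpmul2l; [rewrite lee_fin subr_ge0|exact: E_q].
- rewrite ge0_integral_sum; [|exact: measurableT|exact: mS|by move=> k w _; exact: S0];
    rewrite -sumEFin; apply: lee_sum => k _.
  have nz0 (zw : (T * T) * Omega) : (0 <= (negr (D k (zw.1.1 - zw.1.2) zw.2))%:E)%E.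
    by rewrite lee_fin negr_ge0.
  rewrite (_ : (\int[P]_w _)%E = (\int[pk k]_z E k (z.1 - z.2))%E); last first.
    exact: esym (@fubini_tonelli _ _ _ _ _ (pk k) P _ (mnz k) nz0).
  apply: (@le_trans _ _ (\int[pk k]_z (q k)%:E)%E).
    apply: ge0_le_integral => //.
    - exact: (@measurable_fun_fubini_tonelli_F _ _ _ _ _ P _ (mnz k) nz0).
  have -> : (\int[pk k]_z (q k)%:E = (q k)%:E * ((t - s)%:E * m j k setT))%E.
    rewrite integral_cst//; congr (_ * _)%E; rewrite -(leb_itvT (ltW st)) -setXTT.
    exact: product_measure1E.
  by rewrite -[m j k setT]fineK ?fin_num_measure// -!EFinM lee_fin [leLHS]mulrC.
- rewrite ge0_integralZl//; last 2 first; [by move=> w _; exact: integral_ge0|by rewrite lee_fin|].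
  rewrite EFinM; apply: lee_wpmul2l; first by rewrite lee_fin.
  rewrite (_ : (\int[P]_w _)%E = (\int[leb_itv s t]_u \int[P]_w `|D j u w - D j s w|%:E)%E);
    last first.
    exact: esym (@fubini_tonelli _ _ _ _ _ (leb_itv s t) P _ md (fun=> _)).
  have mE : measurable_fun setT (fun u : T => \int[P]_w `|D j u w - D j s w|%:E)%E.
    exact: (@measurable_fun_fubini_tonelli_F _ _ _ _ _ P _ md).
  rewrite integral_leb_itv//.
  apply: (@le_trans _ _ (\int[lebesgue_measure]_(u in `[s, t]) (C * (t - s))%:E)%E).
    apply: ge0_le_integral => //; [by move=> u _; exact: integral_ge0|exact: measurable_funTS|].
    move=> u /=; rewrite in_itv/= => /andP[su ut].
    apply: (le_trans (cD j su)); rewrite lee_fin ler_wpM2l// lerB//.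
  rewrite integral_cst// [X in (_ <= X)%E]EFinM; apply: lee_wpmul2l.
    by rewrite lee_fin mulr_ge0// subr_ge0 ltW.
  by rewrite -(leb_itvT (ltW st)) /= /mfrestr /mrestr setTI.
Qed.

(** Let q_j be the supremum over t of E j t, the mean of the negative part of
    D j t.  By [E_step], q_j <= (1 - a_j h) q_j + h sum_k m_jk(R) q_k + O(h^2);
    dividing by h and letting h tend to 0 gives the hypothesis of [sub0]. *)
Lemma contraction_nonneg t : {ae P, forall w, forall j, 0 <= D j t w}.
Proof.
have q0 j : q j = 0.
  apply: sub0 => // {}j.
  set N := (leRHS).
  have C0 : 0 <= C.
    have := le_trans (integral_ge0 _ _) (cD j (@ler01 R)); rewrite lee_fin subr0 mulr1.
    by apply.
  have hq h : 0 < h -> a j * h <= 1 -> a j * q j <= N + a j * C * h.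
    move=> h0 ah.
    suff : q j <= (1 - a j * h) * q j + h * N + a j * (C * h * h).
      by move=> H; rewrite -(ler_pM2l h0); lra.
    apply: ge_sup; first by exists (fine (E j 0)); exists 0.
    move=> _ [u _ <-]; rewrite -lee_fin fineK//.
    have hu : u - (u - h) = h by rewrite opprB addrC subrK.
    have := @E_step j (u - h) u; rewrite hu gtrBl => /(_ h0 ah)/le_trans; apply.
    rewrite lee_fin; apply: lerD => //; apply: lerD => //.
    by rewrite mulr_sumr; apply: ler_sum => k _; rewrite mulrA.
  apply/ler_addgt0Pr => e e0.
  pose K := 1 + a j + a j * C.
  have K0 : 0 < K by rewrite /K -addrA ltr_pwDl// addr_ge0// mulr_ge0.
  have h1 : 0 < (1 + e) by rewrite ltr_pwDl// ltW.
  (* h satisfies both a j * h <= 1 and a j * C * h <= e. *)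
  pose h := e / (K * (1 + e)).
  have h0 : 0 < h by rewrite divr_gt0// mulr_gt0.
  have Kh : K * h = e / (1 + e) by rewrite /h; field; rewrite !gt_eqF.
  have e1 : e / (1 + e) <= 1 by rewrite ler_pdivrMr// mul1r lerDr.
  have e2 : e / (1 + e) <= e by rewrite ler_pdivrMr// mulrDr mulr1 lerDl mulr_ge0 ?ltW.
  have ajC : 0 <= a j * C by exact: mulr_ge0.
  have aj := a0 j.
  have ah1 : a j * h <= 1 by apply: le_trans e1; rewrite -Kh ler_wpM2r ?ltW// /K; lra.
  apply: (le_trans (hq h h0 ah1)); rewrite lerD2l.
  by apply: le_trans e2; rewrite -Kh ler_wpM2r ?ltW// /K; lra.
have D0 j : {ae P, forall w, 0 <= D j t w}.
  have : (\int[P]_w `|(negr (D j t w))%:E|)%E = 0%E.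
    apply/eqP; rewrite eq_le integral_ge0// andbT.
    have := E_q j t; rewrite q0; apply: le_trans.
    rewrite le_eqVlt; apply/orP; left; apply/eqP; apply: eq_integral => w _.
    by rewrite /= ger0_norm ?negr_ge0.
  move/(ae_eq_integral_abs P measurableT _).
  have mn : measurable_fun setT (fun w => (negr (D j t w))%:E).
    by apply/measurable_EFinP; exact: measurable_negr.
  move=> /(_ mn); apply: filterS => w /(_ I) [nD].
  by have := negr_geN (D j t w); rewrite nD oppr_le0.
exact: filter_forall.
Qed.

End contraction.

(** * The characteristic matrix on the half-line *)

Section delay_matrix.
Context {R : realType} {d : nat}.
Variable phi : 'M[signed_measure R]_d.
Hypothesis hphi2 : forall j k,
  (\int[abs_measure (phi j k)]_(t in `[0%R, +oo[) (t ^+ 2)%:E < +oo)%E.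
Hypothesis hdet : forall z : R[i], 0 <= complex.Re z -> \det (h_phi phi z) != 0.
Hypothesis heta : forall j k (A : set (measurableTypeR R)),
  measurable A -> (0 <= eta_mx phi j k A)%E.
Hypothesis hlambda : M_matrix (lambda_mx phi).

(** The off-diagonal entries of an M-matrix are non-positive, so phi_jk has a
    non-negative atom at the origin. *)
Lemma negmass_off j k : j != k -> negmass (phi j k) = 0.
Proof.
move=> jk; apply: negmass_eq0 => [A mA|]; first exact: heta.
have [alpha [B [_ B0 _ /matrixP/(_ j k)]]] := hlambda.
rewrite !mxE (negbTE jk) mulr0n sub0r => /oppr_inj E.
rewrite -[X in (_ <= X)%E]fineK; last by apply: fin_num_measure; exact: measurable_set1.
by rewrite lee_fin E.
Qed.

Definition h_real (x : R) : 'M[R]_d :=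
  \matrix_(j, k) (x *+ (j == k) + negmass (phi j k) - posm_laplace (phi j k) x).

Lemma h_phi_real x : h_phi phi x%:C = map_mx (real_complex R) (h_real x).
Proof.
apply/matrixP => j k; rewrite !mxE.
have E : signed_cint (phi j k) (fun t => cexp (- x%:C * t%:C)) =
    (posm_laplace (phi j k) x - negmass (phi j k))%:C.
  have cE t : cexp (- x%:C * t%:C) = (expR (- x * t))%:C.
    by rewrite -rmorphN -rmorphM /cexp /= cos0 sin0 mulr1 mulr0.
  rewrite /signed_cint.
  rewrite (_ : (fun t => complex.Re _) = fun t => expR (- x * t)); last first.
    by apply/funext => t; rewrite cE.
  rewrite (_ : (fun t => complex.Im _) = cst 0); last first.
    by apply/funext => t; rewrite cE.
  rewrite !signed_intE//; last first.
  - by apply: measurableT_comp => //; exact: mulrl_measurable.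
  - by move=> A mA; exact: heta.
  - by move=> A mA; exact: heta.
  by rewrite /= mulr0 expR0 mulr1 Rintegral_cst// mul0r mulr0 subr0.
by rewrite E; case: (j == k); rewrite ?mulr1n ?mulr0n -!(rmorphB, rmorphD)/=; congr _%:C; ring.
Qed.

(** [monotone_at0] applies: the Laplace transforms decrease in x, are Lipschitz
    by their first moments, and for x above the total mass the row sums are
    positive, so that the constant vector is the required positive vector. *)
Lemma h_real_monotone : monotone_mx (h_real 0).
Proof.
pose N := \sum_j \sum_k fine (posm (phi j k) setT).
pose C := \sum_j \sum_k `|\int[posm (phi j k)]_t t|.
have L0 j k x : 0 <= x -> 0 <= posm_laplace (phi j k) x.
  by move=> x0; apply: Rintegral_ge0 => t _; exact: expR_ge0.
have LN j k x : 0 <= x -> posm_laplace (phi j k) x <= fine (posm (phi j k) setT).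
  move=> x0; apply: (le_trans (posm_laplace_le _ (lexx 0) x0)).
  rewrite /posm_laplace (_ : (fun t : measurableTypeR R => _) = cst 1) ?Rintegral_cst ?mul1r//.
  by apply/funext => t; rewrite oppr0 mul0r expR0.
have N0 : 0 <= N by apply: sumr_ge0 => j _; apply: sumr_ge0 => k _; exact: fine_ge0.
have C0 : 0 <= C by apply: sumr_ge0 => j _; apply: sumr_ge0 => k _.
apply: (@monotone_at0 R d h_real _ _ (1 + C) _ _ (1 + N) (const_mx 1)).
- move=> x x0 j k jk; rewrite mxE (negbTE jk) mulr0n negmass_off// add0r add0r.
  by rewrite oppr_le0 L0.
- move=> x y j k x0 xy; rewrite !mxE lerB ?posm_laplace_le// lerD2r.
  by case: (j == k); rewrite ?mulr1n ?mulr0n.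
- have lip x y j k : 0 <= x -> x <= y -> `|h_real x j k - h_real y j k| <= (1 + C) * `|x - y|.
    move=> x0 xy; rewrite !mxE.
    have h1 := posm_laplace_lip (posm_first_moment (hphi2 j k)) x0 xy.
    have h2 := posm_laplace_le (phi j k) x0 xy.
    have h3 : `|x - y| = y - x by rewrite distrC ger0_norm ?subr_ge0.
    have h4 : \int[posm (phi j k)]_t t <= C.
      apply: (le_trans (ler_norm _)); rewrite /C (bigD1 j)//= (bigD1 k)//=.
      by rewrite -addrA lerDl addr_ge0// ?sumr_ge0// => i _; rewrite sumr_ge0.
    have h5 : (\int[posm (phi j k)]_t t) * (y - x) <= C * (y - x).
      by rewrite ler_wpM2r// subr_ge0.
    rewrite h3 mulrDl mul1r ler_norml; case: (j == k); rewrite ?mulr1n ?mulr0n;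
      by apply/andP; split; lra.
  move=> x y j k x0 y0; have [xy|/ltW yx] := leP x y; first exact: lip.
  by rewrite distrC [`|x - y|]distrC lip.
- move=> x x0; have := hdet (z := x%:C); rewrite h_phi_real det_map_mx /= => /(_ x0).
  by apply: contra_neq => ->.
- by rewrite addr_ge0.
- by move=> j; rewrite mxE.
- move=> j; rewrite mxE; under eq_bigr do rewrite !mxE mulr1.
  rewrite sumrB big_split/=.
  have -> : \sum_k (1 + N) *+ (j == k) = 1 + N.
    rewrite (bigD1 j)//= eqxx big1 ?addr0// => k; rewrite eq_sym => /negbTE -> .
    by [].
  have n0 : 0 <= \sum_k negmass (phi j k) by apply: sumr_ge0 => k _; exact: negmass_ge0.
  have : \sum_k posm_laplace (phi j k) (1 + N) <= N.
    rewrite /N [leRHS](bigD1 j)//= ler_wpDr//.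
      by apply: sumr_ge0 => i _; apply: sumr_ge0 => k _; exact: fine_ge0.
    by apply: ler_sum => k _; rewrite LN// addr_ge0.
  lra.
Qed.

(** The hypothesis says that h_phi(0) maps - q to a non-negative vector. *)
Lemma subinvariant_eq0 (q : 'I_d -> R) : (forall j, 0 <= q j) ->
  (forall j, negmass (phi j j) * q j <=
     \sum_k fine (posm (phi j k) setT) * q k) -> forall j, q j = 0.
Proof.
move=> q0 qsub j; apply/eqP; rewrite eq_le q0 andbT.
have := h_real_monotone (u := \col_i - q i); rewrite -oppr_ge0.
move=> /(_ _ j); rewrite mxE; apply => {}j; rewrite mxE.
under eq_bigr do rewrite !mxE mulrN mulrBl mul0rn add0r opprB.
rewrite sumrB subr_ge0 (bigD1 j)//= big1 ?addr0; last first.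
  by move=> k kj; rewrite negmass_off ?mul0r// eq_sym.
apply: (le_trans (qsub j)); apply: ler_sum => k _.
rewrite /posm_laplace (_ : (fun t : measurableTypeR R => _) = cst 1) ?Rintegral_cst ?mul1r//.
by apply/funext => t; rewrite oppr0 mul0r expR0.
Qed.

End delay_matrix.

(** * Paths and means of two-sided subordinators *)

Lemma same_law_integral {dsp} {Omega : measurableType dsp} {R : realType}
    (P : probability Omega R) (I : Type) (D : set I) (Z Z' : I -> Omega -> R)
    (i : I) (f : R -> \bar R) :
  same_law P D Z Z' -> D i -> measurable_fun setT (Z i) -> measurable_fun setT (Z' i) ->
  measurable_fun setT f -> (forall x, 0 <= f x)%E ->
  (\int[P]_w f (Z i w) = \int[P]_w f (Z' i w))%E.
Proof.
move=> ZZ' Di mZ mZ' mf f0.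
rewrite -(@ge0_integral_pushforward _ _ _ _ _ (Z i) mZ P setT f)//.
rewrite -(@ge0_integral_pushforward _ _ _ _ _ (Z' i) mZ' P setT f)//.
apply: eq_measure_integral => A mA _.
apply: (ZZ' [set x | A (x i)]); apply: sub_sigma_algebra.
by exists i => //; exists A.
Qed.

Section additive.
Context {R : realType}.

(** Monotonicity squeezes n f(t) between f(k) and f(k + 1) when n t lies
    between k and k + 1. *)
Lemma additive_nondecreasing_linear (f : R -> R) :
  (forall s t, 0 <= s -> 0 <= t -> f (s + t) = f s + f t) ->
  (forall t, 0 <= t -> 0 <= f t) ->
  forall t, 0 <= t -> f t = f 1 * t.
Proof.
move=> fD f0 t t0.
have nd s u : 0 <= s -> s <= u -> f s <= f u.
  by move=> s0 su; rewrite -[u](subrKC s) fD ?subr_ge0// lerDl f0// subr_ge0.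
have fM n s : 0 <= s -> f (n%:R * s) = n%:R * f s.
  move=> s0; elim: n => [|n IH].
    rewrite !mul0r; have := fD 0 0 (lexx 0) (lexx 0).
    by rewrite addr0 => /eqP; rewrite -subr_eq0 opprD addNKr oppr_eq0 => /eqP.
  by rewrite -natr1 !mulrDl !mul1r fD ?mulr_ge0// IH.
have fn n : f n%:R = n%:R * f 1 by rewrite -[n%:R in LHS]mulr1 fM.
have c0 := f0 1 ler01.
have bnd n : n.+1%:R * `|f t - f 1 * t| <= f 1.
  pose k := Num.truncn (n.+1%:R * t).
  have nt0 : 0 <= n.+1%:R * t by rewrite mulr_ge0.
  have /andP[k1 k2] : k%:R <= n.+1%:R * t < k.+1%:R by exact: truncn_itv.
  have h1 := nd _ _ (ler0n _ _) k1; have h2 := nd _ _ nt0 (ltW k2).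
  rewrite fn fM// in h1; rewrite fn fM// in h2.
  have h3 : k%:R * f 1 <= n.+1%:R * t * f 1 by rewrite ler_wpM2r.
  have h4 : n.+1%:R * t * f 1 <= k.+1%:R * f 1 by rewrite ler_wpM2r// ltW.
  rewrite -[X in X * _]ger0_norm// -normrM ler_norml.
  rewrite -natr1 mulrDl mul1r in h2 h4.
  by rewrite mulrBr; apply/andP; split; lra.
apply/eqP; rewrite -subr_eq0 -normr_le0 leNgt; apply/negP => e0.
have := bnd (Num.truncn (f 1 / `|f t - f 1 * t|)).
apply/negP; rewrite -ltNge -ltr_pdivrMr//; exact: truncnS_gt.
Qed.

End additive.

Section one_sided.
Context {dsp : measure_display} {Omega : measurableType dsp} {R : realType}.
Variables (P : probability Omega R) (n : nat) (S : process P n).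
Hypothesis hS : subordinator S.

Lemma measurable_process (X : process P n) j t : measurable_fun setT (X j t : Omega -> R).
Proof. exact: measurable_funPT. Qed.

Let e j t : \bar R := (\int[P]_w `|S j t w|%:E)%E.

Let S0 j t : 0 <= t -> {ae P, forall w, 0 <= S j t w}.
Proof.
move=> t0; have [[Sz _ _ _] Sinc] := hS.
apply: filterS2 Sz (Sinc 0 t (lexx 0) t0) => w S0w /(_ j).
by rewrite S0w subr0.
Qed.

Lemma measurable_normr_EFin (f : Omega -> R) : measurable_fun setT f ->
  measurable_fun setT (fun w => `|f w|%:E).
Proof. by move=> mf; apply/measurable_EFinP; exact: measurableT_comp. Qed.

Lemma subordinator_mean_increment j s t : 0 <= s -> s <= t ->
  (\int[P]_w `|S j t w - S j s w|%:E = e j (t - s))%E.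
Proof.
move=> s0 st; have [[_ _ Sst _] _] := hS.
apply: (same_law_integral (f := fun x => `|x|%:E) (Sst s t s0 st) (i := j)) => //=.
- by apply: measurable_funB; [exact: (measurable_process S j t)|exact: (measurable_process S j s)].
- by apply/measurable_EFinP; exact: normr_measurable.
Qed.

Let eD j s t : 0 <= s -> 0 <= t -> (e j (s + t) = e j s + e j t)%E.
Proof.
move=> s0 t0; have st : s <= s + t by rewrite lerDl.
have -> : e j t = e j ((s + t) - s) by rewrite addrAC subrr add0r.
rewrite -subordinator_mean_increment// -ge0_integralD//; last 2 first.
- by apply: measurable_normr_EFin; exact: measurable_process.
- by apply: measurable_normr_EFin; apply: measurable_funB; exact: measurable_process.
apply: ge0_ae_eq_integral => //.
- by apply: measurable_normr_EFin; exact: measurable_process.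
- apply: emeasurable_funD; apply: measurable_normr_EFin; first exact: measurable_process.
  by apply: measurable_funB; exact: measurable_process.
- by move=> w _; exact: adde_ge0.
have [_ Sinc] := hS.
have h : {ae P, forall w, 0 <= S j s w /\ 0 <= S j (s + t) w - S j s w}.
  by apply: filterS2 (S0 j s0) (Sinc s (s + t) s0 st) => w Ss /(_ j).
apply: filterS h => w [Ss Sst] _.
have Sst0 : 0 <= S j (s + t) w by apply: (le_trans Ss); rewrite -subr_ge0.
by rewrite -EFinD !ger0_norm// addrCA subrr addr0.
Qed.

(** The mean is additive in time by stationarity of the increments, and
    non-decreasing. *)
Lemma subordinator_mean j : (e j 1 < +oo)%E ->
  exists2 c, 0 <= c & forall t, 0 <= t -> e j t = (c * t)%:E.
Proof.
move=> e1; have e0 t : (0 <= e j t)%E by exact: integral_ge0.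
have en (k : nat) : (e j k%:R < +oo)%E.
  elim: k => [|k IH].
    apply: le_lt_trans e1; rewrite -[X in (_ <= e j X)%E]add0r eD// leeDl//.
  by rewrite -natr1 eD// lte_add_pinfty.
have efin t : 0 <= t -> e j t \is a fin_num.
  move=> t0; rewrite ge0_fin_numE//; apply: le_lt_trans (en (Num.truncn t).+1).
  have h : 0 <= (Num.truncn t).+1%:R - t by rewrite subr_ge0 ltW// truncnS_gt.
  by rewrite -[X in (_ <= e j X)%E](subrKC t) eD// leeDl.
exists (fine (e j 1)); first exact: fine_ge0.
move=> t t0; rewrite -(additive_nondecreasing_linear (f := fun t => fine (e j t)))//.
- by rewrite fineK// efin.
- by move=> s u s0 u0; rewrite eD// fineD// efin.
- by move=> s s0; exact: fine_ge0.
Qed.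

End one_sided.

Section paths.
Context {R : realType}.
Variables f1 f2 f : R -> R.
Hypotheses (f1c : cadlag f1) (f2c : cadlag f2).
Hypotheses (f10 : f1 0 = 0) (f20 : f2 0 = 0).
Hypothesis nd1 : forall s t, 0 <= s -> s <= t -> f1 s <= f1 t.
Hypothesis nd2 : forall s t, 0 <= s -> s <= t -> f2 s <= f2 t.
Hypothesis fpos : forall t, 0 <= t -> f t = f1 t.
Hypothesis fneg : forall t, t < 0 -> f t = - lim (f2 s @[s --> (- t)^'-]).

Lemma left_limit_ge x s : 0 <= s -> s < x -> f2 s <= lim (f2 s @[s --> x^'-]).
Proof.
move=> s0 sx; apply: limr_ge; first by apply: f2c.2; exact: le_lt_trans sx.
near=> u; apply: nd2 => //; near: u; exact: nbhs_left_ge.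
Unshelve. all: by end_near. Qed.

Lemma left_limit_le x : 0 < x -> lim (f2 s @[s --> x^'-]) <= f2 x.
Proof.
move=> x0; apply: limr_le; first exact: f2c.2.
near=> u; apply: nd2.
  by near: u; apply: nbhs_left_ge.
by near: u; exact: nbhs_left_le.
Unshelve. all: by end_near. Qed.

Lemma two_sided_path_nd : nondecreasing f.
Proof.
move=> a b ab; have [a0|a0] := leP 0 a.
  by rewrite !fpos// ?nd1// (le_trans a0).
have [b0|b0] := leP 0 b.
  rewrite (fneg a0) (fpos b0) (@le_trans _ _ 0)//; last by rewrite -f10 nd1.
  by rewrite oppr_le0 -f20 left_limit_ge// oppr_gt0.
rewrite !fneg// lerN2.
have := ab; rewrite le_eqVlt => /predU1P[->//|{}ab].
apply: (@le_trans _ _ (f2 (- b))); first by apply: left_limit_le; rewrite oppr_gt0.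
by apply: left_limit_ge; rewrite ?ltrN2// oppr_ge0 ltW.
Qed.

(** At a negative time t the value is minus the left limit of f2 at - t; as s
    decreases to t, the left limits of f2 at - s converge to it. *)
Lemma two_sided_path_rc : right_continuous f.
Proof.
move=> t; have [t0|t0] := leP 0 t.
  rewrite (fpos t0); apply: (cvg_trans _ (f1c.1 _ t0)).
  apply: near_eq_cvg; near=> s; rewrite fpos//; apply: (le_trans t0).
  by near: s; exact: nbhs_right_ge.
apply/cvgrPdist_le => e e0.
have nt0 : 0 < - t by rewrite oppr_gt0.
have /cvgrPdist_le/(_ e e0) := f2c.2 _ nt0.
move=> [dl /= dl0 hd].
near=> s.
have ts : t <= s by near: s; exact: nbhs_right_ge.
have s0 : s < 0 by near: s; exact: nbhs_right_lt.
rewrite distrC ger0_norm ?subr_ge0 ?two_sided_path_nd//.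
rewrite (fneg t0) (fneg s0) opprK addrC.
have sd : s < t + dl by near: s; apply: nbhs_right_lt; rewrite ltrDl.
have ts' : t < s by near: s; exact: nbhs_right_gt.
pose x := Num.max (((- t - dl) + (- s)) / 2) ((- s) / 2).
have x0 : 0 <= x by rewrite le_max [X in _ || X]divr_ge0 ?orbT// oppr_ge0 ltW.
have xs : x < - s by rewrite gt_max; apply/andP; split; lra.
have xd : - t - dl < x by rewrite lt_max; apply/orP; left; lra.
have h1 := left_limit_ge x0 xs.
have : `|lim (f2 s0 @[s0 --> (- t)^'-]) - f2 x| <= e.
  apply: hd => /=; last by lra.
  by rewrite /ball/= ger0_norm; lra.
have h2 : f2 x <= lim (f2 s0 @[s0 --> (- t)^'-]) by apply: left_limit_ge => //; lra.
rewrite ger0_norm ?subr_ge0//; lra.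
Unshelve. all: by end_near. Qed.

(** Since the left limit at - t lies between the values of f2 just before - t
    and at - t, moments at negative times follow from those of f2 at fixed times. *)
Lemma two_sided_path_bounds t s : t < 0 -> 0 <= s -> s < - t ->
  f2 s <= `|f t| <= f2 (- t).
Proof.
move=> t0 s0 st; rewrite (fneg t0) normrN.
have h := left_limit_ge s0 st.
rewrite ger0_norm; last by apply: le_trans h; rewrite -f20 nd2.
by rewrite h left_limit_le// oppr_gt0.
Qed.

End paths.

Section subordinator_paths.
Context {dsp : measure_display} {Omega : measurableType dsp} {R : realType}.
Variables (P : probability Omega R) (n : nat) (S : process P n).
Hypothesis hS : subordinator S.

Lemma right_limit_le (f g : R -> R) (s t : R) : s < t ->
  f r @[r --> s^'+] --> f s -> f r @[r --> t^'+] --> f t ->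
  (forall p q : rat, s < ratr p -> ratr p <= ratr q :> R -> f (ratr p) <= f (ratr q)) ->
  f s <= f t.
Proof.
move=> st /cvgrPdist_lt fs /cvgrPdist_lt ft frat; rewrite leNgt; apply/negP => ts.
pose e := (f s - f t) / 2.
have e0 : 0 < e by rewrite divr_gt0// subr_gt0.
have [d1 /= d10 h1] := fs _ e0; have [d2 /= d20 h2] := ft _ e0.
have [p] : exists p, ratr p \in `]s, Num.min t (s + d1)[.
  by apply: rat_in_itvoo; rewrite lt_min st ltrDl.
rewrite in_itv/= lt_min => /and3P[sp pt pd].
have [q] : exists q, ratr q \in `]t, (t + d2)[ by apply: rat_in_itvoo; rewrite ltrDl.
rewrite in_itv/= => /andP[tq qd].
have := frat p q sp (ltW (lt_trans pt tq)).
have := h1 (ratr p); rewrite /ball/= distrC ger0_norm ?subr_ge0 ?(ltW sp)//.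
move=> /(_ _ sp); rewrite ltrBlDl => /(_ pd); rewrite ltr_norml => /andP[_ k1].
have := h2 (ratr q); rewrite /ball/= distrC ger0_norm ?subr_ge0 ?(ltW tq)//.
move=> /(_ _ tq); rewrite ltrBlDl => /(_ qd); rewrite ltr_norml => /andP[k2 _].
rewrite /e in k1 k2; lra.
Qed.

(** The increments are almost surely non-negative for each fixed pair of times;
    countably many rational pairs suffice by right-continuity
    ([right_limit_le]). *)
Lemma subordinator_paths_nd : {ae P, forall w, forall j, [/\ S j 0 w = 0,
  cadlag (fun t => S j t w) &
  forall s t, 0 <= s -> s <= t -> S j s w <= S j t w]}.
Proof.
have [[Sz _ _ Sc] Sinc] := hS.
have hrat : {ae P, forall w, forall (k : nat) (j : 'I_n) (p q : rat),
    unpickle k = Some (p, q) -> 0 <= ratr p :> R -> ratr p <= ratr q :> R ->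
    S j (ratr p) w <= S j (ratr q) w}.
  apply: ae_foralln => k.
  case: (@unpickle (rat * rat)%type k) => [[p q]|]; last by apply: aeW.
  have [p0|p0] := leP 0 (ratr p : R); last first.
    by apply: aeW => w j p' q' [<- _]; rewrite leNgt p0.
  have [pq|pq] := leP (ratr p : R) (ratr q); last first.
    by apply: aeW => w j p' q' [<- <-] _; rewrite leNgt pq.
  apply: filterS (Sinc _ _ p0 pq) => w h j p' q' [<- <-] _ _.
  by rewrite -subr_ge0; exact: h.
apply: filterS3 Sz Sc hrat => w S0 cS hr j; split => //.
move=> s t s0; rewrite le_eqVlt => /predU1P[->//|st].
apply: (right_limit_le (f := fun t => S j t w) (fun=> 0) st).
- exact: (cS j).1.
- by apply: (cS j).1; rewrite (le_trans s0)// ltW.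
move=> p q sp pq; apply: (hr (pickle (p, q))) => //; first exact: pickleK.
by rewrite (le_trans s0)// ltW.
Qed.

End subordinator_paths.

Section two_sided.
Context {dsp : measure_display} {Omega : measurableType dsp} {R : realType}.
Variables (P : probability Omega R) (n : nat) (L : process P n).
Hypothesis hL : two_sided_subordinator L.

Lemma two_sided_paths : {ae P, forall w, forall j,
  nondecreasing (fun t => L j t w) /\ right_continuous (fun t => L j t w)}.
Proof.
have [L1 [L2 [s1 s2 _ _ LE]]] := hL.
apply: filterS3 LE (subordinator_paths_nd s1) (subordinator_paths_nd s2).
move=> w Lw h1 h2 j; have [z1 c1 n1] := h1 j; have [z2 c2 n2] := h2 j.
split.
- by apply: (two_sided_path_nd c2 z1 z2 n1 n2) => t t0; have [] := Lw j t; auto.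
- by apply: (two_sided_path_rc c1 c2 z1 z2 n1 n2) => t t0; have [] := Lw j t; auto.
Qed.

Hypothesis hL1 : finite_first_moment L 1.

Lemma coordinate_le_norm (x : 'I_n -> R) j : `|x j| <= euclidean_norm x.
Proof.
rewrite /euclidean_norm -sqrtr_sqr ler_sqrt; last by apply: sumr_ge0 => i _; exact: sqr_ge0.
by rewrite (bigD1 j)//= lerDl sumr_ge0// => i _; exact: sqr_ge0.
Qed.

Lemma first_moment_coordinate (X : process P n) t j : finite_first_moment X t ->
  (\int[P]_w `|X j t w|%:E < +oo)%E.
Proof.
apply: le_lt_trans; apply: ge0_le_integral => //.
- by apply: measurable_normr_EFin; exact: measurable_process.
- apply/measurable_EFinP.
  have msqrt : measurable_fun setT (Num.sqrt : R -> R).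
    by apply: continuous_measurable_fun; exact: sqrt_continuous.
  apply: (measurableT_comp msqrt (g := fun w => \sum_j X j t w ^+ 2)).
  by apply: measurable_sum => i; apply: measurable_funX; exact: measurable_process.
- by move=> w _; rewrite lee_fin; exact: (coordinate_le_norm (fun j => X j t w)).
Qed.

(** The mean of the absolute value at time t is c |t|; for t < 0 it is squeezed
    between the means of L2 at times below - t and at - t.  The increments
    follow as the paths increase through 0 at time 0. *)
Lemma two_sided_mean : exists c : 'I_n -> R, (forall j, 0 <= c j) /\
  forall j s t, s <= t ->
    (\int[P]_w `|L j t w - L j s w|%:E = (c j * (t - s))%:E)%E.
Proof.
have [L1 [L2 [s1 s2 _ lawL LE]]] := hL.
have L1E j t : 0 <= t -> (\int[P]_w `|L j t w|%:E = \int[P]_w `|L1 j t w|%:E)%E.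
  move=> t0; apply: ge0_ae_eq_integral => //; [by apply: measurable_normr_EFin; exact: measurable_process..|].
  by apply: filterS LE => w /(_ j t)[/(_ t0) -> _].
have hc j : exists c, 0 <= c /\
    forall t, 0 <= t -> (\int[P]_w `|L1 j t w|%:E = (c * t)%:E)%E.
  have [|c c0 h] := subordinator_mean s1 (j := j).
    by rewrite -L1E//; exact: first_moment_coordinate.
  by exists c.
have {hc}[c hc] := choice hc.
exists c; split=> [j|j]; first by have [] := hc j.
have L2E t : 0 <= t -> (\int[P]_w `|L2 j t w|%:E = (c j * t)%:E)%E.
  move=> t0; have [_ <-//] := hc j; apply/esym.
  apply: (same_law_integral (f := fun x => `|x|%:E) lawL (i := (j, t))) => //=.
  by apply/measurable_EFinP; exact: normr_measurable.
have mean t : (\int[P]_w `|L j t w|%:E = (c j * `|t|)%:E)%E.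
  have [t0|t0] := leP 0 t; first by rewrite L1E//; have [_ ->] := hc j; rewrite ?ger0_norm.
  have bnd s : 0 <= s -> s < - t ->
      {ae P, forall w, `|L2 j s w| <= `|L j t w| <= `|L2 j (- t) w|}.
    move=> s0 st.
    apply: filterS2 LE (subordinator_paths_nd s2) => w Lw /(_ j)[z2 c2 n2].
    have pos u : 0 <= u -> 0 <= L2 j u w by move=> u0; have := n2 _ _ (lexx 0) u0; rewrite z2.
    have nt0 : 0 <= - t by rewrite oppr_ge0 ltW.
    rewrite (ger0_norm (pos _ s0)) (ger0_norm (pos _ nt0)).
    apply: (two_sided_path_bounds (f := fun t => L j t w) c2 z2 n2 _ t0 s0 st).
    by move=> u u0; have [_ /(_ u0)] := Lw j u.
  rewrite (ltr0_norm t0); apply/eqP; rewrite eq_le; apply/andP; split.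
    have nt0 : 0 <= - t by rewrite oppr_ge0 ltW.
    rewrite -(L2E _ nt0); apply: ae_ge0_le_integral => //;
      [by apply: measurable_normr_EFin; exact: measurable_process..|].
    apply: filterS (bnd 0 (lexx 0) _); last by rewrite oppr_gt0.
    by move=> w /andP[_ h] _; rewrite lee_fin.
  apply/lee_subgt0Pr => e e0.
  (* c j * s is within e of c j * - t, and s stays below - t. *)
  pose s := Num.max 0 (- t - e / (1 + c j)).
  have c0 : 0 <= c j by have [] := hc j.
  have c1 : 0 < 1 + c j by rewrite ltr_pwDl.
  have s0 : 0 <= s by rewrite le_max lexx.
  have st : s < - t by rewrite gt_max oppr_gt0 t0/= gtrBl divr_gt0.
  have st' : - t - e / (1 + c j) <= s by rewrite le_max lexx orbT.
  apply: (@le_trans _ _ (c j * s)%:E).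
    rewrite -EFinB lee_fin lerBlDr.
    apply: (@le_trans _ _ (c j * (s + e / (1 + c j)))).
      by rewrite ler_wpM2l//; lra.
    rewrite mulrDr lerD2l mulrCA; apply: ler_piMr; first exact: ltW.
    by rewrite ler_pdivrMr// mul1r lerDr.
  rewrite -L2E//; apply: ae_ge0_le_integral => //;
    [by apply: measurable_normr_EFin; exact: measurable_process..|].
  by apply: filterS (bnd s s0 st) => w /andP[h _] _; rewrite lee_fin.
have zero : {ae P, forall w, L j 0 w = 0}.
  apply: filterS2 LE (subordinator_paths_nd s1) => w Lw /(_ j)[z1 _ _].
  by have [-> //] := Lw j 0.
have split_mean (A B C : Omega -> R) : measurable_fun setT A ->
    measurable_fun setT B -> measurable_fun setT C ->
    {ae P, forall w, `|A w| = `|B w| + `|C w|} ->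
    (\int[P]_w `|A w|%:E = \int[P]_w `|B w|%:E + \int[P]_w `|C w|%:E)%E.
  move=> mA mB mC ABC; rewrite -ge0_integralD//; [|exact: measurable_normr_EFin..].
  apply: ge0_ae_eq_integral => //.
  - exact: measurable_normr_EFin.
  - by apply: emeasurable_funD; exact: measurable_normr_EFin.
  - by move=> w _; exact: adde_ge0.
  by apply: filterS ABC => w -> _; rewrite EFinD.
have mL u : measurable_fun setT (L j u : Omega -> R) by exact: measurable_process.
have mI s t : measurable_fun setT (fun w => L j t w - L j s w) by exact: measurable_funB.
have cancel (a b : R) (x : \bar R) : (a%:E = b%:E + x)%E -> x = (a - b)%:E.
  by case: x => [r| |]//= [->]; rewrite addrAC subrr add0r.
move=> s t st; have [s0|s0] := leP 0 s.
  have := @split_mean (L j t) (L j s) (fun w => L j t w - L j s w) (mL t) (mL s) (mI s t).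
  rewrite !mean => /(_ _)/cancel ->.
    by rewrite -mulrBr !ger0_norm// (le_trans s0).
  apply: filterS2 two_sided_paths zero => w /(_ j)[nd _] z.
  have h1 : 0 <= L j s w by rewrite -z; exact: nd.
  have h2 : L j s w <= L j t w by exact: nd.
  by rewrite !ger0_norm ?subr_ge0// ?(le_trans h1)// addrC subrK.
have [t0|t0] := leP t 0.
  have := @split_mean (L j s) (L j t) (fun w => L j t w - L j s w) (mL s) (mL t) (mI s t).
  rewrite !mean => /(_ _)/cancel ->.
    by rewrite -mulrBr (ltr0_norm s0) (ler0_norm t0) opprK addrC.
  apply: filterS2 two_sided_paths zero => w /(_ j)[nd _] z.
  have h1 : L j t w <= 0 by rewrite -z; exact: nd.
  have h2 : L j s w <= L j t w by exact: nd.
  have h3 : 0 <= L j t w - L j s w by rewrite subr_ge0.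
  by rewrite (ler0_norm h1) (ler0_norm (le_trans h2 h1)) (ger0_norm h3); lra.
rewrite (@split_mean (fun w => L j t w - L j s w) (L j s) (L j t))//.
  by rewrite !mean -EFinD -mulrDr (ltr0_norm s0) (gtr0_norm t0) addrC.
apply: filterS2 two_sided_paths zero => w /(_ j)[nd _] z.
have h1 : 0 <= L j t w by rewrite -z; apply: nd; exact: ltW.
have h2 : L j s w <= 0 by rewrite -z; apply: nd; exact: ltW.
have h3 : L j s w <= L j t w by exact: nd.
by rewrite (ler0_norm h2) !ger0_norm ?subr_ge0// addrC.
Qed.

End two_sided.

(** * Delay equations with non-negative forcing *)

Lemma normr_Rintegral_le {d} {T : measurableType d} {R : realType}
    (m : {measure set T -> \bar R}) (f : T -> R) : measurable_fun setT f ->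
  (`|\int[m]_x f x|%:E <= \int[m]_x `|f x|%:E)%E.
Proof.
move=> mf; have := @le_abse_integral _ _ _ m setT (EFin \o f) measurableT.
move=> /(_ ((measurable_EFinP _ _).2 mf)); apply: le_trans.
by rewrite /Rintegral; case: (\int[m]_x _)%E => [x| |]//=; rewrite ?normr0 ?leey.
Qed.

Lemma sprodT {R : realType} (m1 m2 : {finite_measure set (measurableTypeR R) -> \bar R}) :
  sprod m1 m2 setT = (fine (m1 setT) * fine (m2 setT))%:E.
Proof.
rewrite EFinM !fineK ?fin_num_measure//.
by rewrite -[LHS]/((m1 \x m2)%E setT) -setXTT product_measure1E.
Qed.

Lemma sprod_lty {R : realType} (m1 m2 : {finite_measure set (measurableTypeR R) -> \bar R}) :
  (sprod m1 m2 setT < +oo)%E.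
Proof. by rewrite sprodT ltry. Qed.

Section bounded_mean.
Context {dsp : measure_display} {Omega : measurableType dsp} {R : realType}.
Context {d' : measure_display} {T' : measurableType d'}.
Variables (P : probability Omega R) (m : {sigma_finite_measure set T' -> \bar R}).
Hypothesis mfin : (m setT < +oo)%E.
Variables (D : T' -> Omega -> R) (M : R).
Hypothesis mD : measurable_fun setT (fun zw : T' * Omega => D zw.1 zw.2).
Hypothesis bD : forall z, (\int[P]_w `|D z w|%:E <= M%:E)%E.

Let mDn : measurable_fun setT (fun zw : T' * Omega => `|D zw.1 zw.2|%:E).
Proof. by apply/measurable_EFinP; exact: measurableT_comp. Qed.

Lemma mean_integral_le :
  (\int[P]_w \int[m]_z `|D z w|%:E <= M%:E * m setT)%E.
Proof.
rewrite (_ : (\int[P]_w _ = \int[m]_z \int[P]_w `|D z w|%:E)%E); last first.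
  exact: esym (@fubini_tonelli _ _ _ _ _ m P _ mDn (fun=> _)).
rewrite -integral_cst//; apply: ge0_le_integral => //.
- by move=> z _; exact: integral_ge0.
- exact: (@measurable_fun_fubini_tonelli_F _ _ _ _ _ P _ mDn).
Qed.

Lemma ae_integrable_path : {ae P, forall w, m.-integrable setT (EFin \o D ^~ w)}.
Proof.
have I : (m \x P)%E.-integrable setT (EFin \o (fun zw : T' * Omega => D zw.1 zw.2)).
  apply/integrable21ltyP; first exact/measurable_EFinP.
  apply: (le_lt_trans mean_integral_le).
  by rewrite -[m setT]fineK ?ge0_fin_numE// -EFinM ltry.
by apply: filterS (ae_integrable2 I) => w.
Qed.

End bounded_mean.

Section delay_equation.
Context {dsp : measure_display} {Omega : measurableType dsp} {R : realType}.
Variables (P : probability Omega R) (d : nat).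
Local Notation T := (measurableTypeR R).
Variables (m : 'I_d -> 'I_d -> {finite_measure set T -> \bar R}) (a : 'I_d -> R).
Hypothesis a0 : forall j, 0 <= a j.
Variable D : 'I_d -> R -> Omega -> R.
Hypothesis mD : forall j,
  measurable_fun setT (fun tw : T * Omega => D j tw.1 tw.2).
Variable M : R.
Hypothesis bD : forall j t, (\int[P]_w `|D j t w|%:E <= M%:E)%E.

Lemma measurable_shifted k : measurable_fun setT
  (fun zw : (T * T) * Omega => D k (zw.1.1 - zw.1.2) zw.2).
Proof.
have mg : measurable_fun setT (fun zw : (T * T) * Omega => ((zw.1.1 - zw.1.2 : T), zw.2)).
  apply/measurable_fun_pairP; split => /=; last exact: measurable_snd.
  by apply: measurable_funB; apply: (measurableT_comp _ measurable_fst);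
    [exact: measurable_fst|exact: measurable_snd].
exact: (measurableT_comp (mD k) mg).
Qed.

Lemma ae_integrable_prod s t j k : {ae P, forall w,
  (sprod (leb_itv s t) (m j k)).-integrable setT
    (EFin \o (fun z : T * T => D k (z.1 - z.2) w))}.
Proof.
apply: (ae_integrable_path (m := sprod (leb_itv s t) (m j k))
  (D := fun z w => D k (z.1 - z.2) w) _ (measurable_shifted k) (fun z => bD k _)).
exact: sprod_lty.
Qed.

Lemma ae_integrable_itv s t k : {ae P, forall w,
  (leb_itv s t).-integrable setT (EFin \o D k ^~ w)}.
Proof.
apply: (ae_integrable_path (m := leb_itv s t) _ (mD k) (bD k)).
by rewrite -ge0_fin_numE// fin_num_measure.
Qed.

Hypothesis sub0 : forall q : 'I_d -> R, (forall j, 0 <= q j) ->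
  (forall j, a j * q j <= \sum_k fine (m j k setT) * q k) -> forall j, q j = 0.
Variables (r : 'I_d -> R -> R -> Omega -> R) (c : R).
Hypothesis mr : forall j s t, measurable_fun setT (r j s t).
Hypothesis cr : forall j s t, s < t -> (\int[P]_w `|r j s t w|%:E <= (c * (t - s))%:E)%E.
Hypothesis r0 : forall s t, s < t -> {ae P, forall w, forall j, 0 <= r j s t w}.
Hypothesis eqD : forall s t, s < t -> {ae P, forall w, forall j,
  D j t w - D j s w =
    \sum_k \int[sprod (leb_itv s t) (m j k)]_z D k (z.1 - z.2) w -
    a j * \int[leb_itv s t]_u D j u w + r j s t w}.

Let C := \sum_j (\sum_k M * fine (m j k setT) + a j * M) + c.

Let M0 (j : 'I_d) : 0 <= M.
Proof.
by have := bD j 0; rewrite -lee_fin; apply: le_trans; exact: integral_ge0.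
Qed.

(** Each term of the equation is an integral over [s, t] of quantities bounded
    in mean, so D is Lipschitz in mean. *)
Lemma mean_increment j s t : s <= t ->
  (\int[P]_w `|D j t w - D j s w|%:E <= (C * (t - s))%:E)%E.
Proof.
rewrite le_eqVlt => /predU1P[->|st].
  rewrite subrr mulr0 integral0_eq// => w _.
  by rewrite subrr normr0.
have mI : measurable_fun setT (fun w => \int[leb_itv s t]_u `|D j u w|%:E)%E.
  have mn : measurable_fun setT (fun uw : T * Omega => `|D j uw.1 uw.2|%:E).
    by apply/measurable_EFinP; exact: measurableT_comp.
  exact: (@measurable_fun_fubini_tonelli_G _ _ _ _ _ (leb_itv s t) _ mn).
have mS k : measurable_fun setT
    (fun w => \int[sprod (leb_itv s t) (m j k)]_z `|D k (z.1 - z.2) w|%:E)%E.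
  have mn : measurable_fun setT
      (fun zw : (T * T) * Omega => `|D k (zw.1.1 - zw.1.2) zw.2|%:E).
    by apply/measurable_EFinP; apply: measurableT_comp => //; exact: measurable_shifted.
  exact: (@measurable_fun_fubini_tonelli_G _ _ _ _ _ (sprod (leb_itv s t) (m j k)) _ mn).
have mDt u : measurable_fun setT (D j u) by exact: (measurable_fun_pair2 u (mD j)).
have I0 w : (0 <= \int[leb_itv s t]_u `|D j u w|%:E)%E by exact: integral_ge0.
have S0 w k : (0 <= \int[sprod (leb_itv s t) (m j k)]_z `|D k (z.1 - z.2) w|%:E)%E.
  exact: integral_ge0.
have mr' : measurable_fun setT (fun w => `|r j s t w|%:E).
  by apply/measurable_EFinP; exact: measurableT_comp.
have maI : measurable_fun setT (fun w => (a j)%:E * \int[leb_itv s t]_u `|D j u w|%:E)%E.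
  exact: emeasurable_funM.
have aI0 w : (0 <= (a j)%:E * \int[leb_itv s t]_u `|D j u w|%:E)%E.
  by apply: mule_ge0 => //; rewrite lee_fin.
have mSS : measurable_fun setT
    (fun w => \sum_k \int[sprod (leb_itv s t) (m j k)]_z `|D k (z.1 - z.2) w|%:E)%E.
  exact: emeasurable_sum.
have SS0 w : (0 <= \sum_k \int[sprod (leb_itv s t) (m j k)]_z `|D k (z.1 - z.2) w|%:E)%E.
  exact: sume_ge0.
have mSI : measurable_fun setT
    (fun w => \sum_k \int[sprod (leb_itv s t) (m j k)]_z `|D k (z.1 - z.2) w|%:E +
      (a j)%:E * \int[leb_itv s t]_u `|D j u w|%:E)%E by exact: emeasurable_funD.
have SI0 w : (0 <= \sum_k \int[sprod (leb_itv s t) (m j k)]_z `|D k (z.1 - z.2) w|%:E +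
      (a j)%:E * \int[leb_itv s t]_u `|D j u w|%:E)%E by exact: adde_ge0.
apply: (@le_trans _ _ (\int[P]_w
   (\sum_k \int[sprod (leb_itv s t) (m j k)]_z `|D k (z.1 - z.2) w|%:E +
      (a j)%:E * \int[leb_itv s t]_u `|D j u w|%:E + `|r j s t w|%:E))%E).
  apply: ae_ge0_le_integral => //.
  - by apply/measurable_EFinP; apply: measurableT_comp => //; exact: measurable_funB.
  - by move=> w _; exact: adde_ge0.
  - exact: emeasurable_funD.
  apply: filterS (eqD st) => w h _; rewrite h.
  apply: (@le_trans _ _ (\sum_k `|\int[sprod (leb_itv s t) (m j k)]_z D k (z.1 - z.2) w|%:E
     + (a j)%:E * `|\int[leb_itv s t]_u D j u w|%:E + `|r j s t w|%:E)%E).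
    rewrite sumEFin -EFinM -!EFinD lee_fin.
    apply: (le_trans (ler_normD _ _)); rewrite lerD2r.
    apply: (le_trans (ler_normB _ _)); apply: lerD; first exact: ler_norm_sum.
    by rewrite normrM (ger0_norm (a0 j)).
  apply: leeD => //; apply: leeD.
    by apply: lee_sum => k _; apply: normr_Rintegral_le;
      exact: (measurable_fun_pair1 w (measurable_shifted k)).
  apply: lee_wpmul2l; first by rewrite lee_fin.
  by apply: normr_Rintegral_le; exact: (measurable_fun_pair1 w (mD j)).
rewrite ge0_integralD// ge0_integralD// ge0_integralZl//; last by rewrite lee_fin.
rewrite ge0_integral_sum//.
apply: (@le_trans _ _ ((\sum_k M * fine (m j k setT) + a j * M) * (t - s) + c * (t - s))%:E).
  rewrite EFinD; apply: leeD; last exact: cr.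
  rewrite mulrDl EFinD; apply: leeD.
    rewrite mulr_suml -sumEFin; apply: lee_sum => k _.
    have := mean_integral_le (sprod (leb_itv s t) (m j k))
      (D := fun z w => D k (z.1 - z.2) w) (measurable_shifted k) (fun z => bD k _).
    move=> /le_trans; apply; rewrite sprodT leb_itvT ?(ltW st)//= -EFinM.
    by rewrite lee_fin [(t - s) * _]mulrC mulrA.
  rewrite -mulrA EFinM; apply: lee_wpmul2l; first by rewrite lee_fin.
  have := mean_integral_le (leb_itv s t) (mD j) (bD j).
  by move=> /le_trans; apply; rewrite [X in (_ * X)%E](leb_itvT (ltW st)) -EFinM.
rewrite lee_fin -mulrDl; apply: ler_wpM2r; first by rewrite subr_ge0 ltW.
rewrite /C lerD2r [leRHS](bigD1 j)//= lerDl; apply: sumr_ge0 => i _;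
  rewrite addr_ge0 ?mulr_ge0 ?(M0 j)//.
  by apply: sumr_ge0 => k _; rewrite mulr_ge0 ?fine_ge0 ?(M0 j).
Qed.

Lemma delay_equation_nonneg t : {ae P, forall w, forall j, 0 <= D j t w}.
Proof.
apply: (contraction_nonneg a0 sub0 mD bD mean_increment) => s u su.
by apply: filterS2 (eqD su) (r0 su) => w h h' j; rewrite h lerDl.
Qed.

End delay_equation.

(** * Stationary solutions *)

Section solutions.
Context {dsp : measure_display} {Omega : measurableType dsp} {R : realType}.
Variables (P : probability Omega R) (d : nat).
Local Notation T := (measurableTypeR R).
Variable phi : 'M[signed_measure R]_d.
Hypothesis heta : forall j k (A : set (measurableTypeR R)),
  measurable A -> (0 <= eta_mx phi j k A)%E.
Hypothesis hlambda : M_matrix (lambda_mx phi).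
Variables (L X : process P d).
Hypothesis hX : solution phi L X.

Lemma solution_mean_bounded :
  exists M, forall j t, (\int[P]_w `|X j t w|%:E <= M%:E)%E.
Proof.
have [_ stX fmX _] := hX.
pose e j := (\int[P]_w `|X j 0 w|%:E)%E.
have efin j : e j \is a fin_num.
  rewrite ge0_fin_numE; last exact: integral_ge0.
  exact: first_moment_coordinate.
exists (\sum_j fine (e j)) => j t.
have -> : (\int[P]_w `|X j t w|%:E = e j)%E.
  have := same_law_integral (f := fun x => `|x|%:E) (stX t) (i := (j, 0)) I.
  rewrite /= add0r; apply => //.
  by apply/measurable_EFinP; exact: normr_measurable.
rewrite -(fineK (efin j)) lee_fin (bigD1 j)//= lerDl sumr_ge0// => i _.
by rewrite fine_ge0// integral_ge0.
Qed.

(** [signed_intE] applied to the delay term; only the diagonal entries have an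
    instantaneous damping. *)
Lemma solution_equation s t : s < t -> {ae P, forall w, forall j,
  X j t w - X j s w =
    \sum_k \int[sprod (leb_itv s t) (posm (phi j k))]_z X k (z.1 - z.2) w -
    negmass (phi j j) * \int[leb_itv s t]_u X j u w + (L j t w - L j s w)}.
Proof.
move=> st; have [mX _ _ eqX] := hX.
have [M bX] := solution_mean_bounded.
have ip : {ae P, forall w, forall j k, (sprod (leb_itv s t) (posm (phi j k))).-integrable
    setT (EFin \o (fun z : T * T => X k (z.1 - z.2) w))}.
  apply: filter_forall => j; apply: filter_forall => k.
  exact: (ae_integrable_prod (fun j k => posm (phi j k)) (D := fun j t w => X j t w) mX bX s t j k).
have ii : {ae P, forall w, forall k, (leb_itv s t).-integrable setT (EFin \o (fun u => X k u w))}.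
  apply: filter_forall => k.
  exact: (ae_integrable_itv (D := fun j t w => X j t w) mX bX s t k).
apply: filterS3 (eqX s t st) ip ii => w hw {}ip {}ii j; rewrite hw; congr (_ + _).
have mXw k u : measurable_fun setT (fun v : R => X k (u - v) w).
  have ms : measurable_fun setT (fun v : R => u - v) by exact: measurable_funB.
  exact: (measurableT_comp (measurable_fun_pair1 w (mX k)) ms).
have E k : \int[lebesgue_measure]_(u in `[s, t])
      signed_int (phi j k) (fun v => X k (u - v) w) =
    \int[sprod (leb_itv s t) (posm (phi j k))]_z X k (z.1 - z.2) w -
    negmass (phi j k) * \int[leb_itv s t]_u X k u w.
  have i1 := integrable_Rfubini1 (ip j k).
  have i2 : (leb_itv s t).-integrable setT (EFin \o (fun u => negmass (phi j k) * X k u w)).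
    exact: (integrableZl measurableT (negmass (phi j k)) (ii k)).
  have /integrableP[/measurable_EFinP m1 _] := i1.
  have /integrableP[/measurable_EFinP m2 _] := i2.
  rewrite (_ : (fun u => signed_int _ _) = (fun u =>
      \int[posm (phi j k)]_v X k (u - v) w - negmass (phi j k) * X k u w)); last first.
    apply/funext => u; rewrite signed_intE ?subr0//.
    by move=> A mA; exact: heta.
  rewrite -Rintegral_leb_itv; last exact: measurable_funB.
  rewrite RintegralB// RintegralZl//; congr (_ - _).
  exact: esym (Rintegral_prod12 (ip j k)).
rewrite (eq_bigr _ (fun k _ => E k)) sumrB; congr (_ - _).
rewrite (bigD1 j)//= big1 ?addr0// => k kj.
by rewrite negmass_off ?mul0r// eq_sym.
Qed.

Hypothesis hphi2 : forall j k,
  (\int[abs_measure (phi j k)]_(t in `[0%R, +oo[) (t ^+ 2)%:E < +oo)%E.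
Hypothesis hdet : forall z : R[i], 0 <= complex.Re z -> \det (h_phi phi z) != 0.
Hypothesis hL : two_sided_subordinator L.
Hypothesis hL1 : finite_first_moment L 1.

Lemma solution_nonneg t : {ae P, forall w, forall j, 0 <= X j t w}.
Proof.
have [mX _ _ _] := hX; have [M bX] := solution_mean_bounded.
have [c [c0 cL]] := two_sided_mean hL hL1.
apply: (@delay_equation_nonneg _ _ _ P d (fun j k => posm (phi j k))
  (fun j => negmass (phi j j)) _ (fun j t w => X j t w) mX M bX _
  (fun j s t w => L j t w - L j s w) (\sum_j c j)) => //.
- by move=> j; exact: negmass_ge0.
- by move=> q q0 qs; apply: (subinvariant_eq0 hphi2 hdet heta hlambda).
- by move=> j s u; apply: measurable_funB; exact: measurable_process.
- move=> j s u su; rewrite (cL j s u (ltW su)) lee_fin; apply: ler_wpM2r.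
    by rewrite subr_ge0 ltW.
  by rewrite (bigD1 j)//= lerDl sumr_ge0.
- move=> s u su; apply: filterS (two_sided_paths hL) => w h j.
  by have [nd _] := h j; rewrite subr_ge0; apply: nd; exact: ltW.
- exact: solution_equation.
Qed.

End solutions.

(** * Reflected convolutions *)

Section reflection.
Context {R : realType}.
Local Notation leb := (@lebesgue_measure R).
Local Notation T := (measurableTypeR R).

Lemma measurable_reflection (c : R) : measurable_fun setT (fun x : T => c - x : T).
Proof. exact: measurable_funB. Qed.

Lemma lebesgue_reflection (c : R) (A : set T) : measurable A ->
  image_measure leb (measurable_reflection c) A = leb A.
Proof.
move=> mA; apply/esym; apply: lebesgue_measure_unique => // _ [[a b]] _ <-.
rewrite image_measureE (_ : _ @^-1` _ = `[c - b, c - a[%classic); last first.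
  by apply/seteqP; split => x /=; rewrite !in_itv/= => /andP[? ?]; apply/andP; split; lra.
rewrite lebesgue_measure_itv/= lte_fin.
have -> := lebesgue_measure_itv `[c - b, c - a[.
rewrite /= lte_fin ltrD2l ltrN2.
by case: ifP => // _; rewrite -!EFinD; congr EFin; ring.
Qed.

Lemma ge0_integral_reflection (c : R) (f : T -> \bar R) : measurable_fun setT f ->
  (forall x, 0 <= f x)%E ->
  (\int[leb]_x f (c - x)%R = \int[leb]_x f x)%E.
Proof.
move=> mf f0; rewrite -(ge0_integral_image leb (measurable_reflection c))//.
by apply: eq_measure_integral => A mA _; exact: lebesgue_reflection.
Qed.

Lemma integrable_reflection (c : R) (f : R -> R) : leb.-integrable setT (EFin \o f) ->
  leb.-integrable setT (EFin \o (fun x => f (c - x))).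
Proof.
move=> /integrableP[mf foo]; apply/integrableP; split.
  exact: (measurableT_comp mf (measurable_reflection c)).
rewrite /= (ge0_integral_reflection c (f := fun x => `|(f x)%:E|%E))//.
exact: measurableT_comp.
Qed.

Lemma Rintegral_reflection (c : R) (f : R -> R) : leb.-integrable setT (EFin \o f) ->
  \int[leb]_x f (c - x) = \int[leb]_x f x.
Proof.
move=> intf; have /integrableP[/measurable_EFinP mf _] := intf.
rewrite -(Rintegral_image (measurable_reflection c) mf (integrable_reflection c intf)).
rewrite /Rintegral; apply: (congr1 fine).
by apply: eq_measure_integral => A mA _; exact: lebesgue_reflection.
Qed.

End reflection.

Lemma eq_Rintegral_ae {d} {T : measurableType d} {R : realType}
    (m : {measure set T -> \bar R}) (f g : T -> R) :
  measurable_fun setT f -> measurable_fun setT g -> {ae m, forall x, f x = g x} ->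
  \int[m]_x f x = \int[m]_x g x.
Proof.
move=> mf mg fg; rewrite /Rintegral; apply: (congr1 fine); apply: ae_eq_integral => //.
- exact/measurable_EFinP.
- exact/measurable_EFinP.
by apply: filterS fg => x -> _.
Qed.

Section reflected_convolution.
Context {R : realType} {d' : measure_display} {T' : measurableType d'}.
Local Notation leb := (@lebesgue_measure R).
Local Notation T := (measurableTypeR R).
Variables (m : {sigma_finite_measure set T' -> \bar R}) (rho : T' -> R).
Hypothesis mfin : (m setT < +oo)%E.
Hypothesis mrho : measurable_fun setT rho.
Variable G : R -> R.
Hypothesis intG : leb.-integrable setT (EFin \o G).

Let mG : measurable_fun setT G.
Proof. by have /integrableP[/measurable_EFinP] := intG. Qed.

Let K (rz : T * T') := G (rho rz.2 - rz.1).

Let mK : measurable_fun setT K.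
Proof.
apply: (measurableT_comp mG); apply: measurable_funB; last exact: measurable_fst.
exact: (measurableT_comp mrho measurable_snd).
Qed.

(** Lebesgue measure is invariant under each reflection r -> rho z - r. *)
Lemma integrable_reflected_kernel : (leb \x m)%E.-integrable setT (EFin \o K).
Proof.
apply/integrable21ltyP; first exact/measurable_EFinP.
rewrite (_ : (\int[m]_z _ = \int[m]_z (\int[leb]_x `|(G x)%:E|))%E); last first.
  apply: eq_integral => z _.
  rewrite -(ge0_integral_reflection (rho z))//.
  by apply: measurableT_comp => //; exact/measurable_EFinP.
have /integrableP[_ Goo] := intG.
rewrite integral_cst//; apply: lte_mul_pinfty => //; first exact: integral_ge0.
by rewrite ge0_fin_numE// integral_ge0.
Qed.

Definition reflected_conv (r : R) : R := \int[m]_z G (rho z - r).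

Lemma integrable_reflected_conv : leb.-integrable setT (EFin \o reflected_conv).
Proof. exact: (integrable_Rfubini1 integrable_reflected_kernel). Qed.

(** Exchanging the integrals and reflecting around rho z; with a trigonometric
    test function this computes a Fourier transform. *)
Lemma reflected_conv_test (psi : R -> R) (M : R) : measurable_fun setT psi ->
  (forall x, `|psi x| <= M) ->
  \int[leb]_r (reflected_conv r * psi r) = \int[m]_z \int[leb]_x (G x * psi (rho z - x)).
Proof.
move=> mpsi psiM.
have mpsi1 : measurable_fun setT (fun rz : T * T' => psi rz.1).
  exact: (measurableT_comp mpsi measurable_fst).
have iK := integrable_mul_bounded integrable_reflected_kernel mpsi1 (fun rz => psiM rz.1).
transitivity (\int[leb]_r \int[m]_z (G (rho z - r) * psi r)).
  apply: eq_Rintegral_ae.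
  - apply: measurable_funM => //.
    by have /integrableP[/measurable_EFinP] := integrable_reflected_conv.
  - by have /integrableP[/measurable_EFinP] := integrable_Rfubini1 iK.
  apply: ae_weaken (ae_integrable1 integrable_reflected_kernel) => r ir.
  by rewrite RintegralZr.
rewrite (Rintegral_swap iK); apply: eq_Rintegral => z _ /=.
have i2 : leb.-integrable setT (EFin \o (fun x => G x * psi (rho z - x))).
  apply: (integrable_mul_bounded intG _ (fun x => psiM (rho z - x))).
  exact: (measurableT_comp mpsi (measurable_reflection (rho z))).
rewrite -(Rintegral_reflection (rho z) i2).
by apply: eq_Rintegral => x _; rewrite subKr.
Qed.

Lemma normr_cos_le1 (x : R) : `|cos x| <= 1.
Proof. by rewrite ler_norml cos_geN1 cos_le1. Qed.

Lemma normr_sin_le1 (x : R) : `|sin x| <= 1.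
Proof. by rewrite ler_norml sin_geN1 sin_le1. Qed.

Lemma measurable_cos_comp {d0} {T0 : measurableType d0} (f : T0 -> R) :
  measurable_fun setT f -> measurable_fun setT (fun x => cos (f x)).
Proof.
move=> mf; apply: (measurableT_comp _ mf).
exact: continuous_measurable_fun (@continuous_cos R).
Qed.

Lemma measurable_sin_comp {d0} {T0 : measurableType d0} (f : T0 -> R) :
  measurable_fun setT f -> measurable_fun setT (fun x => sin (f x)).
Proof.
move=> mf; apply: (measurableT_comp _ mf).
exact: continuous_measurable_fun (@continuous_sin R).
Qed.

Let bounded_integrable (k : T' -> R) : measurable_fun setT k -> (forall x, `|k x| <= 1) ->
  m.-integrable setT (EFin \o k).
Proof.
move=> mk k1; have i1 : m.-integrable setT (EFin \o cst 1).
  apply/integrableP; split; first by apply/measurable_EFinP; exact: measurable_cst.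
  under eq_integral do rewrite /= normr1.
  by rewrite integral_cst// mul1e.
have := integrable_mul_bounded i1 mk k1.
by under [X in EFin \o X]eq_fun do rewrite /= mul1r.
Qed.

Section transforms.
Variable y : R.
Let C := \int[leb]_x (G x * cos (x * y)).
Let S := \int[leb]_x (G x * sin (x * y)).
Let c := \int[m]_z cos (rho z * y).
Let s := \int[m]_z sin (rho z * y).

Let my : measurable_fun setT (fun x : R => x * y). Proof. exact: mulrr_measurable. Qed.
Let mry : measurable_fun setT (fun z => rho z * y).
Proof. exact: (measurableT_comp my mrho). Qed.
Let iC : leb.-integrable setT (EFin \o (fun x => G x * cos (x * y))).
Proof.
exact: (integrable_mul_bounded intG (measurable_cos_comp my) (fun x => normr_cos_le1 (x * y))).
Qed.
Let iS : leb.-integrable setT (EFin \o (fun x => G x * sin (x * y))).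
Proof.
exact: (integrable_mul_bounded intG (measurable_sin_comp my) (fun x => normr_sin_le1 (x * y))).
Qed.
Let ic : m.-integrable setT (EFin \o (fun z => cos (rho z * y))).
Proof. exact: (bounded_integrable (measurable_cos_comp mry) (fun z => normr_cos_le1 _)). Qed.
Let is' : m.-integrable setT (EFin \o (fun z => sin (rho z * y))).
Proof. exact: (bounded_integrable (measurable_sin_comp mry) (fun z => normr_sin_le1 _)). Qed.

Let linear2 (u v : R) : \int[leb]_x (u * (G x * cos (x * y)) + v * (G x * sin (x * y))) =
  u * C + v * S.
Proof.
rewrite RintegralD//.
- by rewrite !RintegralZl.
- exact: (integrableZl measurableT u iC).
- exact: (integrableZl measurableT v iS).
Qed.

Let linear2' (u v : R) : \int[m]_z (cos (rho z * y) * u + sin (rho z * y) * v) = c * u + s * v.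
Proof.
rewrite RintegralD//.
- by rewrite !RintegralZr.
- exact: (integrableZr measurableT u ic).
- exact: (integrableZr measurableT v is').
Qed.

Lemma reflected_conv_cos : \int[leb]_r (reflected_conv r * cos (r * y)) = c * C + s * S.
Proof.
rewrite (reflected_conv_test (measurable_cos_comp my) (fun r => normr_cos_le1 (r * y))).
rewrite -linear2'; apply: eq_Rintegral => z _.
rewrite -linear2; apply: eq_Rintegral => x _.
by rewrite mulrBl cosB; ring.
Qed.

Lemma reflected_conv_sin : \int[leb]_r (reflected_conv r * sin (r * y)) = s * C - c * S.
Proof.
rewrite (reflected_conv_test (measurable_sin_comp my) (fun r => normr_sin_le1 (r * y))).
rewrite addrC -mulrN -linear2'; apply: eq_Rintegral => z _.
rewrite mulrN -mulNr addrC -linear2; apply: eq_Rintegral => x _.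
by rewrite mulrBl sinB; ring.
Qed.

End transforms.
End reflected_convolution.

(** * The Fourier transform of the kernel *)

Lemma sum_complexE {R : rcfType} (I : finType) (F H : I -> R) :
  \sum_i (F i +i* H i) = (\sum_i F i) +i* (\sum_i H i).
Proof.
have h (s : seq I) : \sum_(i <- s) (F i +i* H i) =
    (\sum_(i <- s) F i) +i* (\sum_(i <- s) H i).
  by elim: s => [|i s IH]; rewrite ?big_nil// !big_cons IH.
exact: h.
Qed.

Section kernel_transform.
Context {R : realType} {d : nat}.
Local Notation leb := (@lebesgue_measure R).
Local Notation T := (measurableTypeR R).
Variable phi : 'M[signed_measure R]_d.
Hypothesis hdet : forall z : R[i], 0 <= complex.Re z -> \det (h_phi phi z) != 0.
Hypothesis heta : forall j k (A : set T), measurable A -> (0 <= eta_mx phi j k A)%E.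
Hypothesis hlambda : M_matrix (lambda_mx phi).
Variable g : R -> 'M[R]_d.
Hypothesis hg : is_kernel phi g.

(** Extending by zero turns integrals of the kernel over moving half-lines into
    integrals over the line. *)
Definition kernel_ext (g : R -> 'M[R]_d) j k (x : R) : R := if 0 <= x then g x j k else 0.

Lemma integrable_kernel_ext j k : leb.-integrable setT (EFin \o kernel_ext g j k).
Proof.
have [/(_ j k) ig _] := hg.
have := (@integrable_mkcond _ T R leb `[0, +oo[%classic _ (measurable_itv `[0, +oo[)).1 ig.
apply: eq_integrable => // x _; rewrite patchE /kernel_ext/=.
by rewrite mem_setE in_itv/= andbT; case: ifP.
Qed.

Lemma half_line_ext j k (f : R -> R) :
  \int[leb]_(t in `[0, +oo[) (g t j k * f t) = \int[leb]_x (kernel_ext g j k x * f x).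
Proof.
rewrite Rintegral_mkcond; apply: eq_Rintegral => x _.
rewrite patchE /kernel_ext mem_setE in_itv/= andbT.
by case: ifP => // _; rewrite mul0r.
Qed.

Variable y : R.
Let C j k := \int[leb]_x (kernel_ext g j k x * cos (x * y)).
Let S j k := \int[leb]_x (kernel_ext g j k x * sin (x * y)).
Let c j k := \int[posm (phi j k)]_v cos (v * y).
Let s j k := \int[posm (phi j k)]_v sin (v * y).
Let a j k := negmass (phi j k).

Lemma kernel_fourier j k :
  half_line_cint (fun t => cexp (- (0 +i* (t * y))) * (g t j k)%:C) = C j k +i* - S j k.
Proof.
rewrite /half_line_cint; congr (_ +i* _).
  rewrite /C -half_line_ext; apply: eq_Rintegral => t _ /=.
  by rewrite oppr0 expR0 cosN; ring.
rewrite /S -mulN1r.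
transitivity (\int[leb]_(t in `[0, +oo[) (g t j k * - sin (t * y))).
  by apply: eq_Rintegral => t _ /=; rewrite oppr0 expR0 sinN; ring.
rewrite half_line_ext -RintegralZl//.
  by apply: eq_Rintegral => x _; rewrite mulN1r mulrN.
apply: (integrable_mul_bounded (integrable_kernel_ext j k) _ (fun x => normr_sin_le1 (x * y))).
by apply: measurable_sin_comp; exact: mulrr_measurable.
Qed.

Lemma measure_fourier j k :
  signed_cint (phi j k) (fun t => cexp (- (0 +i* y) * t%:C)) =
  (c j k - a j k) +i* - s j k.
Proof.
have mc : measurable_fun setT (fun v : T => cos (v * y)).
  by apply: measurable_cos_comp; exact: mulrr_measurable.
have ms : measurable_fun setT (fun v : T => sin (v * y)).
  by apply: measurable_sin_comp; exact: mulrr_measurable.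
have h0 (A : set T) : measurable A -> (0 <= phi j k (A `&` `]0%R, +oo[))%E by exact: heta.
rewrite /signed_cint.
rewrite (_ : (fun t => complex.Re _) = fun t => cos (t * y)); last first.
  apply/funext => t /=; rewrite !(oppr0, mul0r, mulr0, subr0, add0r) expR0 mul1r.
  by rewrite mulNr cosN mulrC.
rewrite (_ : (fun t => complex.Im _) = fun t => - sin (t * y)); last first.
  apply/funext => t /=; rewrite !(oppr0, mul0r, mulr0, subr0, add0r) expR0 mul1r.
  by rewrite mulNr sinN mulrC.
rewrite !signed_intE//; last exact: measurableT_comp.
rewrite mul0r cos0 mulr1 sin0 oppr0 mulr0 subr0; congr (_ +i* _).
rewrite /s -mulN1r -RintegralZl//.
  by apply: eq_Rintegral => v _; rewrite mulN1r.
exact: (integrable_bounded (posm (phi j k)) ms (fun v => normr_sin_le1 _)).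
Qed.

(** The real and imaginary parts of the identity h_phi(iy) h_phi(iy)^-1 = I. *)
Lemma kernel_transform j l :
  y * S j l - (\sum_k (c j k * C k l - s j k * S k l) - a j j * C j l) = (j == l)%:R /\
  y * C j l + (\sum_k (c j k * S k l + s j k * C k l) - a j j * S j l) = 0.
Proof.
have [_ /(_ y) E] := hg.
have U : h_phi phi (0 +i* y) \in unitmx by rewrite unitmxE unitfE hdet.
have /matrixP/(_ j l) := mulmxV U; rewrite -E !mxE.
under eq_bigr do rewrite !mxE kernel_fourier measure_fourier.
pose dl k : R := (j == k)%:R.
rewrite (eq_bigr (fun k =>
  (dl k * (y * S k l) - ((c j k * C k l - s j k * S k l) - a j k * C k l)) +i*
  (dl k * (y * C k l) + ((c j k * S k l + s j k * C k l) - a j k * S k l)))); last first.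
  move=> k _; rewrite /dl; case: (j == k); rewrite ?mulr1n ?mulr0n;
  by apply/eqP; rewrite eq_complex/=; apply/andP; split; apply/eqP; ring.
have sdl (F : 'I_d -> R) : \sum_k dl k * F k = F j.
  rewrite (bigD1 j)//= big1 ?addr0; first by rewrite /dl eqxx mul1r.
  by move=> k kj; rewrite /dl eq_sym (negbTE kj) mul0r.
have sa (F : 'I_d -> R) : \sum_k a j k * F k = a j j * F j.
  rewrite (bigD1 j)//= big1 ?addr0// => k kj.
  by rewrite /a (negmass_off heta hlambda) ?mul0r// eq_sym.
rewrite sum_complexE !(sumrB, big_split)/= !sdl !sa.
move=> /eqP; rewrite eq_complex => /andP[/eqP/= re /eqP/= im]; split.
  by rewrite re; case: (j == l).
by rewrite im; case: (j == l).
Qed.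

End kernel_transform.

(** * The delay equation satisfied by the kernel *)

Section fourier_calculus.
Context {R : realType}.
Local Notation leb := (@lebesgue_measure R).
Local Notation T := (measurableTypeR R).
Variable y : R.

(** Cosine and sine transforms at the fixed frequency y, carried along with
    integrability so that they can be computed termwise. *)
Definition has_fourier (f : R -> R) (p q : R) :=
  [/\ leb.-integrable setT (EFin \o f),
      \int[leb]_x (f x * cos (x * y)) = p & \int[leb]_x (f x * sin (x * y)) = q].

Lemma integrable_mul_cos (f : R -> R) : leb.-integrable setT (EFin \o f) ->
  leb.-integrable setT (EFin \o (fun x => f x * cos (x * y))).
Proof.
move=> intf; apply: (integrable_mul_bounded intf _ (fun x => normr_cos_le1 (x * y))).
by apply: measurable_cos_comp; exact: mulrr_measurable.
Qed.

Lemma integrable_mul_sin (f : R -> R) : leb.-integrable setT (EFin \o f) ->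
  leb.-integrable setT (EFin \o (fun x => f x * sin (x * y))).
Proof.
move=> intf; apply: (integrable_mul_bounded intf _ (fun x => normr_sin_le1 (x * y))).
by apply: measurable_sin_comp; exact: mulrr_measurable.
Qed.

Lemma has_fourierD f1 f2 p1 p2 q1 q2 : has_fourier f1 p1 q1 -> has_fourier f2 p2 q2 ->
  has_fourier (fun x => f1 x + f2 x) (p1 + p2) (q1 + q2).
Proof.
move=> [i1 <- <-] [i2 <- <-]; split; first exact: (integrableD measurableT i1 i2).
  rewrite -RintegralD//; [|exact: integrable_mul_cos..].
  by apply: eq_Rintegral => x _; rewrite mulrDl.
rewrite -RintegralD//; [|exact: integrable_mul_sin..].
by apply: eq_Rintegral => x _; rewrite mulrDl.
Qed.

Lemma has_fourierZ (c : R) f p q : has_fourier f p q ->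
  has_fourier (fun x => c * f x) (c * p) (c * q).
Proof.
move=> [i1 <- <-]; split; first exact: (integrableZl measurableT c i1).
  rewrite -RintegralZl//; last exact: integrable_mul_cos.
  by apply: eq_Rintegral => x _; rewrite mulrA.
rewrite -RintegralZl//; last exact: integrable_mul_sin.
by apply: eq_Rintegral => x _; rewrite mulrA.
Qed.

Lemma has_fourierB f1 f2 p1 p2 q1 q2 : has_fourier f1 p1 q1 -> has_fourier f2 p2 q2 ->
  has_fourier (fun x => f1 x - f2 x) (p1 - p2) (q1 - q2).
Proof.
move=> h1 /(has_fourierZ (-1)) h2; have := has_fourierD h1 h2.
by rewrite !mulN1r; under [X in has_fourier X]eq_fun do rewrite mulN1r.
Qed.

Lemma has_fourier0 : has_fourier (fun=> 0) 0 0.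
Proof.
split; first exact: integrable0.
  by under eq_Rintegral do rewrite mul0r; rewrite Rintegral_cst// mul0r.
by under eq_Rintegral do rewrite mul0r; rewrite Rintegral_cst// mul0r.
Qed.

Lemma has_fourier_sum (I : finType) (f : I -> R -> R) (p q : I -> R) :
  (forall i, has_fourier (f i) (p i) (q i)) ->
  has_fourier (fun x => \sum_i f i x) (\sum_i p i) (\sum_i q i).
Proof.
move=> h; have hs (s : seq I) :
    has_fourier (fun x => \sum_(i <- s) f i x) (\sum_(i <- s) p i) (\sum_(i <- s) q i).
  elim: s => [|i s IH].
    rewrite !big_nil; under [X in has_fourier X]eq_fun do rewrite big_nil.
    exact: has_fourier0.
  rewrite !big_cons; under [X in has_fourier X]eq_fun do rewrite big_cons.
  exact: has_fourierD.
exact: hs.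
Qed.

Lemma has_fourier_conv {d'} {T' : measurableType d'}
    (m : {sigma_finite_measure set T' -> \bar R}) (rho : T' -> R) (G : R -> R) p q :
  (m setT < +oo)%E -> measurable_fun setT rho -> has_fourier G p q ->
  has_fourier (fun r => \int[m]_z G (rho z - r))
    (\int[m]_z cos (rho z * y) * p + \int[m]_z sin (rho z * y) * q)
    (\int[m]_z sin (rho z * y) * p - \int[m]_z cos (rho z * y) * q).
Proof.
move=> mfin mrho [iG <- <-]; split.
- exact: (integrable_reflected_conv mfin mrho iG).
- exact: (reflected_conv_cos mfin mrho iG).
- exact: (reflected_conv_sin mfin mrho iG).
Qed.

(** A translation is the reflected convolution with a Dirac measure. *)
Lemma has_fourier_translate (t : R) (G : R -> R) p q : has_fourier G p q ->
  has_fourier (fun r => G (t - r))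
    (cos (t * y) * p + sin (t * y) * q) (sin (t * y) * p - cos (t * y) * q).
Proof.
move=> hG; have [/integrableP[/measurable_EFinP mG _] _ _] := hG.
pose dt : {sigma_finite_measure set T -> \bar R} := @dirac _ T t R.
have D (f : T -> R) : measurable_fun setT f -> \int[dt]_z f z = f t.
  move=> mf; rewrite /Rintegral integral_dirac//; last exact/measurable_EFinP.
  by rewrite diracT mul1e.
have := has_fourier_conv (m := dt)
  (rho := id) _ (@measurable_id _ T setT) hG.
rewrite !D; [|by apply: measurable_sin_comp; exact: mulrr_measurable|
  by apply: measurable_cos_comp; exact: mulrr_measurable].
under [X in has_fourier X]eq_fun => r.
  rewrite (D (fun z => G (z - r))); last first.
    by apply: (measurableT_comp mG); exact: measurable_funB.
  over.
by apply; rewrite /= diracT ltry.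
Qed.

Lemma has_fourier_indic (s t : R) :
  has_fourier (\1_(`]s, t]%classic : set R))
    (\int[leb_itv s t]_u cos (u * y)) (\int[leb_itv s t]_u sin (u * y)).
Proof.
have h (f : R -> R) : measurable_fun setT f -> (forall x, `|f x| <= 1) ->
    \int[leb]_x (\1_(`]s, t]%classic : set R) x * f x) = \int[leb_itv s t]_u f u.
  move=> mf f1; rewrite Rintegral_leb_itv//.
  have mI : measurable (`[s, t]%classic : set T) by exact: measurable_itv.
  have ifu : leb.-integrable `[s, t] (EFin \o f).
    have mEf : measurable_fun setT (EFin \o f) by exact/measurable_EFinP.
    exact: (integrable_leb_itv s t mEf).1 (integrable_bounded (leb_itv s t) mf f1).
  rewrite -Rintegral_itv_obnd_cbnd; last first.
    apply: (integrableS mI _ _ ifu); first exact: measurable_itv.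
    exact: subset_itv_oc_cc.
  rewrite [RHS]Rintegral_mkcond; apply: eq_Rintegral => x _.
  by rewrite patchE indicE; case: (x \in _); rewrite ?mul1r ?mul0r.
split.
- exact: (integrable_indic_itv s t false false).
- by apply: h => [|x]; [apply: measurable_cos_comp; exact: mulrr_measurable|exact: normr_cos_le1].
- by apply: h => [|x]; [apply: measurable_sin_comp; exact: mulrr_measurable|exact: normr_sin_le1].
Qed.

End fourier_calculus.

Lemma is_derive_scale_r {R : realType} (c y : R) : is_derive y 1 (fun t => t * c) c.
Proof. by under eq_fun do rewrite mulrC; exact: is_derive_scale. Qed.

Section kernel_identity.
Context {R : realType} {d : nat}.
Local Notation leb := (@lebesgue_measure R).
Local Notation T := (measurableTypeR R).
Variable phi : 'M[signed_measure R]_d.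
Hypothesis hdet : forall z : R[i], 0 <= complex.Re z -> \det (h_phi phi z) != 0.
Hypothesis heta : forall j k (A : set T), measurable A -> (0 <= eta_mx phi j k A)%E.
Hypothesis hlambda : M_matrix (lambda_mx phi).
Variable g : R -> 'M[R]_d.
Hypothesis hg : is_kernel phi g.
Local Notation E := (kernel_ext g).

(** The difference f of the two sides is integrable in r.  Its transform is, up
    to the transform (A, B) of the indicator of (s, t], a combination of the two
    equations of [kernel_transform], and so vanishes. *)
Lemma kernel_identity j l (s t : R) : s < t -> {ae leb, forall r,
  E j l (t - r) - E j l (s - r) =
  (j == l)%:R * (\1_(`]s, t]%classic : set R) r) +
  (\sum_k \int[sprod (leb_itv s t) (posm (phi j k))]_z E k l (z.1 - z.2 - r) -
   negmass (phi j j) * \int[leb_itv s t]_u E j l (u - r))}.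
Proof.
move=> st.
pose f r := E j l (t - r) - E j l (s - r) -
  ((j == l)%:R * (\1_(`]s, t]%classic : set R) r) +
  (\sum_k \int[sprod (leb_itv s t) (posm (phi j k))]_z E k l (z.1 - z.2 - r) -
   negmass (phi j j) * \int[leb_itv s t]_u E j l (u - r))).
have hf y : has_fourier y f 0 0.
  pose C k := \int[leb]_x (E k l x * cos (x * y)).
  pose S k := \int[leb]_x (E k l x * sin (x * y)).
  have hE k : has_fourier y (E k l) (C k) (S k).
    by split => //; exact: (integrable_kernel_ext hg).
  pose A := \int[leb_itv s t]_u cos (u * y).
  pose B := \int[leb_itv s t]_u sin (u * y).
  pose c k := \int[posm (phi j k)]_v cos (v * y).
  pose q k := \int[posm (phi j k)]_v sin (v * y).
  have mcos : measurable_fun setT (fun v : T => cos (v * y)).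
    by apply: measurable_cos_comp; exact: mulrr_measurable.
  have msin : measurable_fun setT (fun v : T => sin (v * y)).
    by apply: measurable_sin_comp; exact: mulrr_measurable.
  have icos (m : {finite_measure set T -> \bar R}) :
      m.-integrable setT (EFin \o (fun v => cos (v * y))).
    exact: (integrable_bounded m mcos (fun v => normr_cos_le1 _)).
  have isin (m : {finite_measure set T -> \bar R}) :
      m.-integrable setT (EFin \o (fun v => sin (v * y))).
    exact: (integrable_bounded m msin (fun v => normr_sin_le1 _)).
  have cZ (m : {finite_measure set T -> \bar R}) u :
      \int[m]_v (u * cos (v * y)) = u * \int[m]_v cos (v * y).
    by rewrite RintegralZl//; exact: icos.
  have sZ (m : {finite_measure set T -> \bar R}) u :
      \int[m]_v (u * sin (v * y)) = u * \int[m]_v sin (v * y).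
    by rewrite RintegralZl//; exact: isin.
  have cZr (m : {finite_measure set T -> \bar R}) u :
      \int[m]_v (cos (v * y) * u) = \int[m]_v cos (v * y) * u.
    by rewrite RintegralZr//; exact: icos.
  have sZr (m : {finite_measure set T -> \bar R}) u :
      \int[m]_v (sin (v * y) * u) = \int[m]_v sin (v * y) * u.
    by rewrite RintegralZr//; exact: isin.
  have yA : y * A = sin (t * y) - sin (s * y).
    rewrite /A -cZ Rintegral_leb_itv; last exact: measurable_funM.
    have dF (u : R) : is_derive u 1 (sin \o (fun u => u * y)) (y * cos (u * y)).
      by rewrite [y * _]mulrC;
        exact: (@is_derive1_comp _ sin (fun u => u * y) u _ _ (is_derive_sin (u * y))
          (is_derive_scale_r y u)).
    rewrite (FTC_itv (ltW st) _ dF)// => u; apply: cvgM; first exact: cvg_cst.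
    exact: (is_derive_continuous (fun u : R => @is_derive1_comp _ cos (fun u => u * y) u _ _
      (is_derive_cos (u * y)) (is_derive_scale_r y u))).
  have yB : y * B = cos (s * y) - cos (t * y).
    rewrite /B -sZ Rintegral_leb_itv; last exact: measurable_funM.
    have dF (u : R) : is_derive u 1 (- (cos \o (fun u => u * y))) (y * sin (u * y)).
      have dc := @is_derive1_comp _ cos (fun u => u * y) u _ _
        (is_derive_cos (u * y)) (is_derive_scale_r y u).
      by apply: (is_derive_eq (is_deriveN dc)); ring.
    rewrite (FTC_itv (ltW st) _ dF)//; last first.
      move=> u; apply: cvgM; first exact: cvg_cst.
      exact: (is_derive_continuous (fun u : R => @is_derive1_comp _ sin (fun u => u * y) u _ _
        (is_derive_sin (u * y)) (is_derive_scale_r y u))).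
    by rewrite -![(- _) _]/(- _ _) /= opprK addrC.
  have mrho : measurable_fun setT (fun z : T * T => z.1 - z.2).
    by apply: measurable_funB; [exact: measurable_fst|exact: measurable_snd].
  have i1 k : (sprod (leb_itv s t) (posm (phi j k))).-integrable setT
      (EFin \o (fun=> 1 : R)).
    apply/integrableP; split; first by apply/measurable_EFinP; exact: measurable_cst.
    under eq_integral do rewrite /= normr1.
    by rewrite integral_cst// mul1e sprod_lty.
  have cP k : \int[sprod (leb_itv s t) (posm (phi j k))]_z cos ((z.1 - z.2) * y) =
      A * c k + B * q k.
    have m0 : measurable_fun setT (fun z : T * T => cos ((z.1 - z.2) * y)).
      by apply: measurable_cos_comp; exact: measurable_funM.
    have i0 := integrable_mul_bounded (i1 k) m0 (fun z => normr_cos_le1 _).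
    under eq_Rintegral do rewrite -[cos _]mul1r.
    rewrite (Rintegral_prod12 i0) /=.
    transitivity (\int[leb_itv s t]_u (cos (u * y) * c k + sin (u * y) * q k)).
      apply: eq_Rintegral => u _; rewrite /c /q -cZ -sZ.
      rewrite -RintegralD//;
        [|solve [exact: (integrableZl measurableT _ (icos _))|exact: (integrableZl measurableT _
          (isin _))]..].
      by apply: eq_Rintegral => v _; rewrite mul1r mulrBl cosB.
    rewrite RintegralD//;
      [|solve [exact: (integrableZr measurableT _ (icos _))|exact: (integrableZr measurableT _
        (isin _))]..].
    by rewrite cZr sZr.
  have sP k : \int[sprod (leb_itv s t) (posm (phi j k))]_z sin ((z.1 - z.2) * y) =
      B * c k - A * q k.
    have m0 : measurable_fun setT (fun z : T * T => sin ((z.1 - z.2) * y)).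
      by apply: measurable_sin_comp; exact: measurable_funM.
    have i0 := integrable_mul_bounded (i1 k) m0 (fun z => normr_sin_le1 _).
    under eq_Rintegral do rewrite -[sin _]mul1r.
    rewrite (Rintegral_prod12 i0) /=.
    transitivity (\int[leb_itv s t]_u (sin (u * y) * c k - cos (u * y) * q k)).
      apply: eq_Rintegral => u _; rewrite /c /q -cZ -sZ.
      rewrite -RintegralB//;
        [|solve [exact: (integrableZl measurableT _ (icos _))|exact: (integrableZl measurableT _
          (isin _))]..].
      by apply: eq_Rintegral => v _; rewrite mul1r mulrBl sinB.
    rewrite RintegralB//;
      [|solve [exact: (integrableZr measurableT _ (icos _))|exact: (integrableZr measurableT _
        (isin _))]..].
    by rewrite cZr sZr.
  have hsum := has_fourier_sum (fun k => has_fourier_conv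
    (@sprod_lty _ (leb_itv s t) (posm (phi j k))) mrho (hE k)).
  have lebfin : (leb_itv s t setT < +oo)%E by rewrite -ge0_fin_numE// fin_num_measure.
  have ha := has_fourier_conv (m := leb_itv s t) (rho := id) lebfin
    (@measurable_id _ T setT) (hE j).
  have := has_fourierB
    (has_fourierB (has_fourier_translate t (hE j)) (has_fourier_translate s (hE j)))
    (has_fourierD (has_fourierZ (j == l)%:R (has_fourier_indic y s t))
       (has_fourierB hsum (has_fourierZ (negmass (phi j j)) ha))).
  have [k1 k2] := kernel_transform hdet heta hlambda hg y j l.
  rewrite -/A -/B.
  set p := (X in has_fourier _ _ X _); set p' := (X in has_fourier _ _ _ X).
  suff [-> ->] : p = 0 /\ p' = 0 by [].
  pose P := \sum_k (c k * C k - q k * S k) - negmass (phi j j) * C j.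
  pose Q := \sum_k (c k * S k + q k * C k) - negmass (phi j j) * S j.
  have E1 : \sum_k ((A * c k + B * q k) * C k + (B * c k - A * q k) * S k) =
      A * (P + negmass (phi j j) * C j) + B * (Q + negmass (phi j j) * S j).
    rewrite /P /Q !subrK !mulr_sumr -big_split/=; apply: eq_bigr => k _; ring.
  have E2 : \sum_k ((B * c k - A * q k) * C k - (A * c k + B * q k) * S k) =
      B * (P + negmass (phi j j) * C j) - A * (Q + negmass (phi j j) * S j).
    rewrite /P /Q !subrK !mulr_sumr -sumrB; apply: eq_bigr => k _; ring.
  have PE : P = y * S j - (j == l)%:R.
    have <- : y * S j - P = (j == l)%:R by exact: k1.
    by rewrite subKr.
  have QE : Q = - (y * C j).
    by apply/eqP; rewrite -addr_eq0 addrC; apply/eqP; exact: k2.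
  have sE : sin (t * y) = y * A + sin (s * y) by rewrite yA subrK.
  have cE : cos (t * y) = cos (s * y) - y * B by rewrite yB; ring.
  have p0 : p = (cos (t * y) * C j + sin (t * y) * S j) - (cos (s * y) * C j + sin (s * y) * S j) -
     ((j == l)%:R * A + (\sum_k ((A * c k + B * q k) * C k + (B * c k - A * q k) * S k) -
        negmass (phi j j) * (A * C j + B * S j))).
    rewrite /p; congr (_ - (_ + (_ - _))); apply: eq_bigr => k _.
    by rewrite cP sP.
  have p1 : p' = (sin (t * y) * C j - cos (t * y) * S j) - (sin (s * y) * C j - cos (s * y) * S j) -
     ((j == l)%:R * B + (\sum_k ((B * c k - A * q k) * C k - (A * c k + B * q k) * S k) -
        negmass (phi j j) * (B * C j - A * S j))).
    rewrite /p'; congr (_ - (_ + (_ - _))); apply: eq_bigr => k _.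
    by rewrite cP sP.
  rewrite p0 p1 E1 E2 PE QE sE cE; split; ring.
have [intf _ _] := hf 0.
have f0 : {ae leb, forall r, f r = 0}.
  by apply: fourier_uniqueness => // y; have [] := hf y.
by apply: ae_weaken f0 => r /eqP; rewrite subr_eq0 => /eqP.
Qed.

End kernel_identity.

(** * Integration against random Stieltjes measures *)

Lemma lebesgue_stieltjes_oc {R : realType} (f : cumulative R R) a b : a <= b ->
  lebesgue_stieltjes_measure f `]a, b]%classic = (f b - f a)%:E.
Proof.
move=> ab; rewrite /lebesgue_stieltjes_measure/= /measure_extension/=.
rewrite measurable_mu_extE//; last exact: is_ocitv.
exact: wlength_itv_bnd.
Qed.

Lemma lebesgue_oc {R : realType} (a b : R) : a <= b ->
  lebesgue_measure (`]a, b]%classic : set (measurableTypeR R)) = (b - a)%:E.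
Proof.
have := lebesgue_measure_itv `]a, b] => ->.
by rewrite /= lte_fin le_eqVlt => /predU1P[->|->//]; rewrite ltxx subrr.
Qed.

Section time_change.
Context {dsp : measure_display} {Omega : measurableType dsp} {R : realType}.
Local Notation leb := (@lebesgue_measure R).
Local Notation T := (measurableTypeR R).
Variable F : R -> Omega -> R.
Hypothesis ndF : forall w, nondecreasing (F ^~ w).
Hypothesis rcF : forall w, right_continuous (F ^~ w).
Hypothesis mF : forall r, measurable_fun setT (F r).

Definition path_cumulative (w : Omega) : cumulative R R :=
  HB.pack (F ^~ w) (isCumulative.Build R _ R (F ^~ w) (@ndF w) (@rcF w)).

Definition path_measure (w : Omega) : {sigma_finite_measure set T -> \bar R} :=
  lebesgue_stieltjes_measure (path_cumulative w).

Lemma path_measure_oc w a b : a <= b ->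
  path_measure w `]a, b]%classic = (F b w - F a w)%:E.
Proof.
exact: lebesgue_stieltjes_oc.
Qed.

Lemma stieltjes_path w : stieltjes (F ^~ w) = path_measure w.
Proof.
rewrite /stieltjes; case: pselect => [H|[]//].
rewrite /path_measure /path_cumulative.
by rewrite (Prop_irrelevance (proj1 H) (@ndF w)) (Prop_irrelevance (proj2 H) (@rcF w)).
Qed.

(** The levels x that the path w actually crosses; other levels have no
    generalized inverse. *)
Definition range_dom : set (T * Omega) :=
  [set xw | (exists r, xw.1 <= F r xw.2) /\ (exists r, F r xw.2 < xw.1)].

Definition path_inverse (xw : T * Omega) : T :=
  if xw \in range_dom then inf [set r | xw.1 <= F r xw.2] else 0.

(** The Galois connection between a right-continuous path and its generalized
    inverse. *)
Lemma path_inverse_le x w r : range_dom (x, w) ->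
  (path_inverse (x, w) <= r) = (x <= F r w).
Proof.
move=> D; rewrite /path_inverse mem_set//=.
have [[r1 /= hr1] [r2 /= hr2]] := D.
have lb : has_lbound [set r | x <= F r w].
  exists r2 => u /= xu; rewrite leNgt; apply/negP => ur2.
  by have := lt_le_trans hr2 xu; rewrite ltNge (@ndF w _ _ (ltW ur2)).
apply/idP/idP => [h|h]; last exact: ge_inf.
rewrite (le_trans _ (@ndF w _ _ h))//.
set t := inf _; rewrite leNgt; apply/negP => tx.
have /cvgrPdist_lt/(_ (x - F t w)) := @rcF w t.
rewrite subr_gt0 => /(_ tx)[e /= e0 he].
have [u /= xu ut] : exists2 u, x <= F u w & u < t + e.
  by apply: inf_lt; [exists r1|rewrite ltrDl].
have tu : t <= u by apply: ge_inf.
have : F u w < x.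
  move: tu; rewrite le_eqVlt => /predU1P[<-//|tu].
  have := he u; rewrite /ball/= distrC ger0_norm ?subr_ge0 ?(ltW tu)// ltrBlDl.
  move=> /(_ ut tu); rewrite distrC ger0_norm ?subr_ge0 ?(@ndF w _ _ (ltW tu))//.
  by rewrite ltrBlDr subrK.
by rewrite ltNge xu.
Qed.

Lemma measurable_range_le r : measurable [set xw : T * Omega | xw.1 <= F r xw.2].
Proof.
have m : measurable_fun setT (fun xw : T * Omega => xw.1 - F r xw.2).
  apply: measurable_funB; first exact: measurable_fst.
  exact: (measurableT_comp (mF r) measurable_snd).
rewrite (_ : [set _ | _] = setT `&` (fun xw : T * Omega => xw.1 - F r xw.2) @^-1` `]-oo, 0]).
  by apply: m => //; exact: measurable_itv.
by apply/seteqP; split => xw /=; rewrite in_itv/= subr_le0; [|case].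
Qed.

Lemma measurable_range_dom : measurable range_dom.
Proof.
rewrite (_ : range_dom = (\bigcup_n [set xw : T * Omega | xw.1 <= F n%:R xw.2]) `&`
    (\bigcup_n ~` [set xw : T * Omega | xw.1 <= F (- n%:R) xw.2])).
  apply: measurableI; apply: bigcupT_measurable => n; first exact: measurable_range_le.
  by apply: measurableC; exact: measurable_range_le.
apply/seteqP; split => -[x w] /=.
  move=> [[r1 /= h1] [r2 /= h2]]; split.
    exists (Num.truncn r1).+1 => //=; apply: (le_trans h1); apply: ndF.
    by rewrite ltW// truncnS_gt.
  exists (Num.truncn (- r2)).+1 => //=; apply/negP; rewrite -ltNge.
  apply: le_lt_trans h2; apply: ndF.
  by rewrite lerNl ltW// truncnS_gt.
move=> [[n _ /= h1] [m _ /= /negP]]; rewrite -ltNge => h2.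
by split; [exists n%:R|exists (- m%:R)].
Qed.

Lemma measurable_path_inverse : measurable_fun setT path_inverse.
Proof.
apply: (measurability _ (RGenOInfty.measurableE R)) => //.
move=> _ [_ [r ->] <-]; rewrite setTI.
rewrite (_ : _ @^-1` _ = (range_dom `&` ~` [set xw : T * Omega | xw.1 <= F r xw.2]) `|`
   (~` range_dom `&` [set xw | r < 0])).
  apply: measurableU; apply: measurableI.
  - exact: measurable_range_dom.
  - by apply: measurableC; exact: measurable_range_le.
  - by apply: measurableC; exact: measurable_range_dom.
  - have [r0|r0] := pselect (r < 0).
      by have -> : [set xw : T * Omega | r < 0] = setT by apply/seteqP; split => xw.
    by have -> : [set xw : T * Omega | r < 0] = set0 by apply/seteqP; split => xw.
apply/seteqP; split => -[x w] /=; rewrite in_itv/= andbT.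
  have [D|D] := pselect (range_dom (x, w)).
    by rewrite ltNge path_inverse_le// => /negP; left.
  by rewrite /path_inverse memNset// => r0; right.
move=> [[D /negP]|[D r0]].
  by rewrite ltNge path_inverse_le.
by rewrite /path_inverse memNset.
Qed.

Lemma range_dom_oc a b : a <= b -> range_dom `&` path_inverse @^-1` `]a, b] =
  [set xw : T * Omega | F a xw.2 < xw.1 <= F b xw.2].
Proof.
move=> ab; apply/seteqP; split => -[x w] /=; rewrite in_itv/=.
  by move=> [D]; rewrite ltNge !path_inverse_le// -ltNge.
move=> /andP[h1 h2]; have D : range_dom (x, w) by split; [exists b|exists a].
by split => //; rewrite ltNge !path_inverse_le// -ltNge h1.
Qed.

Lemma measurable_range_indic :
  measurable_fun setT (\1_range_dom : T * Omega -> R).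
Proof. by apply: measurable_indic; exact: measurable_range_dom. Qed.

Definition dom_section (w : Omega) : set T := [set x | range_dom (x, w)].

Lemma measurable_dom_section w : measurable (dom_section w).
Proof. by have := measurable_ysection w measurable_range_dom; rewrite ysectionE. Qed.

Lemma measurable_inverse_section w : measurable_fun setT (fun x : T => path_inverse (x, w)).
Proof. exact: (measurable_fun_pair1 w measurable_path_inverse). Qed.

(** The measure dF is the image of Lebesgue measure on the crossed levels under
    the generalized inverse.  All dependence on w is thereby moved from the
    measure into a jointly measurable function. *)
Lemma path_measureE w (A : set T) : measurable A ->
  path_measure w A = image_measure (mrestr leb (measurable_dom_section w))
    (measurable_inverse_section w) A.
Proof.
apply: lebesgue_stieltjes_measure_unique => _ [[a b]] _ <-.
rewrite image_measureE /= /mrestr.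
have [ab|ab] := leP a b; last first.
  by rewrite set_itv_ge ?bnd_simp -?leNgt ?ltW// preimage_set0 set0I !measure0.
rewrite -[LHS]/(path_measure w `]a, b]%classic) path_measure_oc//.
rewrite (_ : _ `&` _ = `]F a w, F b w]%classic :> set T).
  by apply/esym; apply: lebesgue_oc; exact: ndF.
have /seteqP[s1 s2] := range_dom_oc ab.
apply/seteqP; split => x /=.
  by move=> [h D]; have /= := s1 (x, w) (conj D h); rewrite in_itv.
by rewrite in_itv/= => h; have [/= D h'] := s2 (x, w) h.
Qed.

Lemma ge0_integral_path_measure w (f : T -> \bar R) : measurable_fun setT f ->
  (forall r, 0 <= f r)%E ->
  (\int[path_measure w]_r f r =
   \int[leb]_x (f (path_inverse (x, w)) * (\1_range_dom (x, w))%:E))%E.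
Proof.
move=> mf f0.
rewrite (eq_measure_integral (image_measure (mrestr leb (measurable_dom_section w))
    (measurable_inverse_section w))); last by move=> A mA _; exact: path_measureE.
rewrite ge0_integral_image// integral_mrestr; last first.
  exact: (measurableT_comp mf (measurable_inverse_section w)).
rewrite integral_mkcond; apply: eq_integral => x _; rewrite patchE indicE.
have [D|D] := pselect (range_dom (x, w)).
  by rewrite !mem_set// mule1.
by rewrite !memNset// mule0.
Qed.

Section joint_measurability.
Context {dS : measure_display} {U : measurableType dS}.

Lemma measurable_path_integral_ge0 (h : U * T -> \bar R) : measurable_fun setT h ->
  (forall z, 0 <= h z)%E ->
  measurable_fun setT (fun sw : U * Omega => \int[path_measure sw.2]_r h (sw.1, r))%E.
Proof.
move=> mh h0.
pose H (z : (U * Omega) * T) : \bar R :=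
  (h (z.1.1, path_inverse (z.2, z.1.2)) * (\1_range_dom (z.2, z.1.2))%:E)%E.
have mxw : measurable_fun setT (fun z : (U * Omega) * T => (z.2, z.1.2)).
  apply: measurable_fun_pair; first exact: measurable_snd.
  exact: (measurableT_comp measurable_snd measurable_fst).
have mH : measurable_fun setT H.
  apply: emeasurable_funM.
    apply: (measurableT_comp mh); apply: measurable_fun_pair.
      exact: (measurableT_comp measurable_fst measurable_fst).
    exact: (measurableT_comp measurable_path_inverse mxw).
  apply/measurable_EFinP.
  exact: (measurableT_comp measurable_range_indic mxw).
have H0 z : (0 <= H z)%E by rewrite mule_ge0// lee_fin.
rewrite (_ : (fun sw => _) = (fun sw : U * Omega => \int[leb]_x H (sw, x))%E).
  exact: (@measurable_fun_fubini_tonelli_F _ _ _ _ _ leb _ mH H0).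
apply/funext => -[s w] /=; apply: ge0_integral_path_measure => //.
exact: (measurable_fun_pair2 s mh).
Qed.

Lemma measurable_path_Rintegral (h : U * T -> R) : measurable_fun setT h ->
  measurable_fun setT (fun sw : U * Omega => \int[path_measure sw.2]_r h (sw.1, r)).
Proof.
move=> mh; rewrite /Rintegral; apply: (measurableT_comp (fine_measurable _)) => //.
rewrite (_ : (fun sw => _) = (fun sw : U * Omega =>
  \int[path_measure sw.2]_r ((EFin \o h)^\+ (sw.1, r)) -
  \int[path_measure sw.2]_r ((EFin \o h)^\- (sw.1, r)))%E); last first.
  apply/funext => sw; rewrite integralE.
  by congr (_ - _)%E; apply: eq_integral => r _; rewrite ?funeposE ?funenegE.
have mEh : measurable_fun setT (EFin \o h) by exact/measurable_EFinP.
apply: emeasurable_funB; apply: measurable_path_integral_ge0 => //.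
- exact: measurable_funepos.
- exact: measurable_funeneg.
Qed.

End joint_measurability.

Variables (P : probability Omega R) (c : R).
Hypothesis c0 : 0 <= c.
Hypothesis meanF : forall a b, a <= b -> (\int[P]_w (F b w - F a w)%:E = (c * (b - a))%:E)%E.

(** The measure A |-> E (dF (A)) and c times Lebesgue measure agree on the
    half-open intervals, hence everywhere. *)
Lemma campbell (f : T -> \bar R) : measurable_fun setT f -> (forall r, 0 <= f r)%E ->
  (\int[P]_w \int[path_measure w]_r f r = c%:E * \int[leb]_r f r)%E.
Proof.
move=> mf f0.
pose m := image_measure (mrestr (leb \x P)%E measurable_range_dom) measurable_path_inverse.
have mrange : measurable_fun setT (fun xw : T * Omega =>
    (f (path_inverse xw) * (\1_range_dom xw)%:E)%E).
  apply: emeasurable_funM; first exact: (measurableT_comp mf measurable_path_inverse).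
  by apply/measurable_EFinP; exact: measurable_range_indic.
have range0 (xw : T * Omega) : (0 <= f (path_inverse xw) * (\1_range_dom xw)%:E)%E.
  by rewrite mule_ge0// lee_fin.
transitivity (\int[m]_r f r)%E.
  rewrite ge0_integral_image// integral_mrestr; last first.
    exact: (measurableT_comp mf measurable_path_inverse).
  rewrite integral_mkcond.
  rewrite (eq_integral (fun xw => (f (path_inverse xw) * (\1_range_dom xw)%:E)%E)); last first.
    move=> xw _; rewrite patchE indicE; case: (xw \in _); by rewrite ?mule1 ?mule0.
  rewrite (@fubini_tonelli2 _ _ _ _ _ leb P _ mrange range0); apply: eq_integral => w _.
  exact: ge0_integral_path_measure.
have cid_nd : nondecreasing (fun r : R => c * r) by move=> a b ab; exact: ler_wpM2l.
have cid_rc : right_continuous (fun r : R => c * r).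
  by apply: right_continuousW; exact: mulrl_continuous.
pose cid : cumulative R R :=
  HB.pack (fun r : R => c * r) (isCumulative.Build R _ R (fun r : R => c * r) cid_nd cid_rc).
have cidE a b : a <= b -> lebesgue_stieltjes_measure cid `]a, b]%classic = (c * (b - a))%:E.
  by move=> ab; rewrite lebesgue_stieltjes_oc//= mulrBr.
(* c times Lebesgue measure is compared with the mean measure through the
   Stieltjes measure of r |-> c * r, as both are determined by that function. *)
pose cnn : {nonneg R} := NngNum c0.
have m1 A : measurable A -> lebesgue_stieltjes_measure cid A = m A.
  apply: lebesgue_stieltjes_measure_unique => _ [[a b]] _ <-.
  have [ab|ab] := leP a b; last first.
    by rewrite set_itv_ge ?bnd_simp -?leNgt ?ltW// !measure0.
  rewrite cidE// /m image_measureE /= /mrestr setIC range_dom_oc//.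
  have mab : measurable [set xw : T * Omega | F a xw.2 < xw.1 <= F b xw.2].
    rewrite -range_dom_oc//; apply: measurableI; first exact: measurable_range_dom.
    rewrite -[X in measurable X]setTI; apply: measurable_path_inverse => //.
  set B := [set _ | _] in mab *.
  have mB : measurable_fun setT (fun xw : T * Omega => (\1_B xw : R)%:E).
    by apply/measurable_EFinP; exact: measurable_indic.
  have B0 (xw : T * Omega) : (0 <= (\1_B xw)%:E :> \bar R)%E by rewrite lee_fin.
  rewrite -[B]setIT -integral_indic// (@fubini_tonelli2 _ _ _ _ _ leb P _ mB B0).
  rewrite -meanF//; apply: eq_integral => w _; rewrite /fubini_G.
  have mI : measurable (`]F a w, F b w]%classic : set T) by exact: measurable_itv.
  rewrite (eq_integral (fun x => (\1_(`]F a w, F b w]%classic : set T) x : R)%:E)); last first.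
    move=> x _; rewrite !indicE.
    suff -> : ((x, w) \in B) = (x \in (`]F a w, F b w]%classic : set T)) by [].
    by apply/idP/idP => /set_mem h; apply/mem_set; move: h; rewrite /B/= in_itv/=.
  rewrite integral_indic// setIT; apply/esym; apply: lebesgue_oc; exact: ndF.
have m2 A : measurable A -> lebesgue_stieltjes_measure cid A = mscale cnn leb A.
  apply: lebesgue_stieltjes_measure_unique => _ [[a b]] _ <-.
  have [ab|ab] := leP a b; last first.
    by rewrite set_itv_ge ?bnd_simp -?leNgt ?ltW// !measure0.
  by rewrite cidE// EFinM /mscale/=; congr (_ * _)%E; apply/esym; apply: lebesgue_oc.
transitivity (\int[mscale cnn leb]_r f r)%E.
  by apply: eq_measure_integral => A mA _; exact: etrans (esym (m1 A mA)) (m2 A mA).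
by rewrite ge0_integral_mscale.
Qed.

End time_change.

(** * The moving average solves the equation *)

Lemma Rintegral_sum {d} {T : measurableType d} {R : realType}
    (m : {measure set T -> \bar R}) (I : finType) (f : I -> T -> R) :
  (forall i, m.-integrable setT (EFin \o f i)) ->
  \int[m]_x (\sum_i f i x) = \sum_i \int[m]_x f i x.
Proof.
move=> intf; pose S (s : seq I) x := \sum_(i <- s) f i x.
have h (s : seq I) : m.-integrable setT (EFin \o S s) /\
    \int[m]_x S s x = \sum_(i <- s) \int[m]_x f i x.
  elim: s => [|i s [IH1 IH2]].
    rewrite big_nil (_ : S [::] = cst 0); last by apply/funext => x; rewrite /S big_nil.
    by split; [exact: integrable0|rewrite Rintegral_cst// mul0r].
  rewrite big_cons (_ : S (i :: s) = fun x => f i x + S s x); last first.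
    by apply/funext => x; rewrite /S big_cons.
  split; first exact: (integrableD measurableT (intf i) IH1).
  by rewrite RintegralD// IH2.
exact: (h (index_enum I)).2.
Qed.

Section random_measure.
Context {dsp : measure_display} {Omega : measurableType dsp} {R : realType}.
Local Notation leb := (@lebesgue_measure R).
Local Notation T := (measurableTypeR R).
Variable F : R -> Omega -> R.
Hypothesis ndF : forall w, nondecreasing (F ^~ w).
Hypothesis rcF : forall w, right_continuous (F ^~ w).
Hypothesis mF : forall r, measurable_fun setT (F r).
Variables (P : probability Omega R) (c : R).
Hypothesis c0 : 0 <= c.
Hypothesis meanF : forall a b, a <= b -> (\int[P]_w (F b w - F a w)%:E = (c * (b - a))%:E)%E.
Local Notation kappa := (path_measure ndF rcF).

Lemma measurable_random_integral (f : T -> \bar R) : measurable_fun setT f ->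
  (forall r, 0 <= f r)%E -> measurable_fun setT (fun w => \int[kappa w]_r f r)%E.
Proof.
move=> mf f0.
have mh : measurable_fun setT (fun z : Omega * T => f z.2).
  exact: (measurableT_comp mf measurable_snd).
have md : measurable_fun setT (fun w : Omega => (w, w)).
  by apply: measurable_fun_pair; exact: measurable_id.
exact: (measurableT_comp (measurable_path_integral_ge0 ndF rcF mF mh (fun z => f0 z.2)) md).
Qed.

Lemma ae_random_integral_lty (f : T -> \bar R) : measurable_fun setT f ->
  (forall r, 0 <= f r)%E -> (\int[leb]_r f r < +oo)%E ->
  {ae P, forall w, \int[kappa w]_r f r < +oo}%E.
Proof.
move=> mf f0 foo.
have I : P.-integrable setT (fun w => \int[kappa w]_r f r)%E.
  apply/integrableP; split; first exact: measurable_random_integral.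
  rewrite (eq_integral (fun w => \int[kappa w]_r f r)%E); last first.
    by move=> w _; rewrite gee0_abs// integral_ge0.
  rewrite (campbell ndF rcF mF c0 meanF)//.
  by apply: lte_mul_pinfty => //; rewrite ge0_fin_numE// integral_ge0.
apply: filterS (integrable_ae measurableT I) => w /(_ Logic.I).
by rewrite ge0_fin_numE// integral_ge0.
Qed.

(** A Lebesgue null set has mean random measure 0. *)
Lemma ae_random_ae (Q : T -> Prop) : {ae leb, forall r, Q r} ->
  {ae P, forall w, {ae kappa w, forall r, Q r}}.
Proof.
move=> [N [mN N0 QN]].
have m1 : measurable_fun setT (fun r : T => (\1_N r)%:E : \bar R).
  by apply/measurable_EFinP; exact: measurable_indic.
have p1 (r : T) : (0 <= (\1_N r)%:E :> \bar R)%E by rewrite lee_fin.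
have h : (\int[P]_w `|\int[kappa w]_r (\1_N r)%:E| = 0)%E.
  rewrite (eq_integral (fun w => \int[kappa w]_r (\1_N r)%:E)%E); last first.
    by move=> w _; rewrite gee0_abs// integral_ge0.
  rewrite (campbell ndF rcF mF c0 meanF)//.
  by rewrite integral_indic// setIT [X in (_ * X)%E](_ : _ = 0%E) ?mule0.
have := (ae_eq_integral_abs P measurableT (measurable_random_integral m1 p1)).1 h.
apply: filterS => w /(_ Logic.I)/= kN; exists N; split => //.
by move: kN; rewrite integral_indic// setIT.
Qed.

Lemma mean_random_Rintegral (f : T -> R) : leb.-integrable setT (EFin \o f) ->
  (\int[P]_w `|\int[kappa w]_r f r|%:E <= (c * \int[leb]_r `|f r|)%:E)%E.
Proof.
move=> intf; have /integrableP[/measurable_EFinP mf foo] := intf.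
have mn : measurable_fun setT (fun r : T => `|f r|%:E).
  by apply/measurable_EFinP; exact: measurableT_comp.
have mR : measurable_fun setT (fun w => \int[kappa w]_r f r).
  have mh : measurable_fun setT (fun z : Omega * T => f z.2).
    exact: (measurableT_comp mf measurable_snd).
  have md : measurable_fun setT (fun w : Omega => (w, w)).
    by apply: measurable_fun_pair; exact: measurable_id.
  exact: (measurableT_comp (measurable_path_Rintegral ndF rcF mF mh) md).
apply: (@le_trans _ _ (\int[P]_w \int[kappa w]_r `|f r|%:E)%E).
  apply: ge0_le_integral => //.
  - by apply/measurable_EFinP; exact: measurableT_comp.
  - exact: measurable_random_integral.
  - by move=> w _; exact: normr_Rintegral_le.
rewrite (campbell ndF rcF mF c0 meanF)// EFinM /Rintegral fineK//.
by rewrite ge0_fin_numE// integral_ge0.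
Qed.

Section convolution.
Context {d' : measure_display} {T' : measurableType d'}.
Variables (m : {sigma_finite_measure set T' -> \bar R}) (rho : T' -> R).
Hypothesis mfin : (m setT < +oo)%E.
Hypothesis mrho : measurable_fun setT rho.
Variable G : R -> R.
Hypothesis intG : leb.-integrable setT (EFin \o G).

(** The mean of the integral is c times an integral against Lebesgue measure,
    which is finite by [integrable_reflected_kernel]. *)
Lemma ae_random_convolution : {ae P, forall w,
  (kappa w \x m)%E.-integrable setT (EFin \o (fun rz : T * T' => G (rho rz.2 - rz.1))) /\
  (m \x kappa w)%E.-integrable setT (EFin \o (fun zr : T' * T => G (rho zr.1 - zr.2)))}.
Proof.
have /integrableP[/measurable_EFinP mG Goo] := intG.
have m1 : measurable_fun setT (fun rz : T * T' => G (rho rz.2 - rz.1)).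
  apply: (measurableT_comp mG); apply: measurable_funB; last exact: measurable_fst.
  exact: (measurableT_comp mrho measurable_snd).
have m2 : measurable_fun setT (fun zr : T' * T => G (rho zr.1 - zr.2)).
  apply: (measurableT_comp mG); apply: measurable_funB; last exact: measurable_snd.
  exact: (measurableT_comp mrho measurable_fst).
have m1n : measurable_fun setT (fun rz : T * T' => `|G (rho rz.2 - rz.1)|%:E).
  by apply/measurable_EFinP; exact: measurableT_comp.
have mI : measurable_fun setT (fun r : T => \int[m]_z `|G (rho z - r)|%:E)%E.
  exact: (@measurable_fun_fubini_tonelli_F _ _ _ _ _ m _ m1n).
have I0 (r : T) : (0 <= \int[m]_z `|G (rho z - r)|%:E)%E by exact: integral_ge0.
have Ioo : (\int[leb]_r \int[m]_z `|G (rho z - r)|%:E < +oo)%E.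
  have /integrable12ltyP := integrable_reflected_kernel mfin mrho intG.
  by apply; exact/measurable_EFinP.
apply: filterS (ae_random_integral_lty mI I0 Ioo) => w h; split.
- by apply/integrable12ltyP => //; exact/measurable_EFinP.
- by apply/integrable21ltyP => //; exact/measurable_EFinP.
Qed.

End convolution.
End random_measure.

Section kernel_process.
Context {dsp : measure_display} {Omega : measurableType dsp} {R : realType}.
Variables (P : probability Omega R) (d : nat).
Local Notation leb := (@lebesgue_measure R).
Local Notation T := (measurableTypeR R).
Variable phi : 'M[signed_measure R]_d.
Hypothesis hdet : forall z : R[i], 0 <= complex.Re z -> \det (h_phi phi z) != 0.
Hypothesis heta : forall j k (A : set T), measurable A -> (0 <= eta_mx phi j k A)%E.
Hypothesis hlambda : M_matrix (lambda_mx phi).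
Variable g : R -> 'M[R]_d.
Hypothesis hg : is_kernel phi g.
Local Notation E := (kernel_ext g).
Variable F : 'I_d -> R -> Omega -> R.
Hypothesis ndF : forall l w, nondecreasing (F l ^~ w).
Hypothesis rcF : forall l w, right_continuous (F l ^~ w).
Hypothesis mF : forall l r, measurable_fun setT (F l r).
Variable c : 'I_d -> R.
Hypothesis c0 : forall l, 0 <= c l.
Hypothesis meanF : forall l a b, a <= b ->
  (\int[P]_w (F l b w - F l a w)%:E = (c l * (b - a))%:E)%E.
Local Notation kappa l := (path_measure (@ndF l) (@rcF l)).

Definition kernel_process j t w := \sum_l \int[kappa l w]_r E j l (t - r).

Let mE j l : measurable_fun setT (E j l : T -> R).
Proof. by have /integrableP[/measurable_EFinP] := integrable_kernel_ext hg j l. Qed.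

Let measurable_summand j l : measurable_fun setT
  (fun tw : T * Omega => \int[kappa l tw.2]_r E j l (tw.1 - r)).
Proof.
have mh : measurable_fun setT (fun tr : T * T => E j l (tr.1 - tr.2)).
  apply: (measurableT_comp (mE j l)); apply: measurable_funB.
    exact: measurable_fst.
  exact: measurable_snd.
exact: (measurable_path_Rintegral (@ndF l) (@rcF l) (@mF l) mh).
Qed.

Lemma measurable_kernel_process j :
  measurable_fun setT (fun tw : T * Omega => kernel_process j tw.1 tw.2).
Proof. by apply: measurable_sum => l; exact: measurable_summand. Qed.

Lemma kernel_process_mean_bounded :
  exists M, forall j t, (\int[P]_w `|kernel_process j t w|%:E <= M%:E)%E.
Proof.
pose b j := \sum_l c l * \int[leb]_r `|E j l r|.
have b0 j : 0 <= b j.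
  by apply: sumr_ge0 => l _; rewrite mulr_ge0// Rintegral_ge0.
exists (\sum_j b j) => j t.
have mt l : measurable_fun setT (fun w => \int[kappa l w]_r E j l (t - r)).
  exact: (measurable_fun_pair2 (t : T) (measurable_summand j l)).
have mtn l : measurable_fun setT (fun w => `|\int[kappa l w]_r E j l (t - r)|%:E).
  by apply/measurable_EFinP; exact: measurableT_comp.
apply: (@le_trans _ _ (\int[P]_w \sum_l `|\int[kappa l w]_r E j l (t - r)|%:E)%E).
  apply: ge0_le_integral => //.
  - apply/measurable_EFinP; apply: measurableT_comp => //.
    exact: (measurable_fun_pair2 (t : T) (measurable_kernel_process j)).
  - by apply: emeasurable_sum.
  - by move=> w _; rewrite sumEFin lee_fin; exact: ler_norm_sum.
rewrite ge0_integral_sum//.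
apply: (@le_trans _ _ (b j)%:E); last first.
  by rewrite lee_fin (bigD1 j)//= lerDl; apply: sumr_ge0.
rewrite /b -sumEFin; apply: lee_sum => l _.
have intE := integrable_kernel_ext hg j l.
apply: (le_trans (mean_random_Rintegral (@ndF l) (@rcF l) (@mF l) (c0 l) (@meanF l)
  (integrable_reflection t intE))).
rewrite lee_fin (Rintegral_reflection t (f := fun r => `|E j l r|))//.
by have := integrable_norm intE.
Qed.

(** [kernel_identity], integrated against dF l and summed over l. *)
Lemma kernel_process_equation s t : s < t -> {ae P, forall w, forall j,
  kernel_process j t w - kernel_process j s w =
    \sum_k \int[sprod (leb_itv s t) (posm (phi j k))]_z kernel_process k (z.1 - z.2) w -
    negmass (phi j j) * \int[leb_itv s t]_u kernel_process j u w + (F j t w - F j s w)}.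
Proof.
move=> st; apply: filter_forall => j.
have h1 : {ae P, forall w, forall l, {ae kappa l w, forall r,
    E j l (t - r) - E j l (s - r) = (j == l)%:R * (\1_(`]s, t]%classic : set R) r) +
    (\sum_k \int[sprod (leb_itv s t) (posm (phi j k))]_z E k l (z.1 - z.2 - r) -
    negmass (phi j j) * \int[leb_itv s t]_u E j l (u - r))}}.
  apply: filter_forall => l.
  exact: (ae_random_ae (@ndF l) (@rcF l) (@mF l) (c0 l) (@meanF l)
    (kernel_identity hdet heta hlambda hg j l st)).
have h2 u : {ae P, forall w, forall l,
    (kappa l w).-integrable setT (EFin \o (fun r => E j l (u - r)))}.
  apply: filter_forall => l.
  have /integrableP[/measurable_EFinP mG Goo] :=
    integrable_reflection u (integrable_kernel_ext hg j l).
  have mn : measurable_fun setT (fun r : T => `|E j l (u - r)|%:E).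
    by apply/measurable_EFinP; exact: measurableT_comp.
  apply: filterS (ae_random_integral_lty (@ndF l) (@rcF l) (@mF l) (c0 l) (@meanF l) mn
    (fun=> normr_ge0 _) Goo) => w h.
  by apply/integrableP; split => //; exact/measurable_EFinP.
have h3 : {ae P, forall w, forall k l,
    (kappa l w \x sprod (leb_itv s t) (posm (phi j k)))%E.-integrable setT
      (EFin \o (fun rz : T * (T * T) => E k l (rz.2.1 - rz.2.2 - rz.1))) /\
    (sprod (leb_itv s t) (posm (phi j k)) \x kappa l w)%E.-integrable setT
      (EFin \o (fun zr : (T * T) * T => E k l (zr.1.1 - zr.1.2 - zr.2)))}.
  apply: filter_forall => k; apply: filter_forall => l.
  have mrho : measurable_fun setT (fun z : T * T => z.1 - z.2 : T).
    by apply: measurable_funB; [exact: measurable_fst|exact: measurable_snd].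
  exact: (ae_random_convolution (@ndF l) (@rcF l) (@mF l) (c0 l) (@meanF l)
    (sprod_lty (leb_itv s t) (posm (phi j k))) mrho (integrable_kernel_ext hg k l)).
have h4 : {ae P, forall w, forall l,
    (kappa l w \x leb_itv s t)%E.-integrable setT
      (EFin \o (fun rz : T * T => E j l (rz.2 - rz.1))) /\
    (leb_itv s t \x kappa l w)%E.-integrable setT
      (EFin \o (fun zr : T * T => E j l (zr.1 - zr.2)))}.
  apply: filter_forall => l.
  have lebfin : (leb_itv s t setT < +oo)%E by rewrite -ge0_fin_numE// fin_num_measure.
  have mid : measurable_fun setT (fun u : T => u : T) by exact: measurable_id.
  exact: (ae_random_convolution (@ndF l) (@rcF l) (@mF l) (c0 l) (@meanF l)
    lebfin mid (integrable_kernel_ext hg j l)).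
apply: filterS2 (filterI h1 (h2 s)) (filterI (h2 t) (filterI h3 h4)).
move=> w [{}h1 hs] [ht [{}h3 {}h4]]; rewrite /kernel_process.
pose m k := sprod (leb_itv s t) (posm (phi j k)).
have step l : \int[kappa l w]_r E j l (t - r) - \int[kappa l w]_r E j l (s - r) =
    (j == l)%:R * (F l t w - F l s w) +
    (\sum_k \int[m k]_z \int[kappa l w]_r E k l (z.1 - z.2 - r) -
     negmass (phi j j) * \int[leb_itv s t]_u \int[kappa l w]_r E j l (u - r)).
  have mI : measurable (`]s, t]%classic : set T) by exact: measurable_itv.
  have i0 : (kappa l w).-integrable setT
      (EFin \o (\1_(`]s, t]%classic : set T) : T -> R)).
    apply/integrableP; split; first by apply/measurable_EFinP; exact: measurable_indic.
    rewrite (eq_integral (fun r : T => (\1_(`]s, t]%classic : set T) r : R)%:E)); last first.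
      by move=> r _; rewrite gee0_abs// lee_fin.
    rewrite integral_indic// setIT.
    by rewrite [X in (X < _)%E]path_measure_oc ?ltry// ltW.
  have i1 : (kappa l w).-integrable setT
      (EFin \o (fun r => (j == l)%:R * (\1_(`]s, t]%classic : set R) r))).
    exact: (integrableZl measurableT (j == l)%:R i0).
  have i2 k : (kappa l w).-integrable setT
      (EFin \o (fun r => \int[m k]_z E k l (z.1 - z.2 - r))).
    exact: (integrable_Rfubini1 (h3 k l).1).
  have i3 : (kappa l w).-integrable setT
      (EFin \o (fun r => \int[leb_itv s t]_u E j l (u - r))).
    exact: (integrable_Rfubini1 (h4 l).1).
  have i3' := integrableZl measurableT (negmass (phi j j)) i3.
  have i2' : (kappa l w).-integrable setT
      (EFin \o (fun r => \sum_k \int[m k]_z E k l (z.1 - z.2 - r))).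
    have i2s := @integrable_sum _ _ _ (kappa l w) setT measurableT _ (index_enum 'I_d)
      xpredT (fun k r => (\int[m k]_z E k l (z.1 - z.2 - r))%:E) (fun k _ => i2 k).
    by apply: eq_integrable i2s => // r _; rewrite /= -sumEFin.
  have i23 := integrableB measurableT i2' i3'.
  have ml : measurable_fun setT (fun r : T => E j l (t - r) - E j l (s - r)).
    by have /integrableP[/measurable_EFinP] := integrableB measurableT (ht l) (hs l).
  have mr : measurable_fun setT (fun r : T => (j == l)%:R * (\1_(`]s, t]%classic : set R) r) +
      (\sum_k \int[m k]_z E k l (z.1 - z.2 - r) -
      negmass (phi j j) * \int[leb_itv s t]_u E j l (u - r)) : R).
    by have /integrableP[/measurable_EFinP] := integrableD measurableT i1 i23.
  rewrite -(RintegralB measurableT (ht l) (hs l)).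
  apply: (etrans (eq_Rintegral_ae ml mr (h1 l))).
  rewrite (RintegralD measurableT i1 i23) (RintegralB measurableT i2' i3').
  rewrite (RintegralZl _ measurableT i0) (RintegralZl _ measurableT i3) (Rintegral_sum i2).
  congr (_ * _ + (_ - _ * _)).
  - rewrite /Rintegral integral_indic// setIT.
    by rewrite [X in fine X]path_measure_oc// ltW.
  - by apply: eq_bigr => k _; exact: (Rintegral_swap (h3 k l).1).
  - exact: (Rintegral_swap (h4 l).1).
rewrite -sumrB (eq_bigr _ (fun l _ => step l)) big_split sumrB/= addrC.
congr (_ - _ + _).
- rewrite exchange_big; apply: eq_bigr => k _; apply/esym; apply: Rintegral_sum => l.
  exact: (integrable_Rfubini1 (h3 k l).2).
- rewrite -mulr_sumr; congr (_ * _); apply/esym; apply: Rintegral_sum => l.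
  exact: (integrable_Rfubini1 (h4 l).2).
- rewrite (bigD1 j)//= eqxx mul1r big1 ?addr0// => l lj.
  by rewrite eq_sym (negbTE lj) mul0r.
Qed.

End kernel_process.

(** * Uniqueness and the moving-average representation *)

Section comparison.
Context {dsp : measure_display} {Omega : measurableType dsp} {R : realType}.
Variables (P : probability Omega R) (d : nat).
Local Notation T := (measurableTypeR R).
Variables (m : 'I_d -> 'I_d -> {finite_measure set T -> \bar R}) (a : 'I_d -> R).
Hypothesis a0 : forall j, 0 <= a j.
Hypothesis sub0 : forall q : 'I_d -> R, (forall j, 0 <= q j) ->
  (forall j, a j * q j <= \sum_k fine (m j k setT) * q k) -> forall j, q j = 0.
Variable f : 'I_d -> R -> R -> Omega -> R.

Definition mean_bounded_solution (D : 'I_d -> R -> Omega -> R) :=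
  [/\ forall j, measurable_fun setT (fun tw : T * Omega => D j tw.1 tw.2),
      exists M, forall j t, (\int[P]_w `|D j t w|%:E <= M%:E)%E &
      forall s t, s < t -> {ae P, forall w, forall j,
        D j t w - D j s w =
          \sum_k \int[sprod (leb_itv s t) (m j k)]_z D k (z.1 - z.2) w -
          a j * \int[leb_itv s t]_u D j u w + f j s t w}].

(** The difference is a mean-bounded solution with zero forcing. *)
Lemma mean_bounded_solution_le (D D' : 'I_d -> R -> Omega -> R) t :
  mean_bounded_solution D -> mean_bounded_solution D' ->
  {ae P, forall w, forall j, D' j t w <= D j t w}.
Proof.
move=> [mD [M bD] eqD] [mD' [M' bD'] eqD'].
have mt j u : measurable_fun setT (D j u) by exact: (measurable_fun_pair2 (u : T) (mD j)).
have mt' j u : measurable_fun setT (D' j u) by exact: (measurable_fun_pair2 (u : T) (mD' j)).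
pose B j u w := D j u w - D' j u w.
have mB j : measurable_fun setT (fun tw : T * Omega => B j tw.1 tw.2).
  exact: measurable_funB.
have bB j u : (\int[P]_w `|B j u w|%:E <= (M + M')%:E)%E.
  apply: (@le_trans _ _ (\int[P]_w (`|D j u w|%:E + `|D' j u w|%:E))%E).
    apply: ge0_le_integral => //.
    - by apply: measurable_normr_EFin; exact: measurable_funB.
    - by apply: emeasurable_funD; exact: measurable_normr_EFin.
    - by move=> w _; rewrite -EFinD lee_fin; exact: ler_normB.
  rewrite ge0_integralD//; [|exact: measurable_normr_EFin..].
  by rewrite EFinD; exact: leeD.
suff : {ae P, forall w, forall j, 0 <= B j t w}.
  by apply: filterS => w h j; rewrite -subr_ge0; exact: h.
apply: (@delay_equation_nonneg _ _ _ P d m a a0 B mB (M + M') bB sub0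
  (fun _ _ _ _ => 0) 0) => //.
- by move=> j s u _; rewrite integral0_eq ?mul0r// => w _; rewrite normr0.
- by move=> s u _; apply: aeW => w.
move=> s u su.
have ip : {ae P, forall w, forall j k,
    (sprod (leb_itv s u) (m j k)).-integrable setT
      (EFin \o (fun z : T * T => D k (z.1 - z.2) w)) /\
    (sprod (leb_itv s u) (m j k)).-integrable setT
      (EFin \o (fun z : T * T => D' k (z.1 - z.2) w))}.
  apply: filter_forall => j; apply: filter_forall => k.
  by apply: filterS2 (ae_integrable_prod m mD bD s u j k)
    (ae_integrable_prod m mD' bD' s u j k) => w.
have ii : {ae P, forall w, forall k,
    (leb_itv s u).-integrable setT (EFin \o D k ^~ w) /\
    (leb_itv s u).-integrable setT (EFin \o D' k ^~ w)}.
  apply: filter_forall => k.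
  by apply: filterS2 (ae_integrable_itv mD bD s u k) (ae_integrable_itv mD' bD' s u k) => w.
apply: filterS2 (filterI (eqD s u su) (eqD' s u su)) (filterI ip ii).
move=> w [e e'] [{}ip {}ii] j; rewrite /B.
rewrite (_ : \sum_k _ = \sum_k (\int[sprod (leb_itv s u) (m j k)]_z D k (z.1 - z.2) w -
    \int[sprod (leb_itv s u) (m j k)]_z D' k (z.1 - z.2) w)); last first.
  by apply: eq_bigr => k _; have [? ?] := ip j k; rewrite RintegralB.
have [i1 i2] := ii j; rewrite (RintegralB measurableT i1 i2) sumrB.
have := e j; have := e' j; lra.
Qed.

End comparison.

Section regular_version.
Context {dsp : measure_display} {Omega : measurableType dsp} {R : realType}.
Variables (P : probability Omega R) (d : nat) (L : process P d).
Hypothesis hL : two_sided_subordinator L.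

(** Replacing the paths by 0 on a measurable null set makes every path
    non-decreasing and right-continuous, so that path measures are defined
    everywhere. *)
Lemma regular_paths : exists F : 'I_d -> R -> Omega -> R,
  [/\ forall l w, nondecreasing (F l ^~ w), forall l w, right_continuous (F l ^~ w),
      forall l r, measurable_fun setT (F l r) &
      {ae P, forall w, forall l r, F l r w = L l r w}].
Proof.
have [N [mN N0 bad]] := two_sided_paths hL.
have good w : ~ N w -> forall j,
    nondecreasing (fun t => L j t w) /\ right_continuous (fun t => L j t w).
  by move=> Nw; apply: contrapT => h; apply: Nw; exact: bad.
pose F (l : 'I_d) (r : R) w : R := L l r w * \1_(~` N) w.
have Fbad l w : N w -> F l ^~ w = (fun=> 0).
  by move=> Nw; apply/funext => r; rewrite /F indicE memNset ?mulr0// => /(_ Nw).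
have Fgood l w : ~ N w -> F l ^~ w = (fun r => L l r w).
  by move=> Nw; apply/funext => r; rewrite /F indicE mem_set// mulr1.
exists F; split.
- move=> l w; have [Nw|Nw] := pselect (N w); first by rewrite Fbad.
  by rewrite Fgood//; have [] := good w Nw l.
- move=> l w; suff : exists2 f : R -> R, F l ^~ w = f & right_continuous f.
    by case=> f /(congr1 (fun h : R -> R => right_continuous h)) ->.
  have [Nw|Nw] := pselect (N w).
    by exists (fun _ : R => 0 : R); [exact: Fbad|move=> r; exact: cvg_cst].
  by exists (fun r => L l r w); [exact: Fgood|have [] := good w Nw l].
- move=> l r; apply: measurable_funM; first exact: measurable_process.
  by apply: measurable_indic; exact: measurableC.
- exists N; split => // w /= h; apply: contrapT => Nw; apply: h => l r.
  by rewrite -[LHS]/((F l ^~ w) r) Fgood.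
Qed.

End regular_version.

Section representation.
Context {dsp : measure_display} {Omega : measurableType dsp} {R : realType}.
Variables (P : probability Omega R) (d : nat) (L : process P d).
Local Notation T := (measurableTypeR R).
Hypothesis hL : two_sided_subordinator L.
Hypothesis hL1 : finite_first_moment L 1.
Variable phi : 'M[signed_measure R]_d.
Hypothesis hphi2 : forall j k,
  (\int[abs_measure (phi j k)]_(t in `[0%R, +oo[) (t ^+ 2)%:E < +oo)%E.
Hypothesis hdet : forall z : R[i], 0 <= complex.Re z -> \det (h_phi phi z) != 0.
Hypothesis heta : forall j k (A : set T), measurable A -> (0 <= eta_mx phi j k A)%E.
Hypothesis hlambda : M_matrix (lambda_mx phi).
Variable X : process P d.
Hypothesis hX : solution phi L X.
Variable g : R -> 'M[R]_d.
Hypothesis hg : is_kernel phi g.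

(** X and Z both are mean-bounded solutions with the increments of L as
    forcing, so each dominates the other. *)
Lemma solution_moving_average t :
  {ae P, forall w, forall j, X j t w = moving_average g L j t w}.
Proof.
have [F [ndF rcF mF FL]] := regular_paths hL.
have [c [c0 meanL]] := two_sided_mean hL hL1.
have meanF l a b : a <= b ->
    (\int[P]_w (F l b w - F l a w)%:E = (c l * (b - a))%:E)%E.
  move=> ab; rewrite -meanL//; apply: ge0_ae_eq_integral => //.
  - by apply/measurable_EFinP; exact: measurable_funB.
  - by apply: measurable_normr_EFin; apply: measurable_funB; exact: measurable_process.
  - by move=> w _; rewrite lee_fin subr_ge0; exact: ndF.
  apply: filterS FL => w e _; rewrite -!e ger0_norm// subr_ge0; exact: ndF.
pose Z := kernel_process g ndF rcF.
have [mX _ _ _] := hX.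
pose N j s u w := L j u w - L j s w.
have solX : mean_bounded_solution P (fun j k => posm (phi j k))
    (fun j => negmass (phi j j)) N (fun j u w => X j u w).
  by split => //; [exact: (solution_mean_bounded hX)|exact: (solution_equation heta hlambda hX)].
have solZ : mean_bounded_solution P (fun j k => posm (phi j k))
    (fun j => negmass (phi j j)) N Z.
  split.
  - exact: (measurable_kernel_process hg ndF rcF mF).
  - exact: (kernel_process_mean_bounded hg ndF rcF mF c0 meanF).
  move=> s u su.
  apply: filterS2 (kernel_process_equation hdet heta hlambda hg ndF rcF mF c0 meanF su) FL.
  by move=> w e h j; rewrite e !h.
have a0 (j : 'I_d) : 0 <= negmass (phi j j) by exact: negmass_ge0.
have sub0 := subinvariant_eq0 hphi2 hdet heta hlambda.
have ge := mean_bounded_solution_le a0 sub0 t solX solZ.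
have le := mean_bounded_solution_le a0 sub0 t solZ solX.
apply: filterS3 ge le FL => w ge le FLw j.
transitivity (Z j t w); first by apply/eqP; rewrite eq_le le ge.
apply: eq_bigr => l _.
rewrite (_ : (fun s => L l s w) = F l ^~ w); last by apply/funext => s; rewrite FLw.
rewrite stieltjes_path [RHS]Rintegral_mkcond; apply: eq_Rintegral => r _.
by rewrite patchE /kernel_ext mem_setE in_itv/= subr_ge0.
Qed.

End representation.

Unset Implicit Arguments.
Set Strict Implicit.
Set Printing Implicit Defensive.

Theorem theorem4p1 (dsp : measure_display) (Omega : measurableType dsp)
    (R : realType) (P : probability Omega R) (d : nat) (hd : (2 <= d)%N)
    (L : process P d) (hL : two_sided_subordinator L)
    (hL1 : finite_first_moment L 1)
    (phi : 'M[signed_measure R]_d)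
    (hphi : forall j k, concentrated_nonneg (phi j k))
    (hphi2 : forall j k,
       (\int[abs_measure (phi j k)]_(t in `[0%R, +oo[) (t ^+ 2)%:E < +oo)%E)
    (hdet : forall z : R[i], 0 <= complex.Re z -> \det (h_phi phi z) != 0)
    (heta : forall j k (A : set (measurableTypeR R)),
       measurable A -> (0 <= eta_mx phi j k A)%E)
    (hlambda : M_matrix (lambda_mx phi)) :
  forall X : process P d, solution phi L X ->
    (forall g : R -> 'M[R]_d, is_kernel phi g ->
       forall t, {ae P, forall w, forall j, X j t w = moving_average g L j t w}) /\
    (forall t, {ae P, forall w, forall j, 0 <= X j t w}).
Proof.
move=> X hX; split=> [g hg t|t].
- exact: (solution_moving_average hL hL1 hphi2 hdet heta hlambda hX hg).
- exact: (solution_nonneg heta hlambda hX hphi2 hdet hL hL1).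
Qed.
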